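(* Suppose that $(A,A^+)$ is a right-angled Artin group that has no direct factor $(\mathbb Z,\mathbb N)$. Then $C(\partial\Omega)\rtimes A$ is purely infinite and simple, where $\partial\Omega$ is the boundary spectrum of $(A,A^+)$.
   Context: Right-angled Artin groups: for a simplicial graph $\Gamma$ with countable vertex set $S$, $A=\langle S \mid ab=ba \text{ if } \{a,b\}\text{ is an edge of }\Gamma\rangle$ and $A^+$ is the submonoid generated by $S$. ''No direct factor $(\mathbb Z,\mathbb N)$'' means that $(A,A^+)$ is not isomorphic, as a partially ordered group, to a direct sum $(\mathbb Z,\mathbb N)\oplus(G',P')$; equivalently, the opposite (complementary) graph $\Gamma^{\rm opp}$ has no isolated vertices, i.e. no vertex of $\Gamma$ is adjacent to all other vertices. The pair $(G,P)=(A,A^+)$ is quasi-lattice ordered: $P\cap P^{-1}=\{e\}$, and with the left-invariant partial order $x\le y\iff x^{-1}y\in P$ every two elements with a common upper bound have a least upper bound $x\vee y$. Nica spectrum: $\Omega$ is the set of $\omega\subset G$ with $e\in\omega$ that are hereditary ($\omega P^{-1}\subset\omega$) and directed ($x\vee y$ exists and lies in $\omega$ for $x,y\in\omega$), with the (compact Hausdorff) topology from $\{0,1\}^G$. $G$ acts partially on $\Omega$ by $\theta_t:U_{t^{-1}}\to U_t$, $\omega\mapsto t\omega$, where $U_t=\{\omega:t\in\omega\}$. The boundary spectrum $\partial\Omega$ is the closure in $\Omega$ of the set of maximal directed subsets of $G$ containing $e$ (these are automatically hereditary); it is closed and invariant. Crossed product: with $D_t=C_0(U_t\cap\partial\Omega)$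 and $\alpha_t:D_{t^{-1}}\to D_t$, $f\mapsto f\circ\theta_{t^{-1}}$, $C(\partial\Omega)\rtimes G$ is the full partial crossed product: the universal C*-completion of finite sums $\sum f_t\delta_t$, $f_t\in D_t$, with $(f\delta_s)(g\delta_t)=\alpha_s(\alpha_{s^{-1}}(f)g)\delta_{st}$ and $(f\delta_t)^*=\alpha_{t^{-1}}(\bar f)\delta_{t^{-1}}$. ''Purely infinite'' has its standard meaning for simple C*-algebras: every nonzero hereditary C*-subalgebra contains an infinite projection. *)

(* Defs.v *)
From HB Require Import structures.
From mathcomp Require Import all_boot all_order all_algebra.
From mathcomp Require Import generic_quotient finmap complex.
From mathcomp Require Import all_classical all_reals all_analysis.

Set Implicit Arguments.
Unset Strict Implicit.
Unset Printing Implicit Defensive.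

Import Order.TTheory GRing.Theory Num.Theory numFieldNormedType.Exports.

Local Open Scope classical_set_scope.
Local Open Scope quotient_scope.
Local Open Scope ring_scope.

(* The complex numbers are bundled as a numClosedFieldType so that the         *)
(* topology and normed-module structure that numFieldNormedType puts on every  *)
(* numeric field is found by inference.                                        *)
Definition Cplx (R : realType) : numClosedFieldType := R[i].
Arguments Cplx : simpl never.

(* The product is not required to have a unit. *)
HB.mixin Record isStarAlgebra (C : numClosedFieldType) A
    of GRing.Lmodule C A := {
  smul : A -> A -> A;
  star : A -> A;
  smulA : forall a b c, smul a (smul b c) = smul (smul a b) c;
  smulDl : forall a b c, smul (a + b) c = smul a c + smul b c;
  smulDr : forall a b c, smul a (b + c) = smul a b + smul a c;
  smulZl : forall (k : C) a b, smul (k *: a) b = k *: smul a b;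
  smulZr : forall (k : C) a b, smul a (k *: b) = k *: smul a b;
  starK : forall a, star (star a) = a;
  starD : forall a b, star (a + b) = star a + star b;
  starZ : forall (k : C) a, star (k *: a) = k^* *: star a;
  starM : forall a b, star (smul a b) = smul (star b) (star a)
}.

#[short(type="starAlgType")]
HB.structure Definition StarAlgebra (C : numClosedFieldType) :=
  {A of isStarAlgebra C A & GRing.Lmodule C A}.

HB.mixin Record StarAlgebra_isCStar (C : numClosedFieldType) A
    of StarAlgebra C A & CompleteNormedModule C A := {
  normr_smul : forall a b : A, `|smul a b| <= `|a| * `|b|;
  normr_star_smul : forall a : A, `|smul (star a) a| = `|a| ^+ 2
}.

#[short(type="cstarAlgType")]
HB.structure Definition CStarAlgebra (C : numClosedFieldType) :=
  {A of StarAlgebra_isCStar C A & StarAlgebra C A & CompleteNormedModule C A}.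

Section CStarTheory.
Variable C : numClosedFieldType.

Definition star_hom (A B : starAlgType C) (f : A -> B) : Prop :=
  [/\ forall (k : C) a b, f (k *: a + b) = k *: f a + f b,
      forall a b, f (smul a b) = smul (f a) (f b) &
      forall a, f (star a) = star (f a)].

(* The factor g is automatically unique, because i has dense range and         *)
(* *-homomorphisms between C*-algebras are continuous.                         *)
Definition universal_cstar_completion (A : starAlgType C)
    (B : cstarAlgType C) (i : A -> B) : Prop :=
  [/\ star_hom i,
      closure (range i) = [set: B] &
      forall (D : cstarAlgType C) (f : A -> D), star_hom f ->
        exists2 g : B -> D, star_hom g & forall a, g (i a) = f a].

Variable B : cstarAlgType C.
Implicit Types (I H : set B) (a b c p q v : B).

Definition subspace_of I : Prop :=
  I 0 /\ forall (k : C) a b, I a -> I b -> I (k *: a + b).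

Definition closed_ideal I : Prop :=
  [/\ closed I, subspace_of I &
      forall a b, I b -> I (smul a b) /\ I (smul b a)].

Definition simple_cstar : Prop :=
  (exists a : B, a != 0) /\
  forall I, closed_ideal I -> I = [set 0] \/ I = [set: B].

Definition cstar_positive a : Prop := exists c, a = smul (star c) c.

Definition cstar_le a b : Prop := cstar_positive (b - a).

Definition cstar_subalgebra H : Prop :=
  [/\ closed H, subspace_of H,
      forall a b, H a -> H b -> H (smul a b) &
      forall a, H a -> H (star a)].

Definition hereditary_subalgebra H : Prop :=
  cstar_subalgebra H /\
  forall a b, H b -> cstar_le 0 a -> cstar_le a b -> H a.

Definition projection p : Prop := star p = p /\ smul p p = p.

(* p is Murray-von Neumann equivalent to a proper subprojection of itself.     *)
Definition infinite_projection p : Prop :=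
  projection p /\
  exists v, let q := smul v (star v) in
    [/\ smul (star v) v = p, projection q, cstar_le q p & q <> p].

Definition purely_infinite : Prop :=
  forall H, hereditary_subalgebra H -> (exists2 a, H a & a != 0) ->
  exists2 p, H p & infinite_projection p.

End CStarTheory.

(* Subsets of G with the topology of {0,1}^G. *)
Definition subsets (G : groupType) : topologicalType :=
  prod_topology (fun _ : G => bool).

Section Spectrum.
Variables (G : groupType) (P : set G).
Implicit Types (w : subsets G) (x y z t : G).
Local Open Scope group_scope.

Definition po_le x y : Prop := P (x^-1 * y).

Definition is_join x y z : Prop :=
  [/\ po_le x z, po_le y z &
      forall u, po_le x u -> po_le y u -> po_le z u].

Definition hereditary w : Prop :=
  forall x p, w x -> P p -> w (x * p^-1).

Definition directed w : Prop :=
  forall x y, w x -> w y -> exists2 z, is_join x y z & w z.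

Definition nica_spectrum : set (subsets G) :=
  [set w : subsets G | [/\ w 1, hereditary w & directed w]].

Definition maximal_directed : set (subsets G) :=
  [set w : subsets G | [/\ w 1, directed w &
      forall w' : subsets G, directed w' -> (forall x, w x -> w' x) -> w' = w]].

Definition boundary_spectrum : set (subsets G) :=
  nica_spectrum `&` closure maximal_directed.

Definition translate t w : subsets G := fun x => w (t^-1 * x).

Lemma translateK t : cancel (translate t) (translate t^-1).
Proof.
by move=> w; apply/funext => x; rewrite /translate invgK mulgA mulVg mul1g.
Qed.

Lemma translateVK t : cancel (translate t^-1) (translate t).
Proof. by move=> w; rewrite -{1}(invgK t) translateK. Qed.

Lemma translateM s t w : translate (s * t) w = translate s (translate t w).
Proof. by apply/funext => x; rewrite /translate invgM mulgA. Qed.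

Lemma po_le_mul t x y : po_le (t * x) (t * y) <-> po_le x y.
Proof. by rewrite /po_le invgM -mulgA (mulgA t^-1) mulVg mul1g. Qed.

Lemma is_join_mul t x y z : is_join x y z -> is_join (t * x) (t * y) (t * z).
Proof.
move=> [xz yz xyz]; split; [exact/po_le_mul|exact/po_le_mul|] => u.
rewrite -(mulVKg t u) !po_le_mul; exact: xyz.
Qed.

Lemma directed_translate t w : directed w -> directed (translate t w).
Proof.
move=> dw x y wx wy; have [z xyz wz] := dw _ _ wx wy.
exists (t * z); last by rewrite /translate mulKg.
by have := is_join_mul t xyz; rewrite !mulVKg.
Qed.

Lemma translate_nica t w :
  nica_spectrum w -> w t^-1 -> nica_spectrum (translate t w).
Proof.
move=> [w1 hw dw] wt; split; first by rewrite /translate mulg1.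
  by move=> x p wx Pp; rewrite /translate mulgA; exact: hw.
exact: directed_translate.
Qed.

Lemma translate_maximal t w :
  maximal_directed w -> w t^-1 -> maximal_directed (translate t w).
Proof.
move=> [w1 dw mw] wt; split; first by rewrite /translate mulg1.
  exact: directed_translate.
move=> w' dw' sw'; rewrite -[LHS](translateVK t); congr translate.
apply: mw; first exact: directed_translate.
move=> x wx; rewrite /translate invgK; apply: sw'.
by rewrite /translate mulKg.
Qed.

Lemma subsets_cvg (F : set_system (subsets G)) w : Filter F ->
  (forall x, \forall w' \near F, w' x = w x) -> F --> w.
Proof.
move=> FF Fw; apply/cvg_sup => x A [V [[U oU] <-]] /= Ux UA.
by apply: filterS (Fw x) => w' w'x; apply: UA; rewrite /= w'x.
Qed.

Lemma near_subsets w x : \forall w' \near w, w' x = w x.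
Proof.
have h : nbhs (w x) [set b | b = w x] by exact: discrete_set1.
exact: (@proj_continuous G (fun _ => bool) x w _ h).
Qed.

Lemma translate_continuous t : continuous (translate t).
Proof.
by move=> w; apply: subsets_cvg => x; exact: near_subsets.
Qed.

Lemma translate_boundary t w :
  boundary_spectrum w -> w t^-1 -> boundary_spectrum (translate t w).
Proof.
move=> [nw cw] wt; split; first exact: translate_nica.
move=> A /translate_continuous nA.
have {}nA : \forall w' \near w, A (translate t w') by exact: nA.
have [w' [mw' [Aw' wt']]] := cw _ (filterI nA (near_subsets w t^-1)).
by exists (translate t w'); split => //; apply: translate_maximal; rewrite // wt'.
Qed.

Definition boundary : topologicalType := set_type boundary_spectrum.
Definition bval (x : boundary) : subsets G := set_val x.

Lemma boundary_translateP t w : boundary_spectrum w ->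
  boundary_spectrum (translate t^-1 w) <-> w t.
Proof.
move=> bw; split; last by move=> wt; apply: translate_boundary; rewrite ?invgK.
by case=> -[]; rewrite /translate invgK mulg1.
Qed.

End Spectrum.

Section PartialAction.
Variables (R : realType) (G : groupType) (P : set G).
Local Notation C := (Cplx R).
Local Notation X := (boundary P).
Implicit Types (s t r : G) (x y : X) (f g : X -> C).
Local Open Scope group_scope.

(* The partial homeomorphism theta_t, None outside its domain U_{t^-1}.        *)
Definition theta t x : option X :=
  if bval x t^-1 then
    insub (translate t (bval x)) : option (set_type (boundary_spectrum P))
  else None.

Lemma isSome_theta t x : theta t x = bval x t^-1 :> bool.
Proof.
rewrite /theta; case: ifPn => // xt; case: insubP => //= /negP[].
by rewrite inE; apply: translate_boundary => //; exact: set_valP.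
Qed.

(* C_0 of the open subset U_t of the compact space boundary P, its functions   *)
(* being extended by zero.                                                     *)
Definition dom_ideal t : set (X -> C) :=
  [set f | continuous f /\ forall x, ~~ bval x t -> f x = 0%R].

Definition alpha t f : X -> C :=
  fun x => if theta t^-1 x is Some y then f y else 0%R.

(* Extension by zero of a function on the boundary to all subsets of G. *)
Definition extend f (w : subsets G) : C :=
  if (insub w : option (set_type (boundary_spectrum P))) is Some y then f y
  else 0%R.

Lemma extend_val f x : extend f (bval x) = f x.
Proof. by rewrite /extend valK. Qed.

Lemma extend_out f w : ~ boundary_spectrum P w -> extend f w = 0%R.
Proof. by move=> bw; rewrite /extend insubN //; apply/negP => /set_mem. Qed.

Lemma bdryP x : boundary_spectrum P (bval x).
Proof. exact: set_valP. Qed.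

Lemma alphaE t f x : alpha t f x = extend f (translate t^-1 (bval x)).
Proof.
rewrite /alpha /theta invgK; case: ifPn => // xt; rewrite extend_out //.
by move/(boundary_translateP _ (bdryP x)); rewrite (negbTE xt).
Qed.

Lemma inbdryP w : boundary_spectrum P w -> exists x, w = bval x.
Proof. by move=> /mem_set bw; exists (exist _ w bw). Qed.

Lemma near_bdry x t : \forall x' \near x, bval x' t = bval x t.
Proof.
exact: (@initial_continuous _ _ (@bval G P) x _
  (near_subsets (bval x) t)).
Qed.

Lemma extend_alpha t f w : boundary_spectrum P w ->
  extend (alpha t f) w = extend f (translate t^-1 w).
Proof. by move=> /inbdryP[x ->]; rewrite extend_val alphaE. Qed.

Lemma alpha_continuous t f : continuous f -> continuous (alpha t f).
Proof.
move=> cf x; have [xt|xt] := boolP (bval x t); last first.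
  have a0 x' : ~~ bval x' t -> alpha t f x' = 0%R.
    by rewrite /alpha /theta invgK => /negbTE ->.
  have ax : \forall x' \near x, alpha t f x' = 0%R.
    by near=> x'; apply: a0; rewrite (near (near_bdry x t)).
  rewrite /continuous_at a0 //.
  exact: (@cvg_near_cst _ _ _ _ _ (nbhs_filter x) ax).
have [y yx] : exists y, translate t^-1 (bval x) = bval y.
  apply/inbdryP/translate_boundary; [exact: bdryP | by rewrite invgK].
rewrite /continuous_at alphaE yx extend_val => V /cf [_ [[W oW <-] Wy] WV].
have cx : {for x, continuous (translate t^-1 \o @bval G P)}.
  apply: continuous_comp; last exact: translate_continuous.
  exact: initial_continuous.
have Wx : \forall x' \near x, W (translate t^-1 (bval x')).
  apply: cx; apply: open_nbhs_nbhs; split => //.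
  by rewrite /= yx.
suff: \forall x' \near x, V (alpha t f x') by exact.
near=> x'; rewrite alphaE.
have [y' y'x] : exists y, translate t^-1 (bval x') = bval y.
  apply/inbdryP/translate_boundary; first exact: bdryP.
  by rewrite invgK (near (near_bdry x t)).
rewrite y'x extend_val; apply: WV; rewrite /= -[set_val y']/(bval y') -y'x.
by near: x'.
Unshelve. all: by end_near.
Qed.

Lemma alpha_dom t f : dom_ideal t^-1 f -> dom_ideal t (alpha t f).
Proof.
move=> [cf _]; split=> [|x xt]; first exact: alpha_continuous.
by rewrite /alpha /theta invgK (negbTE xt).
Qed.

Lemma alphaK t f : dom_ideal t f -> alpha t (alpha t^-1 f) = f.
Proof.
move=> [_ f0]; apply/funext => x; rewrite alphaE.
have [xt|xt] := boolP (bval x t).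
  rewrite extend_alpha; last by apply/boundary_translateP => //; exact: bdryP.
  by rewrite invgK translateVK extend_val.
rewrite extend_out ?f0 // => /boundary_translateP; rewrite (negbTE xt).
by move=> /(_ (bdryP x)).
Qed.

(* The finite sums sum_t (a t) delta_t with a t in C_0 (U_t). *)
Definition finite_sum : {pred G -> X -> C} := fun a =>
  `[< finite_set [set t | a t <> 0%R] /\ forall t, dom_ideal t (a t) >].

Lemma dom_ideal0 t : dom_ideal t 0%R.
Proof.
by split=> [|//]; exact: (@cst_continuous X C 0%R).
Qed.

Lemma dom_idealD t (k : C) f g :
  dom_ideal t f -> dom_ideal t g -> dom_ideal t (k *: f + g)%R.
Proof.
move=> [cf f0] [cg g0]; split=> [x|x xt].
  apply: (@continuousD C C X (k \*: f) g); last exact: cg.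
  by apply: (@continuousZl_tmp C C X); exact: cf.
by rewrite -[LHS]/(k *: f x + g x)%R f0 ?g0 // scaler0 addr0.
Qed.

Lemma finite_sum_submod : submod_closed finite_sum.
Proof.
split=> [|k a b /asboolP[fa da] /asboolP[fb db]]; apply/asboolP.
  by split=> [|t]; [rewrite (_ : [set _ | _] = set0) //; apply/seteqP; split|
    exact: dom_ideal0].
split=> [|t]; last exact: dom_idealD.
apply: sub_finite_set (_ : finite_set ([set t | a t <> 0%R] `|`
  [set t | b t <> 0%R])); last by rewrite finite_setU.
move=> t /= abt; have [at0|] := pselect (a t = 0%R); last by left.
have [bt0|] := pselect (b t = 0%R); last by right.
by case: abt; rewrite -[LHS]/(k *: a t + b t)%R at0 bt0 scaler0 addr0.
Qed.

HB.instance Definition _ :=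
  GRing.isSubmodClosed.Build C (G -> X -> C) finite_sum finite_sum_submod.

Record crossed_sums := CrossedSums {
  crossed_val :> G -> X -> C;
  crossed_valP : crossed_val \in finite_sum }.
HB.instance Definition _ := [isSub for crossed_val].
HB.instance Definition _ := [Choice of crossed_sums by <:].
HB.instance Definition _ := [SubChoice_isSubLmodule of crossed_sums by <:].

Definition sums_mul (a b : G -> X -> C) : G -> X -> C := fun r x =>
  (\sum_(s \in [set: G])
    alpha s (fun y => alpha s^-1%g (a s) y * b (s^-1 * r)%g y) x)%R.

Definition sums_star (a : G -> X -> C) : G -> X -> C := fun r =>
  alpha r (fun y => ((a r^-1%g y)^*)%R).

Definition delta t f : G -> X -> C := fun r => if r == t then f else 0%R.

Lemma alpha0 t : alpha t 0%R = 0%R.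
Proof. by apply/funext => x; rewrite /alpha; case: theta. Qed.

Lemma sums_mul_delta s t f g :
  sums_mul (delta s f) (delta t g) =
  delta (s * t) (alpha s (fun y => alpha s^-1%g f y * g y)%R).
Proof.
apply/funext => r; apply/funext => x; rewrite /sums_mul (fsbigTE [fset s]%fset).
  rewrite big_seq_fset1 /delta eqxx.
  have -> : (s^-1 * r == t) = (r == s * t).
    by apply/eqP/eqP => [<-|->]; rewrite ?mulVKg ?mulKg.
  case: eqP => // _; transitivity (alpha s 0%R x); last by rewrite alpha0.
  by congr alpha; apply/funext => y; exact: mulr0.
move=> u; rewrite inE => us; rewrite /delta (negbTE us) !alpha0.
transitivity (alpha u 0%R x); last by rewrite alpha0.
by congr alpha; apply/funext => y; exact: mul0r.
Qed.

Lemma sums_star_delta t f :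
  sums_star (delta t f) = delta t^-1 (alpha t^-1 (fun y => ((f y)^*)%R)).
Proof.
apply/funext => r; rewrite /sums_star /delta (can2_eq invgK invgK).
case: eqP => [-> //|_]; rewrite -[RHS](alpha0 r); congr alpha.
by apply/funext => y; exact: conjC0.
Qed.

Lemma crossed_dom (a : crossed_sums) t : dom_ideal t (a t).
Proof. by have /asboolP[] := crossed_valP a. Qed.

Definition supp (a : crossed_sums) : {fset G} :=
  fset_set [set t | a t <> 0%R].

Lemma suppP (a : crossed_sums) t : t \notin supp a -> a t = 0%R.
Proof.
have /asboolP[fa _] := crossed_valP a.
rewrite /supp in_fset_set // => /negP ta; apply: contrapT => at0.
by apply: ta; rewrite inE.
Qed.

Lemma extend0 w : extend 0%R w = 0%R.
Proof. by rewrite /extend; case: insub. Qed.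

Lemma inbdry_translate x t :
  bval x t -> exists y, translate t^-1 (bval x) = bval y.
Proof.
move=> xt; apply/inbdryP/translate_boundary; first exact: bdryP.
by rewrite invgK.
Qed.

Lemma sums_mul_term (a b : crossed_sums) s r x :
  alpha s (fun y => alpha s^-1 (a s) y * b (s^-1 * r)%g y)%R x =
  (a s x * extend (b (s^-1 * r)%g) (translate s^-1%g (bval x)))%R.
Proof.
rewrite alphaE; have [xs|xs] := boolP (bval x s).
  have [y yx] := inbdry_translate xs; rewrite yx !extend_val alphaE -yx invgK.
  by rewrite translateVK extend_val.
have [_ -> //] := crossed_dom a s; rewrite mul0r extend_out //.
by move=> /(boundary_translateP _ (bdryP x)); rewrite (negbTE xs).
Qed.

Lemma sums_mulE (a b : crossed_sums) r x : sums_mul a b r x =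
  (\sum_(s \in [set: G])
    a s x * extend (b (s^-1 * r)%g) (translate s^-1%g (bval x)))%R.
Proof. by apply: eq_fsbigr => s _; exact: sums_mul_term. Qed.

Lemma sums_mul_proof (a b : crossed_sums) : sums_mul a b \in finite_sum.
Proof.
apply/asboolP; split=> [|r].
  pose A := [set t | a t <> 0%R]; pose B := [set t | b t <> 0%R].
  apply: sub_finite_set (_ : finite_set [set s * t | s in A & t in B]).
    move=> r /= abr; apply: contrapT => AB; apply: abr.
    apply/funext => x; rewrite sums_mulE fsbig1 // => s _.
    have [as0|As] := pselect (a s = 0%R); first by rewrite as0 mul0r.
    have [bs0|Bs] := pselect (b (s^-1 * r) = 0%R).
      by rewrite bs0 extend0 mulr0.
    by case: AB; exists s => //; exists (s^-1 * r) => //; rewrite mulVKg.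
  have /asboolP[fa _] := crossed_valP a; have /asboolP[fb _] := crossed_valP b.
  exact: finite_image2.
have -> : sums_mul a b r = (\sum_(s <- supp a)
    alpha s (fun y => alpha s^-1 (a s) y * b (s^-1 * r)%g y))%R.
  apply/funext => x; rewrite fct_sumE /sums_mul (fsbigTE (supp a)) // => s sa.
  rewrite alphaE (_ : (fun y => _) = 0%R) ?extend0 //; apply/funext => y.
  by rewrite (suppP sa) alphaE extend0 mul0r.
elim/big_ind: _ => [|f g df dg|s _]; first exact: dom_ideal0.
  by rewrite -[f]scale1r; exact: dom_idealD.
split=> [|x xr].
  apply: alpha_continuous => y; apply: (@continuousM C X).
    by apply: alpha_continuous; have [] := crossed_dom a s.
  by case: (crossed_dom b (s^-1 * r)%g) => cb _; exact: cb.
rewrite sums_mul_term; have [xs|xs] := boolP (bval x s); last first.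
  by have [_ a0] := crossed_dom a s; rewrite a0 // mul0r.
have [y yx] := inbdry_translate xs.
rewrite yx extend_val; have [_ b0] := crossed_dom b (s^-1 * r)%g.
rewrite b0 ?mulr0 //.
by rewrite -yx /translate invgK mulVKg.
Qed.

Lemma conj_continuous : continuous (fun z : C => z^*%R).
Proof.
move=> z; apply/(@cvgrPdist_lt C C C (nbhs z) _) => e e0.
near=> w; rewrite -rmorphB norm_conjC; near: w.
by move: e e0; apply/(@cvgrPdist_lt C C C (nbhs z) _); exact: cvg_id.
Unshelve. all: by end_near.
Qed.

Lemma sums_star_proof (a : crossed_sums) : sums_star a \in finite_sum.
Proof.
apply/asboolP; split=> [|r].
  have /asboolP[fa _] := crossed_valP a.
  apply: sub_finite_set (finite_image (fun t => t^-1) fa) => r /= ar.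
  exists r^-1; last by rewrite invgK.
  move=> a0; apply: ar; apply/funext => x; rewrite /sums_star alphaE a0.
  rewrite (_ : (fun y => _) = 0%R) ?extend0 //.
  by apply/funext => y; exact: conjC0.
apply: alpha_dom; have [ca a0] := crossed_dom a r^-1; split=> [x|x xr].
  apply: (@continuous_comp X C C); [exact: ca | exact: conj_continuous].
by rewrite a0 // conjC0.
Qed.

Definition crossed_mul (a b : crossed_sums) :=
  CrossedSums (sums_mul_proof a b).
Definition crossed_star (a : crossed_sums) := CrossedSums (sums_star_proof a).

Lemma crossed_eq (a b : crossed_sums) : (forall r x, a r x = b r x) -> a = b.
Proof.
by move=> ab; apply: val_inj; apply/funext => r; apply/funext => x; exact: ab.
Qed.

Lemma crossed_valD (a b : crossed_sums) t : (a + b)%R t = (a t + b t)%R.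
Proof. by []. Qed.

Lemma crossed_valZ (k : C) (a : crossed_sums) t : (k *: a)%R t = (k *: a t)%R.
Proof. by []. Qed.

Lemma extendD f g w : extend (f + g)%R w = (extend f w + extend g w)%R.
Proof. by rewrite /extend; case: insub => [//|]; rewrite addr0. Qed.

Lemma extendZ (k : C) f w : extend (k *: f)%R w = (k * extend f w)%R.
Proof. by rewrite /extend; case: insub => [//|]; rewrite mulr0. Qed.

Lemma extendJ f w : extend (fun y => ((f y)^*)%R) w = ((extend f w)^*)%R.
Proof. by rewrite /extend; case: insub => [//|]; rewrite conjC0. Qed.

Lemma extend_mul (a b : crossed_sums) r w : boundary_spectrum P w ->
  extend (crossed_mul a b r) w = (\sum_(s \in [set: G])
    extend (a s) w * extend (b (s^-1 * r)%g) (translate s^-1%g w))%R.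
Proof.
move=> /inbdryP[x ->]; rewrite extend_val [LHS]sums_mulE.
by apply: eq_fsbigr => s _; rewrite extend_val.
Qed.

Lemma crossed_mul_fset (a b : crossed_sums) (A : {fset G}) r x :
  {in [predC A], forall s, a s = 0%R} ->
  crossed_mul a b r x = (\sum_(s <- A)
    a s x * extend (b (s^-1 * r)%g) (translate s^-1%g (bval x)))%R.
Proof.
by move=> aA; rewrite [LHS]sums_mulE (fsbigTE A) // => s sA; rewrite aA // mul0r.
Qed.

Lemma crossed_mulA a b c :
  crossed_mul a (crossed_mul b c) = crossed_mul (crossed_mul a b) c.
Proof.
apply: crossed_eq => r x.
rewrite (@crossed_mul_fset _ _ (supp a)); last by move=> s /suppP.
pose U := [fset (s * t)%g | s in supp a, t in supp b]%fset.
have abU s u : s \in supp a -> u \notin U -> b (s^-1 * u) = 0%R.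
  move=> sa uU; apply: suppP; apply: contra uU => sub.
  by apply/imfset2P; exists s => //; exists (s^-1 * u) => //; rewrite mulVKg.
rewrite (@crossed_mul_fset _ _ U); last first.
  move=> u uU; apply/funext => z.
  rewrite (@crossed_mul_fset _ _ (supp a)); last by move=> s /suppP.
  by rewrite big_seq big1 // => s sa; rewrite (abU s) // extend0 mulr0.
have abE u := @crossed_mul_fset a b (supp a) u x (fun s => @suppP a s).
under [RHS]eq_bigr => u _ do rewrite abE mulr_suml.
rewrite exchange_big [LHS]big_seq [RHS]big_seq; apply: eq_bigr => s sa /=.
rewrite -(fsbigTE U (fun u => _)); last first.
  by move=> u uU; rewrite abU // extend0 mulr0 mul0r.
rewrite (reindex_fsbigT (fun v => s * v)); last first.
  by exists (fun v => s^-1 * v) => v; rewrite ?mulKg ?mulVKg.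
have [xs|xs] := boolP (bval x s); last first.
  have [_ a0] := crossed_dom a s; rewrite a0 // mul0r fsbig1 // => v _.
  by rewrite !mul0r.
have [y yx] := inbdry_translate xs.
rewrite extend_mul ?mulr_fsumr; last by rewrite yx; exact: bdryP.
apply: eq_fsbigr => v _.
by rewrite mulKg invgM translateM mulgA mulrA.
Qed.

Lemma crossed_mulDl a b c :
  crossed_mul (a + b)%R c = (crossed_mul a c + crossed_mul b c)%R.
Proof.
apply: crossed_eq => r x; pose A := (supp a `|` supp b)%fset.
have aA : {in [predC A], forall s, a s = 0%R}.
  by move=> s; rewrite inE /= in_fsetU negb_or => /andP[/suppP].
have bA : {in [predC A], forall s, b s = 0%R}.
  by move=> s; rewrite inE /= in_fsetU negb_or => /andP[_ /suppP].
have abA : {in [predC A], forall s, (a + b)%R s = 0%R}.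
  by move=> s sA; rewrite -[LHS]/(a s + b s)%R aA // bA // addr0.
rewrite -[RHS]/(crossed_mul a c r x + crossed_mul b c r x)%R.
rewrite !(@crossed_mul_fset _ _ A) // -big_split /=; apply: eq_bigr => s _.
by rewrite -[X in (X * _)%R = _]/(a s x + b s x)%R mulrDl.
Qed.

Lemma crossed_mulDr a b c :
  crossed_mul a (b + c)%R = (crossed_mul a b + crossed_mul a c)%R.
Proof.
apply: crossed_eq => r x.
rewrite -[RHS]/(crossed_mul a b r x + crossed_mul a c r x)%R.
rewrite !(@crossed_mul_fset _ _ (supp a)); try by move=> s /suppP.
rewrite -big_split; apply: eq_bigr => s _.
by rewrite crossed_valD extendD mulrDr.
Qed.

Lemma crossed_mulZl (k : C) a b :
  crossed_mul (k *: a)%R b = (k *: crossed_mul a b)%R.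
Proof.
apply: crossed_eq => r x; rewrite -[RHS]/(k * crossed_mul a b r x)%R.
rewrite !(@crossed_mul_fset _ _ (supp a)); first last.
- by move=> s /suppP as0; rewrite crossed_valZ as0 scaler0.
- by move=> s /suppP.
by rewrite mulr_sumr; apply: eq_bigr => s _; rewrite mulrA.
Qed.

Lemma crossed_mulZr (k : C) a b :
  crossed_mul a (k *: b)%R = (k *: crossed_mul a b)%R.
Proof.
apply: crossed_eq => r x; rewrite -[RHS]/(k * crossed_mul a b r x)%R.
rewrite !(@crossed_mul_fset _ _ (supp a)); try by move=> s /suppP.
rewrite mulr_sumr; apply: eq_bigr => s _.
by rewrite crossed_valZ extendZ mulrCA.
Qed.

Lemma crossed_starE (a : crossed_sums) r x :
  crossed_star a r x = ((extend (a r^-1%g) (translate r^-1%g (bval x)))^*)%R.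
Proof. by rewrite [LHS]alphaE extendJ. Qed.

Lemma crossed_starK a : crossed_star (crossed_star a) = a.
Proof.
apply: crossed_eq => r x.
rewrite crossed_starE -[in RHS](alphaK (crossed_dom a r)) alphaE.
rewrite -extendJ; congr extend; apply/funext => y.
by rewrite crossed_starE conjCK alphaE !invgK.
Qed.

Lemma crossed_starD a b :
  crossed_star (a + b)%R = (crossed_star a + crossed_star b)%R.
Proof.
apply: crossed_eq => r x.
rewrite -[RHS]/(crossed_star a r x + crossed_star b r x)%R.
by rewrite !crossed_starE crossed_valD extendD rmorphD.
Qed.

Lemma crossed_starZ (k : C) a :
  crossed_star (k *: a)%R = (k^* *: crossed_star a)%R.
Proof.
apply: crossed_eq => r x; rewrite -[RHS]/(k^* * crossed_star a r x)%R.
by rewrite !crossed_starE crossed_valZ extendZ rmorphM.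
Qed.

Lemma crossed_starM a b :
  crossed_star (crossed_mul a b) =
  crossed_mul (crossed_star b) (crossed_star a).
Proof.
apply: crossed_eq => r x; rewrite crossed_starE [RHS]sums_mulE.
rewrite (reindex_fsbigT (fun s => r * s)); last first.
  by exists (fun v => r^-1 * v) => v; rewrite ?mulKg ?mulVKg.
have bstar s : crossed_star b (r * s) x =
    ((extend (b (s^-1 * r^-1)%g)
      (translate s^-1%g (translate r^-1%g (bval x))))^*)%R.
  by rewrite crossed_starE invgM translateM.
have astar s w : boundary_spectrum P w -> extend (crossed_star a s^-1) w =
    ((extend (a s) (translate s w))^*)%R.
  by move=> /inbdryP[y ->]; rewrite extend_val crossed_starE invgK.
pose w := translate r^-1 (bval x).
have term s : (crossed_star b (r * s)%g x *
    extend (crossed_star a ((r * s)^-1 * r)%g)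
      (translate (r * s)^-1%g (bval x)) =
    ((extend (a s) w * extend (b (s^-1 * r^-1)%g) (translate s^-1%g w))^*))%R.
  rewrite bstar invgM mulgVK translateM -/w rmorphM mulrC /=.
  have [ws|ws] := pselect (boundary_spectrum P (translate s^-1 w)).
    by rewrite astar // translateVK.
  by rewrite [extend (b _) _]extend_out // conjC0 !mulr0.
under [RHS]eq_fsbigr => s _ do rewrite term.
have [wb|wb] := pselect (boundary_spectrum P w); last first.
  rewrite extend_out // conjC0 fsbig1 // => s _.
  by rewrite extend_out // mul0r conjC0.
rewrite extend_mul // !(fsbigTE (supp a)); first last.
- by move=> s /suppP ->; rewrite extend0 mul0r conjC0.
- by move=> s /suppP ->; rewrite extend0 mul0r.
by rewrite rmorph_sum.
Qed.

HB.instance Definition _ := isStarAlgebra.Build C crossed_sums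
  crossed_mulA crossed_mulDl crossed_mulDr crossed_mulZl crossed_mulZr
  crossed_starK crossed_starD crossed_starZ crossed_starM.

End PartialAction.

Section DirectFactor.
Local Open Scope group_scope.

Definition positive_cone (G : groupType) (P : set G) : Prop :=
  [/\ P 1, forall x y, P x -> P y -> P (x * y) &
      forall x, P x -> P x^-1 -> x = 1].

(* An isomorphism f of partially ordered groups from (G, P) onto the direct    *)
(* sum of (Z, N) and (H, Q).                                                   *)
Definition has_ZN_direct_factor (G : groupType) (P : set G) : Prop :=
  exists (H : groupType) (Q : set H) (f : G -> int * H),
  [/\ positive_cone Q, bijective f,
      forall x y, f (x * y) = (((f x).1 + (f y).1)%R, (f x).2 * (f y).2) &
      forall x, P x <-> (0 <= (f x).1)%R /\ Q (f x).2].

End DirectFactor.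

Section RAAG.
Variables (S : countType) (e : rel S).

(* A word is a product of letters (s, b), standing for s if b and for s^-1     *)
(* otherwise.                                                                  *)
Local Notation word := (seq (S * bool)).

Definition inv_letter (l : S * bool) := (l.1, ~~ l.2).
Definition inv_word (w : word) : word := rev (map inv_letter w).

(* The right-angled Artin group < S | ab = ba if e a b > is the quotient of    *)
(* the words by this congruence.                                               *)
Inductive raag_rel : word -> word -> Prop :=
| raag_refl w : raag_rel w w
| raag_sym w1 w2 : raag_rel w1 w2 -> raag_rel w2 w1
| raag_trans w1 w2 w3 : raag_rel w1 w2 -> raag_rel w2 w3 -> raag_rel w1 w3
| raag_cat w1 w2 w1' w2' : raag_rel w1 w2 -> raag_rel w1' w2' ->
    raag_rel (w1 ++ w1') (w2 ++ w2')
| raag_cancel l : raag_rel [:: l; inv_letter l] [::]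
| raag_comm a b : e a b ->
    raag_rel [:: (a, true); (b, true)] [:: (b, true); (a, true)].

Lemma inv_letterK : involutive inv_letter.
Proof. by case=> a b; rewrite /inv_letter negbK. Qed.

Lemma inv_wordK : involutive inv_word.
Proof.
move=> w; rewrite /inv_word map_rev revK -map_comp -[RHS]map_id.
by apply: eq_map => l /=; rewrite inv_letterK.
Qed.

Lemma inv_word_cat w1 w2 : inv_word (w1 ++ w2) = inv_word w2 ++ inv_word w1.
Proof. by rewrite /inv_word map_cat rev_cat. Qed.

Lemma raag_mulV w : raag_rel (w ++ inv_word w) [::].
Proof.
elim: w => [|l w IHw]; first exact: raag_refl.
rewrite -cat1s inv_word_cat -catA [in X in _ ++ X]catA.
apply: (@raag_trans _ ([:: l] ++ [::] ++ [:: inv_letter l])); last first.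
  exact: raag_cancel.
apply: raag_cat; first exact: raag_refl.
by apply: raag_cat => //; exact: raag_refl.
Qed.

Lemma raag_mulVw w : raag_rel (inv_word w ++ w) [::].
Proof. by rewrite -{2}(inv_wordK w); exact: raag_mulV. Qed.

Lemma raag_inv w1 w2 :
  raag_rel w1 w2 -> raag_rel (inv_word w1) (inv_word w2).
Proof.
move=> r12; apply: (@raag_trans _ (inv_word w1 ++ (w2 ++ inv_word w2))).
  rewrite -{1}[inv_word w1]cats0; apply: raag_cat; first exact: raag_refl.
  exact/raag_sym/raag_mulV.
rewrite catA -{2}[inv_word w2]cat0s; apply: raag_cat; last exact: raag_refl.
apply: raag_trans (raag_mulVw w1); apply: raag_cat; first exact: raag_refl.
exact: raag_sym.
Qed.

Definition raag_relb : rel word := fun w1 w2 => `[< raag_rel w1 w2 >].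

Lemma raag_relb_refl : reflexive raag_relb.
Proof. by move=> w; apply/asboolP; exact: raag_refl. Qed.

Lemma raag_relb_sym : symmetric raag_relb.
Proof. by move=> w1 w2; apply/asboolP/asboolP; exact: raag_sym. Qed.

Lemma raag_relb_trans : transitive raag_relb.
Proof.
by move=> w1 w2 w3 /asboolP h /asboolP h'; apply/asboolP; exact: raag_trans h'.
Qed.

Canonical raag_equiv :=
  EquivRel raag_relb raag_relb_refl raag_relb_sym raag_relb_trans.

Definition raag : Type := {eq_quot raag_equiv}.
HB.instance Definition _ := Choice.on raag.
HB.instance Definition _ := EqQuotient.on raag.

Lemma raag_piP w1 w2 : (\pi_raag w1 = \pi_raag w2) <-> raag_rel w1 w2.
Proof.
split=> [/eqmodP/asboolP//|h]; exact/eqmodP/asboolP.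
Qed.

Definition raag_one : raag := \pi_raag [::].
Definition raag_mul (x y : raag) : raag := \pi_raag (repr x ++ repr y).
Definition raag_invg (x : raag) : raag := \pi_raag (inv_word (repr x)).

Lemma raag_repr_pi w : raag_rel (repr (\pi_raag w)) w.
Proof. by apply/raag_piP; rewrite reprK. Qed.

Lemma raag_mul_pi w1 w2 :
  raag_mul (\pi_raag w1) (\pi_raag w2) = \pi_raag (w1 ++ w2).
Proof. by apply/raag_piP; apply: raag_cat; exact: raag_repr_pi. Qed.

Lemma raag_invg_pi w : raag_invg (\pi_raag w) = \pi_raag (inv_word w).
Proof. by apply/raag_piP; apply: raag_inv; exact: raag_repr_pi. Qed.

Lemma raag_mulA : associative raag_mul.
Proof.
elim/quotW=> x; elim/quotW=> y; elim/quotW=> z.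
by rewrite (raag_mul_pi y z) (raag_mul_pi x y) !raag_mul_pi catA.
Qed.

Lemma raag_mul1 : left_id raag_one raag_mul.
Proof. by elim/quotW=> x; rewrite raag_mul_pi. Qed.

Lemma raag_mulr1 : right_id raag_one raag_mul.
Proof. by elim/quotW=> x; rewrite raag_mul_pi cats0. Qed.

Lemma raag_mulVg : left_inverse raag_one raag_invg raag_mul.
Proof.
elim/quotW=> x; rewrite raag_invg_pi raag_mul_pi.
by apply/raag_piP; exact: raag_mulVw.
Qed.

Lemma raag_mulgV : right_inverse raag_one raag_invg raag_mul.
Proof.
elim/quotW=> x; rewrite raag_invg_pi raag_mul_pi.
by apply/raag_piP; exact: raag_mulV.
Qed.

HB.instance Definition _ :=
  isGroup.Build raag raag_mulA raag_mul1 raag_mulr1 raag_mulVg raag_mulgV.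

Definition raag_gen (a : S) : raag := \pi_raag [:: (a, true)].

Inductive raag_pos : set raag :=
| raag_pos1 : raag_pos 1%g
| raag_posM a x : raag_pos x -> raag_pos (raag_gen a * x)%g.

End RAAG.

(* Main.v *)
(* Write [v_p = 1_(U_p) delta_p] for [p] in [P]; these are isometries of the
   crossed product, and [v_r^* a v_r], for [a] a finite sum, has coefficients
   [a_(r t r^-1) (r x)].  At a maximal directed set the sets [U_r] form a base of
   neighbourhoods, and when no vertex is adjacent to all others every [t <> 1]
   admits [r] in [P] such that [r] and [t r] have no common upper bound.  Hence
   [v_r^* a v_r] can be made as close as desired to the scalar [a_1 x].

   The Fourier coefficients are therefore contractive for the full norm.  An
   element all of whose coefficients vanish is zero: by the gauge actions given
   by the exponents of the generators, whose spectral components are averages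
   over roots of unity, one is reduced to gauge-invariant elements [a], where the
   powers of [a^* a] stay in a space on which the norm and the supremum of the
   coefficients are equivalent.

   For [h <> 0] some coefficient is then bounded away from zero, and compressing
   [h^* h] produces [x] with [(h x)^* (h x) = 1].  Simplicity follows at once, and
   [(h x) (h x)^*] is a projection in every hereditary subalgebra containing [h];
   it is infinite because some [v_r] is not unitary.  That the crossed product is
   not zero is seen in its regular representation on [l^2 (G)]. *)

Require Import Defs.
From HB Require Import structures.
From mathcomp Require Import all_boot all_order all_algebra.
From mathcomp Require Import generic_quotient finmap complex.
From mathcomp Require Import all_classical all_reals all_analysis.
From mathcomp Require Import ring lra zify.

Set Implicit Arguments.
Unset Strict Implicit.
Unset Printing Implicit Defensive.

Import Order.TTheory GRing.Theory Num.Theory numFieldNormedType.Exports.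

Local Open Scope classical_set_scope.
Local Open Scope ring_scope.

Local Notation "a ** b" := (smul a b) (at level 40, left associativity).

(** * C*-algebras without spectral theory *)

(** The obstacle is that the norm of [B] is known only through a universal property, while the group
    is in general not amenable: nothing says a priori that Fourier coefficients determine an
    element. The way out is that joins are controlled by exponents: no exponent of a join of
    positive elements exceeds the larger of the two given ones. The norm of [B] is compared with the
    quotient norm modulo the elements with vanishing coefficients. An estimate that loses a factor
    linear in [2 ^ n] on the [2 ^ n]-th power of [star a ** a] becomes sharp on taking roots, so
    crude triangle inequalities replace integration over a torus and the structure theory of a
    fixed-point algebra. Generators are treated one at a time; a finite sum involves finitely many
    of them even when the graph is infinite. Square roots and inverses are fixed points of
    contractions, and the contractivity of star homomorphisms comes from an identity
    [y^2 + (1 - s)^2 = 1], so no functional calculus enters. *)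

Section RealNorm.
Variables (R : realType).
Local Notation C := (Cplx R).

Definition rC (r : R) : C := real_complex R r.

Lemma rCD r s : rC (r + s) = rC r + rC s. Proof. exact: rmorphD. Qed.
Lemma rCM r s : rC (r * s) = rC r * rC s. Proof. exact: rmorphM. Qed.
Lemma rCN r : rC (- r) = - rC r. Proof. exact: rmorphN. Qed.
Lemma rC1 : rC 1 = 1. Proof. by []. Qed.
Lemma rC_le r s : (rC r <= rC s) = (r <= s). Proof. exact: lecR. Qed.
Lemma rC_lt r s : (rC r < rC s) = (r < s). Proof. exact: ltcR. Qed.
Lemma rC_inj : injective rC. Proof. by move=> x y []. Qed.
Lemma rCX r n : rC (r ^+ n) = rC r ^+ n.
Proof. exact: (rmorphXn (real_complex R)). Qed.
Lemma rC_conj r : (rC r)^* = rC r.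
Proof. by apply: conj_Creal; rewrite realE !rC_le le_total. Qed.
Lemma norm_rC r : `|rC r| = rC `|r|.
Proof. by rewrite normc_def /= expr0n addr0 sqrtr_sqr. Qed.

Lemma half_addrr (V : lmodType C) (v : V) : rC (2^-1) *: (v + v) = v.
Proof.
have -> : v + v = rC 2 *: v.
  by rewrite -[2]/(1 + 1) rCD rC1 scalerDl scale1r.
by rewrite scalerA -rCM mulVf ?pnatr_eq0 // rC1 scale1r.
Qed.

Lemma half_norm : `|2^-1 : R| = 2^-1.
Proof. by rewrite ger0_norm // invr_ge0. Qed.

Definition rnorm (V : normedZmodType C) (a : V) : R := complex.Re `|a|.

Section Norm.
Variable V : normedModType C.
Implicit Types a b : V.

Lemma rnormE a : `|a| = rC (rnorm a).
Proof. by rewrite /rC /rnorm RRe_real // normr_real. Qed.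

Lemma rnorm_ge0 a : 0 <= rnorm a.
Proof. by rewrite -rC_le -rnormE normr_ge0. Qed.

Lemma rnormD a b : rnorm (a + b) <= rnorm a + rnorm b.
Proof. by rewrite -rC_le rCD -!rnormE ler_normD. Qed.

Lemma rnormN a : rnorm (- a) = rnorm a.
Proof. by rewrite /rnorm normrN. Qed.

Lemma rnormC a b : rnorm (a - b) = rnorm (b - a).
Proof. by rewrite -rnormN opprB. Qed.

Lemma rnorm0 : rnorm (0 : V) = 0.
Proof. by rewrite /rnorm normr0. Qed.

Lemma rnorm_eq0 a : rnorm a = 0 -> a = 0.
Proof. by move=> a0; apply/normr0_eq0; rewrite rnormE a0. Qed.

Lemma rnormZ (k : C) a : rnorm (k *: a) = rnorm (k : C^o) * rnorm a.
Proof. by apply: rC_inj; rewrite rCM -!rnormE normrZ. Qed.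

Lemma rnormZr (k : R) a : rnorm (rC k *: a) = `|k| * rnorm a.
Proof. by rewrite rnormZ {1}/rnorm norm_rC. Qed.

Lemma rnorm_dist b a c : rnorm (a - c) <= rnorm (a - b) + rnorm (b - c).
Proof. by rewrite (le_trans _ (rnormD _ _)) // addrA subrK. Qed.

Lemma rnorm_sum I (r : seq I) (F : I -> V) :
  rnorm (\sum_(i <- r) F i) <= \sum_(i <- r) rnorm (F i).
Proof.
elim/big_ind2: _ => // [|x1 x2 y1 y2 h1 h2]; first by rewrite rnorm0.
exact: le_trans (rnormD _ _) (lerD h1 h2).
Qed.

Lemma rnorm_small a : (forall e : R, 0 < e -> rnorm a <= e) -> a = 0.
Proof.
move=> ae; apply: rnorm_eq0; apply/eqP; rewrite eq_le rnorm_ge0 andbT.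
by apply/ler_addgt0Pl => e e0; rewrite addr0 ae.
Qed.

Lemma closureP (A : set V) a :
  closure A a <-> forall e : R, 0 < e -> exists2 b, A b & rnorm (a - b) <= e.
Proof.
split=> [cA e e0|cA U].
  have [|b [Ab]] := cA (ball a (rC e)); first by apply: nbhsx_ballx; rewrite rC_lt.
  by rewrite -ball_normE /= rnormE rC_lt => ab; exists b => //; exact: ltW.
move/nbhs_ballP => [e /= e0 eU].
have er : e = rC (complex.Re e) by rewrite /rC RRe_real // realE ltW.
have [|b Ab ab] := cA (complex.Re e / 2).
  by rewrite divr_gt0 // -rC_lt -er.
exists b; split => //; apply: eU; rewrite -ball_normE /= rnormE er rC_lt.
apply: le_lt_trans ab _; rewrite ltr_pdivrMr // mulr_natr mulr2n ltrDl.
by rewrite -rC_lt -er.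
Qed.

End Norm.

Lemma geometric_small (M q e : R) : 0 <= q < 1 -> 0 < e ->
  exists N, forall n, (N <= n)%N -> M * q ^+ n <= e.
Proof.
move=> /andP[q0 q1] e0.
have h : (fun n => M * q ^+ n) @ \oo --> (M * 0 : R).
  by apply: cvgMr; apply: cvg_expr; rewrite ger0_norm.
have /cvgrPdist_le/(_ e e0) := h; rewrite mulr0 => -[N _ hN]; exists N => n Nn.
have := hN n Nn; rewrite /= sub0r normrN; apply: le_trans; exact: ler_norm.
Qed.

Lemma geometric_cauchy_cvg (V : completeNormedModType C) (u : nat -> V)
    (M q : R) : 0 <= q < 1 -> (forall n, rnorm (u n.+1 - u n) <= M * q ^+ n) ->
  exists l, forall e : R, 0 < e ->
    exists N, forall n, (N <= n)%N -> rnorm (u n - l) <= e.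
Proof.
move=> q01 uM; have /andP[q0 q1] := q01.
have um n k : rnorm (u (n + k)%N - u n) <= M / (1 - q) * q ^+ n.
  (* The exact partial geometric sum, unlike the cruder bound wanted, is stable under the induction
     on [k]. *)
  suff h : rnorm (u (n + k)%N - u n) <= M * q ^+ n * (1 - q ^+ k) / (1 - q).
    apply: le_trans h _; rewrite [leRHS]mulrAC ler_pM2r ?invr_gt0 ?subr_gt0 //.
    have M0 : 0 <= M * q ^+ n by exact: le_trans (rnorm_ge0 _) (uM n).
    by rewrite ler_piMr // lerBlDr lerDl exprn_ge0.
  elim: k => [|k IH]; first by rewrite addn0 !subrr rnorm0 mulr0 mul0r.
  rewrite addnS; apply: le_trans (rnorm_dist (u (n + k)%N) _ _) _.
  apply: le_trans (lerD (uM _) IH) _.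
  rewrite exprD exprS.
  by rewrite le_eqVlt; apply/orP; left; apply/eqP; field; rewrite subr_eq0 gt_eqF.
have : cvg (u @ \oo).
  apply: (@cauchy_cvg V); apply: (@cauchy_exP (Cplx R) V) => e ep.
  have er : e = rC (complex.Re e) by rewrite /rC RRe_real // realE ltW.
  have e0 : 0 < complex.Re e by rewrite -rC_lt -er.
  have [|N hN] := geometric_small (M / (1 - q)) q01 (e := complex.Re e / 2).
    by rewrite divr_gt0.
  exists (u N); exists N => //= n /= Nn; rewrite -ball_normE /= rnormE er rC_lt.
  rewrite rnormC -(subnKC Nn); apply: le_lt_trans (um _ _) _.
  apply: le_lt_trans (hN _ _) _ => //.
  by rewrite ltr_pdivrMr // mulr_natr mulr2n ltrDl.
move=> /cvg_ex[l ul]; exists l => e e0.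
have /cvgrPdist_le/(_ (rC e)) := ul; rewrite rC_lt => /(_ e0)[N _ hN].
exists N => n Nn; rewrite -rC_le rnormC -rnormE; exact: hN.
Qed.

End RealNorm.

Section StarAlgebra.
Variables (C : numClosedFieldType) (A : starAlgType C).
Implicit Types a b c : A.

(* The same identities as the mixin fields, but stated on the canonical        *)
(* instances, on which rewriting relies.                                       *)
Lemma sMA a b c : a ** (b ** c) = a ** b ** c. Proof. exact: smulA. Qed.
Lemma sMDl a b c : (a + b) ** c = a ** c + b ** c. Proof. exact: smulDl. Qed.
Lemma sMDr a b c : a ** (b + c) = a ** b + a ** c. Proof. exact: smulDr. Qed.
Lemma sMZl (k : C) a b : (k *: a) ** b = k *: (a ** b). Proof. exact: smulZl. Qed.
Lemma sMZr (k : C) a b : a ** (k *: b) = k *: (a ** b). Proof. exact: smulZr. Qed.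
Lemma stD a b : star (a + b) = star a + star b. Proof. exact: starD. Qed.
Lemma stZ (k : C) a : star (k *: a) = k^* *: star a. Proof. exact: starZ. Qed.
Lemma stM a b : star (a ** b) = star b ** star a. Proof. exact: starM. Qed.

Lemma smul0l a : 0 ** a = 0.
Proof. by have := sMZl 0 (0 : A) a; rewrite !scale0r. Qed.
Lemma smul0r a : a ** 0 = 0.
Proof. by have := sMZr 0 a (0 : A); rewrite !scale0r. Qed.
Lemma smulNl a b : (- a) ** b = - (a ** b).
Proof. by rewrite -scaleN1r sMZl scaleN1r. Qed.
Lemma smulNr a b : a ** (- b) = - (a ** b).
Proof. by rewrite -scaleN1r sMZr scaleN1r. Qed.
Lemma smulBl a b c : (a - b) ** c = a ** c - b ** c.
Proof. by rewrite sMDl smulNl. Qed.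
Lemma smulBr a b c : a ** (b - c) = a ** b - a ** c.
Proof. by rewrite sMDr smulNr. Qed.
Lemma star0 : star (0 : A) = 0.
Proof. by have := stZ 0 (0 : A); rewrite conjC0 !scale0r. Qed.
Lemma starN a : star (- a) = - star a.
Proof. by rewrite -scaleN1r stZ rmorphN1 scaleN1r. Qed.
Lemma starB a b : star (a - b) = star a - star b.
Proof. by rewrite stD starN. Qed.
Lemma star_sum I (r : seq I) (F : I -> A) :
  star (\sum_(i <- r) F i) = \sum_(i <- r) star (F i).
Proof.
by elim: r => [|i r IH]; rewrite ?big_nil ?star0 // !big_cons stD IH.
Qed.

Definition square a := a ** a.

Lemma star_square a : star a = a -> star (square a) = square a.
Proof. by move=> sa; rewrite /square stM sa. Qed.

Lemma star_iter_square n a : star a = a ->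
  star (iter n square a) = iter n square a.
Proof. by elim: n => //= n IH sa; rewrite star_square // IH. Qed.

Definition is_unit u := (forall a, u ** a = a) /\ (forall a, a ** u = a).

Lemma star_unit u : is_unit u -> star u = u.
Proof. by move=> [ul ur]; rewrite -[LHS]ur -{2}[u]starK -stM ur starK. Qed.

End StarAlgebra.

Section StarHom.
Variables (C : numClosedFieldType) (A B : starAlgType C) (g : A -> B).
Hypothesis gh : star_hom g.

Lemma star_homD a b : g (a + b) = g a + g b.
Proof. by have [gl _ _] := gh; rewrite -[a]scale1r gl !scale1r. Qed.
Lemma star_hom0 : g 0 = 0.
Proof. by apply: (@addrI _ (g 0)); rewrite -star_homD !addr0. Qed.
Lemma star_homZ (k : C) a : g (k *: a) = k *: g a.
Proof. by have [gl _ _] := gh; rewrite -[k *: a]addr0 gl star_hom0 addr0. Qed.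
Lemma star_homN a : g (- a) = - g a.
Proof. by rewrite -scaleN1r star_homZ scaleN1r. Qed.
Lemma star_homB a b : g (a - b) = g a - g b.
Proof. by rewrite star_homD star_homN. Qed.
Lemma star_homM a b : g (a ** b) = g a ** g b. Proof. by case: gh. Qed.
Lemma star_homS a : g (star a) = star (g a). Proof. by case: gh. Qed.
Lemma star_hom_sum I (r : seq I) (F : I -> A) :
  g (\sum_(i <- r) F i) = \sum_(i <- r) g (F i).
Proof.
by elim: r => [|i r IH]; rewrite ?big_nil ?star_hom0 // !big_cons star_homD IH.
Qed.
Lemma star_hom_iter_square n a : g (iter n (@square _ A) a) = iter n (@square _ B) (g a).
Proof. by elim: n => //= n IH; rewrite star_homM IH. Qed.

End StarHom.

Section CStarNorm.
Variable R : realType.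
Local Notation C := (Cplx R).
Variable B : cstarAlgType C.
Implicit Types a b c l p s t u v w x y z : B.

Lemma rnormM a b : rnorm (a ** b) <= rnorm a * rnorm b.
Proof. by rewrite -rC_le rCM -!rnormE normr_smul. Qed.

Lemma rnorm_starM a : rnorm (star a ** a) = rnorm a ^+ 2.
Proof.
by apply: rC_inj; rewrite -rnormE normr_star_smul rnormE /rC -rmorphXn.
Qed.

Lemma rnorm_star a : rnorm (star a) = rnorm a.
Proof.
have h b : rnorm b <= rnorm (star b).
  have [->|b0] := eqVneq (rnorm b) 0; first exact: rnorm_ge0.
  have b1 : 0 < rnorm b by rewrite lt_def b0 rnorm_ge0.
  by rewrite -(ler_pM2r b1) -expr2 -rnorm_starM rnormM.
by apply/eqP; rewrite eq_le h andbT -{2}[a]starK h.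
Qed.

Lemma rnorm_Mstar a : rnorm (a ** star a) = rnorm a ^+ 2.
Proof. by rewrite -{1}[a]starK rnorm_starM rnorm_star. Qed.

Lemma rnorm_iter_square n a : star a = a ->
  rnorm (iter n (@square _ B) a) = rnorm a ^+ (2 ^ n)%N.
Proof.
move=> sa; elim: n => //= n IH.
by rewrite /square -{1}(star_iter_square n sa) rnorm_starM IH -exprM -expnSr.
Qed.

Lemma rnormM_le a b (s t : R) :
  rnorm a <= s -> rnorm b <= t -> rnorm (a ** b) <= s * t.
Proof.
by move=> ra rb; rewrite (le_trans (rnormM _ _)) // ler_pM ?rnorm_ge0.
Qed.

Lemma rnorm_projection p : star p ** p = p -> rnorm p <= 1.
Proof.
move=> pp; have [->|p0] := eqVneq (rnorm p) 0; first exact: ler01.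
have p1 : 0 < rnorm p by rewrite lt_def p0 rnorm_ge0.
by rewrite -(ler_pM2r p1) -expr2 -rnorm_starM pp mul1r.
Qed.

Lemma rnorm_le1_starM a : rnorm (star a ** a) <= 1 -> rnorm a <= 1.
Proof. by rewrite rnorm_starM expr_le1 // rnorm_ge0. Qed.

(* [u = b + i c] satisfies [u^* u = b^2 + c^2], and [b] is the real part of   *)
(* [u].                                                                       *)
Lemma rnorm_commuting_squares b c : star b = b -> star c = c ->
  b ** c = c ** b -> rnorm (b ** b + c ** c) <= 1 -> rnorm b <= 1.
Proof.
move=> sb sc bc bb; pose i : C := 'i; pose u := b + i *: c.
have su : star u = b - i *: c.
  by rewrite /u stD stZ sb sc conjCi scaleNr.
have uu : star u ** u = b ** b + c ** c.
  rewrite su /u smulBl !sMDr !sMZl !sMZr bc opprD addrA addrK scalerA.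
  by rewrite -expr2 sqrCi scaleN1r opprK.
have u1 : rnorm u <= 1 by apply: rnorm_le1_starM; rewrite uu.
have -> : b = rC (2^-1) *: (u + star u).
  by rewrite su /u addrACA subrr addr0 half_addrr.
rewrite rnormZr half_norm mulrC ler_pdivrMr // mul1r.
rewrite (le_trans (rnormD _ _)) // rnorm_star.
by rewrite -[2%:R]/(1 + 1) lerD.
Qed.

(** Banach's fixed point theorem on a closed subset. Closedness is the last hypothesis, phrased by
    approximation so that norm estimates alone verify it. *)
Lemma contraction_fixpoint (U : set B) (F : B -> B) (q : R) x0 :
  0 <= q < 1 -> U x0 -> (forall x, U x -> U (F x)) ->
  (forall x y, U x -> U y -> rnorm (F x - F y) <= q * rnorm (x - y)) ->
  (forall l, (forall e : R, 0 < e -> exists2 x, U x & rnorm (x - l) <= e) ->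
    U l) ->
  exists2 x, U x & F x = x.
Proof.
move=> q01 U0 UF Fq Ucl; have /andP[q0 q1] := q01.
pose u n := iter n F x0.
have Uu n : U (u n) by elim: n => //= n IH; apply: UF.
have us n : rnorm (u n.+1 - u n) <= rnorm (F x0 - x0) * q ^+ n.
  elim: n => [|n IH]; first by rewrite expr0 mulr1.
  apply: le_trans (Fq _ _ (Uu n.+1) (Uu n)) _.
  by rewrite exprS mulrCA ler_wpM2l.
have [l ul] := geometric_cauchy_cvg q01 us.
have Ul : U l.
  apply: Ucl => e e0; have [N hN] := ul e e0.
  by exists (u N) => //; exact: hN.
exists l => //; apply/eqP; rewrite -subr_eq0; apply/eqP.
apply: rnorm_small => e e0; have [|N hN] := ul (e / 2); first by rewrite divr_gt0.
apply: le_trans (rnorm_dist (u N.+1) _ _) _.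
have -> : e = e / 2 + e / 2 by rewrite -splitr.
apply: lerD; last exact: hN.
apply: le_trans (Fq _ _ Ul (Uu N)) _; rewrite rnormC.
apply: le_trans (ler_piMl _ (ltW q1)) (hN N _) => //; exact: rnorm_ge0.
Qed.

(* The element [s] stands for [1 - sqrt (1 - y)].                              *)
Lemma one_minus_sqrt y (r : R) : star y = y -> rnorm y <= r -> r < 1 ->
  exists s, [/\ star s = s, rnorm s <= r, s + s = y + s ** s &
    forall z, z ** y = y ** z -> z ** s = s ** z].
Proof.
move=> sy yr r1; have r0 : 0 <= r := le_trans (rnorm_ge0 _) yr.
(* A fixed point satisfies [2 s = y + s^2], a unit-free form of [(1 - s)^2 = 1 - y]. On the ball of
   radius [r] the Lipschitz constant is [r], because [s^2 - t^2 = s (s - t) + (s - t) t].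
   Commutation with everything commuting with [y] is put into [U], where it survives limits. *)
pose F s : B := rC (2^-1) *: (y + s ** s).
pose U : set B := [set s | [/\ star s = s, rnorm s <= r &
  forall z, z ** y = y ** z -> z ** s = s ** z]].
have [|||||s [ss sr sc] Fs] := @contraction_fixpoint U F r 0.
- by rewrite r0.
- by split; rewrite ?star0 ?rnorm0 // => z _; rewrite smul0l smul0r.
- move=> s [ss sr sc]; split.
  + by rewrite /F stZ stD stM ss sy rC_conj.
  + rewrite rnormZr half_norm mulrC ler_pdivrMr // mulr_natr mulr2n.
    apply: le_trans (rnormD _ _) _; apply: lerD => //.
    apply: le_trans (rnormM_le sr sr) _.
    by rewrite ler_piMl // ltW.
  + move=> z zy; rewrite /F sMZl sMZr sMDl sMDr zy; congr (_ *: (_ + _)).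
    by rewrite sMA (sc z zy) -sMA (sc z zy) sMA.
- move=> s t [ss sr _] [st tr _].
  have -> : F s - F t = rC (2^-1) *: (s ** (s - t) + (s - t) ** t).
    rewrite /F -scalerBr smulBl smulBr; congr (_ *: _).
    by rewrite opprD addrACA subrr add0r addrA subrK.
  rewrite rnormZr half_norm mulrC ler_pdivrMr //.
  apply: le_trans (rnormD _ _) _.
  rewrite mulr_natr mulr2n; apply: lerD; first exact: rnormM_le.
  by rewrite mulrC; exact: rnormM_le.
- move=> l hl; split.
  + apply/eqP; rewrite -subr_eq0; apply/eqP/rnorm_small => e e0.
    have [|x [sx _ _] xl] := hl (e / 2); first by rewrite divr_gt0.
    apply: le_trans (rnorm_dist x _ _) _.
    have -> : e = e / 2 + e / 2 by rewrite -splitr.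
    by apply: lerD => //; rewrite -sx -starB rnorm_star rnormC.
  + apply/ler_addgt0Pr => e e0; have [x [_ xr _] xl] := hl e e0.
    rewrite -[l](subrK x) addrC; apply: le_trans (rnormD _ _) _.
    by rewrite lerD // rnormC.
  + move=> z zy; apply/eqP; rewrite -subr_eq0; apply/eqP/rnorm_small => e e0.
    pose e' := e / (rnorm z * 2 + 1).
    have d0 : 0 < rnorm z * 2 + 1 by rewrite ltr_wpDl // mulr_ge0 // rnorm_ge0.
    have [|x [_ _ xz] xl] := hl e'; first by rewrite divr_gt0.
    have -> : z ** l - l ** z = (x - l) ** z - z ** (x - l).
      by rewrite smulBl smulBr (xz z zy) opprB [RHS]addrC addrA subrK.
    apply: le_trans (rnormD _ _) _; rewrite rnormN.
    apply: le_trans (lerD (rnormM_le xl (lexx _)) (rnormM_le (lexx _) xl)) _.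
    rewrite [_ * e']mulrC -mulrDr /e' mulrAC ler_pdivrMr // ler_pM2l //.
    by rewrite mulr_natr mulr2n lerDl.
exists s; split=> //; rewrite -{1 2}Fs /F -scalerDr.
exact: half_addrr.
Qed.

(** Writing [a = (e - s)^2] with [s] of norm at most 1/2, the element sought is the inverse of
    [e - s]. *)
Lemma near_unit_inverse_sqrt (e a : B) : is_unit e -> star a = a ->
  rnorm (e - a) <= 2^-1 -> exists2 z, star z = z & z ** a ** z = e.
Proof.
move=> eu sa ea; have [el er] := eu; have se := star_unit eu.
have half1 : (2^-1 : R) < 1 by rewrite invf_lt1 // ltr1n.
have sea : star (e - a) = e - a by rewrite starB se sa.
have [s [ss s1 s2 _]] := one_minus_sqrt sea ea half1.
have cc : (e - s) ** (e - s) = a.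
  have s2' : s + s - s ** s = e - a by rewrite s2 addrK.
  rewrite smulBl !smulBr !er !el -[RHS](subKr e) -s2'.
  by rewrite -addrA -opprD addrA.
(* The fixed point is the Neumann series [e + s + s^2 + ...]. It is a right inverse of [e - s], its
   adjoint is a left inverse, and the two therefore coincide, which also makes it self-adjoint. *)
pose F w : B := e + s ** w.
have [||||w _ Fw] := @contraction_fixpoint setT F (2^-1) 0 _ I.
- by rewrite invr_ge0 half1 andbT.
- by [].
- move=> x y _ _; rewrite /F opprD addrACA subrr add0r -smulBr.
  exact: rnormM_le.
- by [].
have csw : (e - s) ** w = e.
  by rewrite smulBl el -{1}Fw /F addrK.
have wsc : star w ** (e - s) = e.
  by rewrite -{1}se -{1}ss -starB -stM csw se.
have sw : star w = w by rewrite -[LHS]er -csw sMA wsc el.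
by exists w => //; rewrite -cc sMA -[X in X ** _ ** _ ** _]sw wsc el csw.
Qed.

(** This expresses [x ** star x <= k] in the operator order; it will bound a projection by an
    element of a hereditary subalgebra. The factor 2 in [k] brings [x ** star x], divided by [k], to
    norm at most 1/2, in the range of [one_minus_sqrt]. *)
Lemma norm_minus_mul_star (e x : B) : is_unit e ->
  exists2 k : R, 0 < k & exists c, rC k *: e - x ** star x = star c ** c.
Proof.
move=> eu; have [el er] := eu; have se := star_unit eu.
pose k := 2 * (rnorm x ^+ 2 + 1).
have k0 : 0 < k by rewrite mulr_gt0 // ltr_wpDl // exprn_ge0 // rnorm_ge0.
exists k => //; pose y := rC k^-1 *: (x ** star x).
have sy : star y = y by rewrite /y stZ stM starK rC_conj.
have y1 : rnorm y <= 2^-1.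
  have ki : `|k^-1| = k^-1 by rewrite ger0_norm // invr_ge0 ltW.
  rewrite /y rnormZr ki rnorm_Mstar [leLHS]mulrC.
  rewrite ler_pdivrMr // /k mulrA mulVf ?mul1r ?pnatr_eq0 //.
  by rewrite lerDl.
have half1 : (2^-1 : R) < 1 by rewrite invf_lt1 // ltr1n.
have [s [ss _ s2 _]] := one_minus_sqrt sy y1 half1.
exists (rC (Num.sqrt k) *: (e - s)).
rewrite stZ starB se ss rC_conj sMZl sMZr scalerA -rCM -expr2 sqr_sqrtr ?ltW //.
have -> : x ** star x = rC k *: y.
  by rewrite /y scalerA -rCM mulfV ?gt_eqF // rC1 scale1r.
rewrite -scalerBr; congr (_ *: _).
have s2' : s + s - s ** s = y by rewrite s2 addrK.
rewrite smulBl !smulBr !er !el -s2'.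
by rewrite -[RHS]addrA -opprD addrA.
Qed.

End CStarNorm.

(** For [a] of norm less than 1 and [y = star a ** a] there is [s] commuting with [y] such that
    [y^2 + (e - s)^2 = e]. The relation passes to the images, where [rnorm_commuting_squares] bounds
    [g y]. Nothing makes [g e] a unit of [D], but it is a projection acting as a unit on the range
    of [g]. *)
Lemma star_hom_contractive (R : realType) (A D : cstarAlgType (Cplx R))
    (g : A -> D) (e : A) : is_unit e -> star_hom g ->
  forall a, rnorm (g a) <= rnorm a.
Proof.
move=> eu gh; have [el er] := eu; have se := star_unit eu.
suff h a : rnorm a < 1 -> rnorm (g a) <= 1.
  move=> a; apply/ler_addgt0Pr => d d0.
  have n0 : 0 < rnorm a + d by rewrite ltr_wpDl // rnorm_ge0.
  have := h (rC (rnorm a + d)^-1 *: a).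
  have ni : `|(rnorm a + d)^-1| = (rnorm a + d)^-1.
    by rewrite ger0_norm // invr_ge0 ltW.
  rewrite (star_homZ gh) !rnormZr ni.
  rewrite !(mulrC _^-1) ltr_pdivrMr // ler_pdivrMr // mul1r ltrDl.
  exact.
move=> a1; pose y := star a ** a.
have sy : star y = y by rewrite /y stM starK.
have y1 : rnorm y < 1 by rewrite rnorm_starM expr_lt1 // rnorm_ge0.
have yy1 : rnorm (y ** y) < 1.
  by rewrite -{1}sy rnorm_starM expr_lt1 // rnorm_ge0.
have syy : star (y ** y) = y ** y by rewrite stM sy.
have [s [ss _ s2 sc]] := one_minus_sqrt syy (lexx _) yy1.
pose p := g e; pose b := g y; pose t := g s.
have pp : p ** p = p by rewrite /p -(star_homM gh) el.
have sp : star p = p by rewrite /p -(star_homS gh) se.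
have bt : b ** t = t ** b.
  by rewrite /b /t -!(star_homM gh) sc // sMA.
have pt : p ** t = t by rewrite /p /t -(star_homM gh) el.
have tp : t ** p = t by rewrite /p /t -(star_homM gh) er.
have pb : p ** b = b by rewrite /p /b -(star_homM gh) el.
have bp : b ** p = b by rewrite /p /b -(star_homM gh) er.
have sb : star b = b by rewrite /b -(star_homS gh) sy.
have st : star t = t by rewrite /t -(star_homS gh) ss.
have t2 : t + t = b ** b + t ** t.
  by rewrite /b /t -!(star_homM gh) -!(star_homD gh) s2.
apply: rnorm_le1_starM; rewrite -(star_homS gh) -(star_homM gh) -/y -/b.
apply: (@rnorm_commuting_squares _ _ b (p - t)) => //.
- by rewrite starB sp st.
- by rewrite smulBr smulBl bp pb bt.
have -> : b ** b + (p - t) ** (p - t) = p.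
  have -> : b ** b = t + t - t ** t by rewrite t2 addrK.
  by rewrite smulBl !smulBr pp pt tp -[p - t - _]addrA -opprD (addrA t) [LHS]addrC subrK.
by apply: rnorm_projection; rewrite sp.
Qed.

(** * The C*-algebra of adjointable operators *)

(** [ip] is the real part of a complex inner product, and [ipJ] carries the complex structure. For
    complex-linear maps the adjoints and norms are those of the complex inner product, so real
    estimates suffice. Completeness is stated for geometrically decaying tails, the form in which
    Cauchy sequences arise below. *)
Record hilbert (R : realType) := Hilbert {
  hsort :> lmodType (Cplx R);
  ip : hsort -> hsort -> R;
  ipC : forall x y, ip x y = ip y x;
  ipDl : forall x y z, ip (x + y) z = ip x z + ip y z;
  ipZl : forall (r : R) x y, ip (rC r *: x) y = r * ip x y;
  ipJ : forall (k : Cplx R) x y, ip (k *: x) y = ip x (k^* *: y);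
  ip_ge0 : forall x, 0 <= ip x x;
  ip_eq0 : forall x, ip x x = 0 -> x = 0;
  hilbert_complete : forall (u : nat -> hsort) (M q : R), 0 <= q < 1 ->
    (forall n m, (n <= m)%N ->
      Num.sqrt (ip (u n - u m) (u n - u m)) <= M * q ^+ n) ->
    exists l, forall e : R, 0 < e -> exists N, forall n, (N <= n)%N ->
      Num.sqrt (ip (u n - l) (u n - l)) <= e }.
Arguments ip {R h}.

Section Hilbert.
Variables (R : realType) (H : hilbert R).
Local Notation C := (Cplx R).
Implicit Types (x y z : H) (k : C).

Definition hnorm x := Num.sqrt (ip x x).

Lemma ipDr x y z : ip x (y + z) = ip x y + ip x z.
Proof. by rewrite ipC ipDl !(ipC x). Qed.
Lemma ipZr (r : R) x y : ip x (rC r *: y) = r * ip x y.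
Proof. by rewrite ipC ipZl ipC. Qed.
Lemma ipNl x y : ip (- x) y = - ip x y.
Proof. by rewrite -scaleN1r -rC1 -rCN ipZl mulN1r. Qed.
Lemma ipNr x y : ip x (- y) = - ip x y.
Proof. by rewrite ipC ipNl ipC. Qed.
Lemma ipBl x y z : ip (x - y) z = ip x z - ip y z.
Proof. by rewrite ipDl ipNl. Qed.
Lemma ipBr x y z : ip x (y - z) = ip x y - ip x z.
Proof. by rewrite ipDr ipNr. Qed.
Lemma ip0l x : ip 0 x = 0.
Proof. by rewrite -(subrr (0 : H)) ipBl subrr. Qed.

Lemma hnorm_ge0 x : 0 <= hnorm x. Proof. exact: sqrtr_ge0. Qed.
Lemma hnorm_sqr x : hnorm x ^+ 2 = ip x x.
Proof. by rewrite sqr_sqrtr // ip_ge0. Qed.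
Lemma hnorm_eq0 x : hnorm x = 0 -> x = 0.
Proof. by move=> x0; apply: ip_eq0; rewrite -hnorm_sqr x0 expr0n. Qed.
Lemma hnorm0 : hnorm 0 = 0. Proof. by rewrite /hnorm ip0l sqrtr0. Qed.

Lemma hilbert_CS x y : ip x y <= hnorm x * hnorm y.
Proof.
have [y0|y0] := eqVneq (hnorm y) 0.
  by rewrite y0 mulr0 (hnorm_eq0 y0) ipC ip0l.
have yp : 0 < hnorm y by rewrite lt_def y0 hnorm_ge0.
have [x0|x0] := eqVneq (hnorm x) 0.
  by rewrite x0 mul0r (hnorm_eq0 x0) ip0l.
have xp : 0 < hnorm x by rewrite lt_def x0 hnorm_ge0.
(* With [a], [b] the norms and [t = ip x y], the value [ip w w] is [2 a b (a b - t)]. *)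
pose w := rC (hnorm y) *: x - rC (hnorm x) *: y.
have := ip_ge0 w; rewrite /w ipBl !ipBr !ipZl !ipZr (ipC y x) -!hnorm_sqr.
set a := hnorm x; set b := hnorm y; set t := ip x y => h.
have ab : 0 < 2 * (a * b) by rewrite !mulr_gt0.
rewrite -(ler_pM2l ab) -subr_ge0; apply: le_trans h _.
by rewrite le_eqVlt; apply/orP; left; apply/eqP; ring.
Qed.

Lemma hnormZ k x : hnorm (k *: x) = rnorm (k : C^o) * hnorm x.
Proof.
rewrite /hnorm ipJ scalerA [k^* * k]mulrC -normCK rnormE /rC -rmorphXn -/rC.
by rewrite ipZr sqrtrM ?exprn_ge0 ?rnorm_ge0 // sqrtr_sqr ger0_norm // rnorm_ge0.
Qed.

Lemma hnormN x : hnorm (- x) = hnorm x.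
Proof. by rewrite /hnorm ipNl ipNr opprK. Qed.

Lemma hnormC x y : hnorm (x - y) = hnorm (y - x).
Proof. by rewrite -hnormN opprB. Qed.

Lemma hnormD x y : hnorm (x + y) <= hnorm x + hnorm y.
Proof.
rewrite -(ler_pXn2r (n := 2)) ?nnegrE ?addr_ge0 ?hnorm_ge0 //.
rewrite sqrrD !hnorm_sqr ipDl !ipDr (ipC y x).
have := hilbert_CS x y; set a := hnorm x * hnorm y => h.
by rewrite mulr2n; lra.
Qed.

Lemma hnorm_dist y x z : hnorm (x - z) <= hnorm (x - y) + hnorm (y - z).
Proof. by apply: le_trans (hnormD _ _); rewrite addrA subrK. Qed.

Lemma ip_ext x y : (forall z, ip x z = ip y z) -> x = y.
Proof.
move=> xy; apply/eqP; rewrite -subr_eq0; apply/eqP/ip_eq0.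
by rewrite ipBl xy subrr.
Qed.

Definition bounded_by (T : H -> H) (M : R) := forall x, hnorm (T x) <= M * hnorm x.
Definition adjoint (T T' : H -> H) := forall x y, ip (T x) y = ip x (T' y).

Lemma adjoint_sym T T' : adjoint T T' -> adjoint T' T.
Proof. by move=> a x y; rewrite ipC -a ipC. Qed.

Lemma adjoint_uniq T T1 T2 : adjoint T T1 -> adjoint T T2 -> T1 = T2.
Proof.
by move=> a1 a2; apply/funext => y; apply: ip_ext => x; rewrite ipC -a1 a2 ipC.
Qed.

Lemma adjointD T T' x y : adjoint T T' -> T (x + y) = T x + T y.
Proof. by move=> a; apply: ip_ext => z; rewrite a !ipDl !a. Qed.

(* The inner product [ip] is only real-valued, hence complex homogeneity is    *)
(* not a consequence of adjointness and is required separately.                *)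
Definition homogeneous (T : H -> H) := forall k x, T (k *: x) = k *: T x.

Lemma adjoint_homogeneous T T' : adjoint T T' -> homogeneous T -> homogeneous T'.
Proof.
move=> a hT k y; apply: ip_ext => x.
by rewrite [LHS]ipC -a [LHS]ipC ipJ -hT [LHS]ipC a [LHS]ipC -ipJ.
Qed.

Lemma bounded_adjoint T T' M : 0 <= M ->
  adjoint T T' -> bounded_by T M -> bounded_by T' M.
Proof.
move=> M0 a bT y; have [y0|y0] := eqVneq (hnorm (T' y)) 0.
  by rewrite y0 mulr_ge0 // hnorm_ge0.
have yp : 0 < hnorm (T' y) by rewrite lt_def y0 hnorm_ge0.
rewrite -(ler_pM2l yp) -expr2 hnorm_sqr -a.
apply: le_trans (hilbert_CS _ _) _.
by rewrite mulrA [_ * M]mulrC ler_wpM2r ?hnorm_ge0.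
Qed.

Definition operator : {pred H -> H} := fun T =>
  `[< [/\ homogeneous T, exists T', adjoint T T' & exists M, bounded_by T M] >].

Lemma operator_submod : submod_closed operator.
Proof.
split=> [|k S T /asboolP[hS [S' aS] [M bS]] /asboolP[hT [T' aT] [N bT]]].
  apply/asboolP; split=> [k x||]; first by rewrite -[RHS]/(k *: 0) scaler0.
    by exists 0 => x y; rewrite ip0l ipC ip0l.
  by exists 0 => x; rewrite mul0r hnorm0.
apply/asboolP; split=> [l x||].
- rewrite -[LHS]/(k *: S (l *: x) + T (l *: x)) hS hT.
  by rewrite -[RHS]/(l *: (k *: S x + T x)) scalerDr !scalerA mulrC.
- exists (fun y => S' (k^* *: y) + T' y) => x y.
  by rewrite -[ip _ y]/(ip (k *: S x + T x) y) ipDl ipDr ipJ aS aT.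
- exists (rnorm (k : C^o) * M + N) => x.
  rewrite mulrDl -mulrA; apply: le_trans (hnormD _ _) _; apply: lerD => //.
  by rewrite hnormZ ler_wpM2l ?rnorm_ge0.
Qed.

HB.instance Definition _ :=
  GRing.isSubmodClosed.Build C (H -> H) operator operator_submod.

Record opH := OpH { op_val :> H -> H; op_valP : op_val \in operator }.
HB.instance Definition _ := [isSub for op_val].
HB.instance Definition _ := [Choice of opH by <:].
HB.instance Definition _ := [SubChoice_isSubLmodule of opH by <:].

Implicit Types S T : opH.

Lemma opP T : [/\ homogeneous T, exists T' : H -> H, adjoint T T' & exists M, bounded_by T M].
Proof. by have /asboolP := op_valP T. Qed.

Lemma op_eq S T : (forall x, S x = T x) -> S = T.
Proof. by move=> ST; apply: val_inj; apply/funext. Qed.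

Lemma op_D S T x : (S + T) x = S x + T x. Proof. by []. Qed.
Lemma op_Z k T x : (k *: T) x = k *: T x. Proof. by []. Qed.

Definition op_bounds T : set R := [set M | 0 <= M /\ bounded_by T M].
Definition opnorm T : R := inf (op_bounds T).

Lemma op_bounds_has_inf T : has_inf (op_bounds T).
Proof.
split; last by exists 0 => M [].
have [_ _ [M bM]] := opP T; exists (Num.max M 0); split=> [|x].
  by rewrite le_max lexx orbT.
apply: le_trans (bM x) _; rewrite ler_wpM2r ?hnorm_ge0 //.
by rewrite le_max lexx.
Qed.

Lemma opnorm_ge0 T : 0 <= opnorm T.
Proof.
apply: lb_le_inf; first by case: (op_bounds_has_inf T).
by move=> M [].
Qed.

Lemma opnorm_le T M : 0 <= M -> bounded_by T M -> opnorm T <= M.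
Proof. by move=> M0 bM; apply: ge_inf; [case: (op_bounds_has_inf T)|split]. Qed.

Lemma opnorm_bound T x : hnorm (T x) <= opnorm T * hnorm x.
Proof.
have [x0|x0] := eqVneq (hnorm x) 0.
  have [_ _ [M bM]] := opP T.
  by apply: le_trans (bM x) _; rewrite x0 !mulr0.
have xp : 0 < hnorm x by rewrite lt_def x0 hnorm_ge0.
rewrite -ler_pdivrMr //; apply: lb_le_inf.
  by case: (op_bounds_has_inf T).
by move=> M [_ bM]; rewrite ler_pdivrMr.
Qed.

Definition opnormC T : C := rC (opnorm T).

Lemma opnormD S T : opnormC (S + T) <= opnormC S + opnormC T.
Proof.
rewrite /opnormC -rCD rC_le; apply: opnorm_le.
  by rewrite addr_ge0 ?opnorm_ge0.
move=> x; rewrite op_D mulrDl; apply: le_trans (hnormD _ _) _.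
by apply: lerD; exact: opnorm_bound.
Qed.

Lemma opnormZ k T : opnormC (k *: T) = `|k| * opnormC T.
Proof.
rewrite (rnormE (k : C^o)) /opnormC -rCM; congr rC.
have le l S : opnorm (l *: S) <= rnorm (l : C^o) * opnorm S.
  apply: opnorm_le => [|x]; first by rewrite mulr_ge0 ?opnorm_ge0 ?rnorm_ge0.
  by rewrite op_Z hnormZ -mulrA ler_wpM2l ?rnorm_ge0 // opnorm_bound.
apply/eqP; rewrite eq_le le /=; have [->|k0] := eqVneq k 0.
  by rewrite /rnorm normr0 mul0r opnorm_ge0.
have kp : 0 < rnorm (k : C^o).
  rewrite lt_def rnorm_ge0 andbT; apply: contra k0 => /eqP k0.
  by apply/eqP/(@rnorm_eq0 _ C^o).
rewrite -ler_pdivlMl // -{1}[T]scale1r -(mulVf k0) -scalerA.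
apply: le_trans (le _ _) _; rewrite le_eqVlt; apply/orP; left; apply/eqP.
congr (_ * _); apply: rC_inj; rewrite [RHS](fmorphV (real_complex R)).
have := normfV k.
by rewrite (rnormE (k^-1 : C^o)) (rnormE (k : C^o)).
Qed.

Lemma opnorm_eq0 T : opnormC T = 0 -> T = 0.
Proof.
move=> /rC_inj T0; apply: op_eq => x; apply: hnorm_eq0; apply/eqP.
by rewrite eq_le hnorm_ge0 andbT; have := opnorm_bound T x; rewrite T0 mul0r.
Qed.

HB.instance Definition _ :=
  Lmodule_isNormed.Build C opH opnormD opnormZ opnorm_eq0.

Lemma op_rnorm T : rnorm T = opnorm T.
Proof. by []. Qed.

Definition op_adj T : H -> H :=
  projT1 (cid (let: And3 _ h _ := opP T in h)).

Lemma op_adjP T : adjoint T (op_adj T).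
Proof. exact: (projT2 (cid _)). Qed.

Lemma bounded_op_adj T : bounded_by (op_adj T) (opnorm T).
Proof.
apply: (bounded_adjoint (opnorm_ge0 T) (op_adjP T)) => x.
exact: opnorm_bound.
Qed.

Lemma op_adj_proof T : op_adj T \in operator.
Proof.
have [hT _ _] := opP T; apply/asboolP; split.
- exact: (adjoint_homogeneous (op_adjP T)).
- by exists T; apply: adjoint_sym; exact: op_adjP.
- by exists (opnorm T); exact: bounded_op_adj.
Qed.
Definition op_star T := OpH (op_adj_proof T).

Lemma op_starP S T : adjoint S T -> op_star S = T.
Proof.
by move=> a; apply: op_eq => x; rewrite -(adjoint_uniq (op_adjP S) a).
Qed.

Lemma op_mul_proof S T : (S : H -> H) \o (T : H -> H) \in operator.
Proof.
have [hS _ _] := opP S; have [hT _ _] := opP T; apply/asboolP; split.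
- by move=> k x /=; rewrite hT hS.
- by exists (op_adj T \o op_adj S) => x y /=; rewrite !op_adjP.
- exists (opnorm S * opnorm T) => x /=.
  apply: le_trans (opnorm_bound _ _) _.
  by rewrite -mulrA ler_wpM2l ?opnorm_ge0 // opnorm_bound.
Qed.
Definition op_mul S T := OpH (op_mul_proof S T).

Lemma op_mulA S T U : op_mul S (op_mul T U) = op_mul (op_mul S T) U.
Proof. exact: op_eq. Qed.
Lemma op_mulDl S T U : op_mul (S + T) U = op_mul S U + op_mul T U.
Proof. exact: op_eq. Qed.
Lemma op_mulDr S T U : op_mul S (T + U) = op_mul S T + op_mul S U.
Proof. by apply: op_eq => x; exact: (adjointD _ _ (op_adjP S)). Qed.
Lemma op_mulZl k S T : op_mul (k *: S) T = k *: op_mul S T.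
Proof. exact: op_eq. Qed.
Lemma op_mulZr k S T : op_mul S (k *: T) = k *: op_mul S T.
Proof. by apply: op_eq => x; have [hS _ _] := opP S; exact: hS. Qed.
Lemma op_starK T : op_star (op_star T) = T.
Proof. by apply: op_starP; apply: adjoint_sym; exact: op_adjP. Qed.
Lemma op_starD S T : op_star (S + T) = op_star S + op_star T.
Proof.
apply: op_starP => x y.
by rewrite op_D ipDl !op_adjP -ipDr.
Qed.
Lemma op_starZ k T : op_star (k *: T) = k^* *: op_star T.
Proof.
apply: op_starP => x y; have [hT _ _] := opP T.
by rewrite op_Z -hT op_adjP ipJ.
Qed.
Lemma op_starM S T : op_star (op_mul S T) = op_mul (op_star T) (op_star S).
Proof. by apply: op_starP => x y; rewrite /= !op_adjP. Qed.

HB.instance Definition _ := isStarAlgebra.Build C opH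
  op_mulA op_mulDl op_mulDr op_mulZl op_mulZr
  op_starK op_starD op_starZ op_starM.

Lemma op_norm_mul S T : `|smul S T| <= `|S| * `|T|.
Proof.
rewrite -[leLHS]/(opnormC _) -[leRHS]/(opnormC _ * opnormC _) -rCM rC_le.
apply: opnorm_le => [|x]; first by rewrite mulr_ge0 ?opnorm_ge0.
apply: le_trans (opnorm_bound S (T x)) _.
by rewrite -mulrA ler_wpM2l ?opnorm_ge0 // opnorm_bound.
Qed.

Lemma op_norm_star_mul T : `|smul (star T) T| = `|T| ^+ 2.
Proof.
rewrite -[LHS]/(rC (opnorm _)) -[ `|T| ]/(rC (opnorm T)) /rC -rmorphXn -/rC.
congr rC; apply/eqP; rewrite eq_le; apply/andP; split.
  apply: opnorm_le => [|x]; first by rewrite exprn_ge0 ?opnorm_ge0.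
  apply: le_trans (bounded_op_adj T (T x)) _.
  by rewrite expr2 -mulrA ler_wpM2l ?opnorm_ge0 // opnorm_bound.
have hx x : ip (T x) (T x) <= opnorm (smul (star T) T) * hnorm x ^+ 2.
  rewrite op_adjP ipC expr2 mulrA.
  apply: le_trans (hilbert_CS _ _) _; rewrite ler_wpM2r ?hnorm_ge0 //.
  exact: (opnorm_bound (smul (star T) T)).
have := opnorm_ge0 (smul (star T) T); move: (opnorm _) hx => N hx N0.
have sN : Num.sqrt N ^+ 2 = N by rewrite sqr_sqrtr.
rewrite -[N]sN ler_pXn2r ?nnegrE ?opnorm_ge0 ?sqrtr_ge0 //.
apply: opnorm_le => [|x]; first exact: sqrtr_ge0.
rewrite -(ler_pXn2r (n := 2)) ?nnegrE ?mulr_ge0 ?hnorm_ge0 ?sqrtr_ge0 //.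
by rewrite hnorm_sqr exprMn sN.
Qed.

(* A Cauchy filter is approximated by a sequence with geometric steps, whose   *)
(* pointwise limit, and that of the adjoints, exist by completeness of [H].    *)
Lemma op_complete (F : set_system opH) : ProperFilter F -> cauchy F -> cvg F.
Proof.
move=> FF Fc; have q01 : 0 <= (2^-1 : R) < 1.
  by rewrite invr_ge0 ler0n invf_lt1 // ltr1n.
have e0 n : 0 < (2^-1 : R) ^+ n by rewrite exprn_gt0.
have /cauchyP FE : cauchy F by [].
have /choice[u uF] : forall n, exists T, F (ball T (rC (2^-1 ^+ n))).
  by move=> n; apply: FE; rewrite rC_lt.
have ballE S T e : ball S (rC e) T -> opnorm (S - T) < e.
  by rewrite -ball_normE /= -[ `|_| ]/(rC (opnorm _)) rC_lt.
have umn n m : (n <= m)%N -> opnorm (u n - u m) <= 2 * 2^-1 ^+ n.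
  move=> nm; have [T [/ballE uT /ballE vT]] := filter_ex (filterI (uF n) (uF m)).
  rewrite -op_rnorm; apply: le_trans (rnorm_dist T _ _) _.
  rewrite mulr_natl mulr2n; apply: lerD; first exact: ltW.
  rewrite rnormC; apply: le_trans (ltW vT) _.
  by case/andP: q01 => q0 q1; rewrite ler_wiXn2l // ltW.
have adjB S T x : op_adj S x - op_adj T x = op_adj (S - T) x.
  rewrite -[RHS]/(op_star (S - T) x) -[- T]scaleN1r op_starD op_starZ.
  by rewrite rmorphN1 scaleN1r.
have lim (v : nat -> H -> H) : (forall n m x, (n <= m)%N ->
    hnorm (v n x - v m x) <= 2 * 2^-1 ^+ n * hnorm x) ->
    exists T : H -> H, forall n x, hnorm (v n x - T x) <= 2 * 2^-1 ^+ n * hnorm x.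
  move=> vmn; have /choice[T Tl] : forall x, exists l, forall e : R, 0 < e ->
      exists N, forall n, (N <= n)%N -> hnorm (v n x - l) <= e.
    move=> x; apply: (@hilbert_complete _ H _ (2 * hnorm x) _ q01) => n m nm.
    by rewrite -/(hnorm _) mulrAC vmn.
  exists T => n x; apply/ler_addgt0Pr => e ep; have [N hN] := Tl x e ep.
  apply: le_trans (hnorm_dist (v (maxn n N) x) _ _) _; apply: lerD.
    by rewrite vmn // leq_maxl.
  by rewrite hN // leq_maxr.
have [T Tu] : exists T : H -> H, forall n x, hnorm (u n x - T x) <= 2 * 2^-1 ^+ n * hnorm x.
  apply: lim => n m x nm; apply: le_trans (opnorm_bound (u n - u m) x) _.
  by rewrite ler_wpM2r ?hnorm_ge0 // umn.
have [T' Tu'] : exists T' : H -> H, forall n x,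
    hnorm (op_adj (u n) x - T' x) <= 2 * 2^-1 ^+ n * hnorm x.
  apply: lim => n m x nm; rewrite adjB; apply: le_trans (bounded_op_adj _ x) _.
  by rewrite ler_wpM2r ?hnorm_ge0 // umn.
have small (r M : R) : (forall n, r <= M * 2^-1 ^+ n) -> r <= 0.
  move=> rM; apply/ler_addgt0Pr => e ep; rewrite add0r.
  have [N hN] := geometric_small M q01 ep.
  exact: le_trans (rM N) (hN N _).
have TP : T \in operator.
  apply/asboolP; split.
  - move=> k x; apply/eqP; rewrite -subr_eq0; apply/eqP/hnorm_eq0/eqP.
    rewrite eq_le hnorm_ge0 andbT.
    apply: (small _ (2 * hnorm (k *: x) + 2 * hnorm (k *: x))) => n.
    have [hu _ _] := opP (u n).
    apply: le_trans (hnorm_dist (u n (k *: x)) _ _) _.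
    rewrite mulrDl; apply: lerD; first by rewrite hnormC mulrAC.
    rewrite hu -scalerBr [leLHS]hnormZ; apply: le_trans (ler_wpM2l (rnorm_ge0 _) (Tu n x)) _.
    by rewrite hnormZ le_eqVlt; apply/orP; left; apply/eqP; ring.
  - exists T' => x y; apply/eqP; rewrite eq_le -!(subr_le0 (ip _ _)).
    have E n : ip (T x) y - ip x (T' y) =
        ip (T x - u n x) y + ip x (op_adj (u n) y - T' y).
      by rewrite ipBl ipBr op_adjP addrA subrK.
    apply/andP; split; apply: (small _ (4 * (hnorm x * hnorm y))) => n.
      rewrite (E n).
      apply: le_trans (lerD (hilbert_CS _ _) (hilbert_CS _ _)) _.
      apply: le_trans (lerD (ler_wpM2r (hnorm_ge0 _) _)
        (ler_wpM2l (hnorm_ge0 _) (Tu' n y))) _; first by rewrite hnormC; exact: Tu.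
      by rewrite le_eqVlt; apply/orP; left; apply/eqP; ring.
    rewrite -opprB (E n) opprD -ipNl -ipNr.
    apply: le_trans (lerD (hilbert_CS _ _) (hilbert_CS _ _)) _; rewrite !hnormN.
    apply: le_trans (lerD (ler_wpM2r (hnorm_ge0 _) _)
      (ler_wpM2l (hnorm_ge0 _) (Tu' n y))) _; first by rewrite hnormC; exact: Tu.
    by rewrite le_eqVlt; apply/orP; left; apply/eqP; ring.
  - exists (opnorm (u 0%N) + 2) => x; rewrite -[T x](subrK (u 0%N x)) addrC mulrDl.
    apply: le_trans (hnormD _ _) _; apply: lerD; first exact: opnorm_bound.
    by rewrite hnormC; have := Tu 0%N x; rewrite expr0 mulr1.
apply/cvg_ex; exists (OpH TP : opH); apply/cvg_ballP => e ep.
have er : e = rC (complex.Re e) by rewrite /rC RRe_real // realE ltW.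
have ep' : 0 < complex.Re e by rewrite -rC_lt -er.
have [|N hN] := geometric_small 3 q01 (e := complex.Re e / 2).
  by rewrite divr_gt0.
apply: filterS (uF N) => S /ballE uS.
rewrite -ball_normE /= -[ `|_| ]/(rC (opnorm _)) er rC_lt -op_rnorm.
apply: (@le_lt_trans _ _ (complex.Re e / 2)); last first.
  by rewrite ltr_pdivrMr // mulr_natr mulr2n ltrDl.
apply: le_trans (rnorm_dist (u N) _ _) _; apply: le_trans (hN N (leqnn N)).
rewrite (_ : 3 = 2 + 1 :> R); last by ring.
rewrite mulrDl mul1r; apply: lerD; last exact: ltW.
rewrite rnormC; apply: opnorm_le => [|x]; last exact: Tu.
by rewrite mulr_ge0 // ltW.
Qed.

HB.instance Definition _ := Uniform_isComplete.Build opH op_complete.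
HB.instance Definition _ := StarAlgebra_isCStar.Build C opH
  op_norm_mul op_norm_star_mul.

End Hilbert.

(** * The Hilbert space of square summable functions *)

Section L2.
Variables (R : realType) (I : choiceType).
Local Notation C := (Cplx R).
Implicit Types (z w k : C) (x y : I -> C) (f g : I -> R) (F : {fset I}).

(** The real part of the sesquilinear product of two complex numbers, matching the real-valued
    [ip]. *)
Definition cdot z w : R :=
  complex.Re z * complex.Re w + complex.Im z * complex.Im w.

Lemma cdotC z w : cdot z w = cdot w z.
Proof. by rewrite /cdot mulrC [X in _ + X]mulrC. Qed.
Lemma cdotDl z1 z2 w : cdot (z1 + z2) w = cdot z1 w + cdot z2 w.
Proof. by case: z1 z2 w => [a b] [c d] [r s]; rewrite /cdot /=; ring. Qed.
Lemma cdotZl (r : R) z w : cdot (rC r * z) w = r * cdot z w.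
Proof. by case: z w => [a b] [c d]; rewrite /cdot /=; ring. Qed.
Lemma cdotJ k z w : cdot (k * z) w = cdot z (k^* * w).
Proof.
have -> : k^* = conjc k by [].
by case: k z w => [a b] [c d] [r s]; rewrite /cdot /=; ring.
Qed.
Lemma cdot_ge0 z : 0 <= cdot z z.
Proof. by rewrite addr_ge0 // -expr2 sqr_ge0. Qed.
Lemma cdot_eq0 z : cdot z z = 0 -> z = 0.
Proof.
case: z => a b; rewrite /cdot /= -!expr2 => /eqP.
rewrite paddr_eq0 ?sqr_ge0 // !sqrf_eq0 => /andP[/eqP -> /eqP ->].
by [].
Qed.
Lemma cdotBle z w : cdot (z + w) (z + w) <= 2 * cdot z z + 2 * cdot w w.
Proof.
case: z w => a b [c d]; rewrite /cdot /=.
have := sqr_ge0 (a - c); have := sqr_ge0 (b - d); rewrite !expr2; nra.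
Qed.

(** Convergence along the net of finite subsets: the index set may have any cardinality, and
    reindexing by a bijection is immediate. *)
Definition sums f (r : R) := forall e : R, 0 < e ->
  exists F0, forall F, (F0 `<=` F)%fset -> `|r - \sum_(i <- F) f i| <= e.

Lemma sums_uniq f r s : sums f r -> sums f s -> r = s.
Proof.
move=> fr fs; apply/eqP; rewrite -subr_eq0 -normr_eq0 eq_le normr_ge0 andbT.
apply/ler_addgt0Pl => e e0; rewrite addr0.
have e2 : 0 < e / 2 by rewrite divr_gt0.
have [F1 h1] := fr _ e2; have [F2 h2] := fs _ e2.
rewrite [e]splitr; set F := (F1 `|` F2)%fset.
apply: le_trans (ler_distD (\sum_(i <- F) f i) _ _) _; apply: lerD.
  exact/h1/fsubsetUl.
by rewrite distrC; exact/h2/fsubsetUr.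
Qed.

Lemma sumsD f g r s : sums f r -> sums g s -> sums (fun i => f i + g i) (r + s).
Proof.
move=> fr gs e e0; have e2 : 0 < e / 2 by rewrite divr_gt0.
have [F1 h1] := fr _ e2; have [F2 h2] := gs _ e2.
exists (F1 `|` F2)%fset => F; rewrite fsubUset => /andP[F1F F2F].
rewrite big_split /= opprD addrACA [e]splitr.
by apply: le_trans (ler_normD _ _) (lerD (h1 _ F1F) (h2 _ F2F)).
Qed.

Lemma sumsZ f r (k : R) : sums f r -> sums (fun i => k * f i) (k * r).
Proof.
move=> fr e e0; have k0 : 0 < `|k| + 1 by rewrite ltr_wpDl.
have [|F0 h] := fr (e / (`|k| + 1)); first by rewrite divr_gt0.
exists F0 => F /h hF; rewrite -mulr_sumr -mulrBr normrM.
have k1 : `|k| <= `|k| + 1 by rewrite lerDl.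
apply: le_trans (ler_pM _ _ k1 hF) _ => //.
by rewrite mulrCA mulfV ?mulr1 // gt_eqF.
Qed.

Lemma sum_fsubset f F G : (forall i, 0 <= f i) -> (F `<=` G)%fset ->
  \sum_(i <- F) f i <= \sum_(i <- G) f i.
Proof.
move=> f0 FG; rewrite [leRHS](big_fsetID _ (mem F)) /=.
have -> : [fset x in G | x \in F]%fset = F.
  apply/fsetP => i; rewrite !inE andbC; case: (boolP (i \in F)) => //= iF.
  exact: (fsubsetP FG).
by rewrite lerDl sumr_ge0.
Qed.

Lemma sums_ge f r F : (forall i, 0 <= f i) -> sums f r -> \sum_(i <- F) f i <= r.
Proof.
move=> f0 fr; apply/ler_addgt0Pr => e e0; have [F0 h] := fr e e0.
have := h (F0 `|` F)%fset (fsubsetUl _ _); rewrite ler_norml => /andP[h1 _].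
have : \sum_(i <- F) f i <= \sum_(i <- (F0 `|` F)%fset) f i.
  exact: sum_fsubset (fsubsetUr _ _).
lra.
Qed.

Lemma sums_le f r M : (forall F, \sum_(i <- F) f i <= M) -> sums f r -> r <= M.
Proof.
move=> fM fr; apply/ler_addgt0Pr => e e0; have [F0 h] := fr e e0.
have := h F0 (fsubset_refl _); rewrite ler_norml => /andP[_ h0].
by have := fM F0; lra.
Qed.

Lemma sums_nonneg f M : (forall i, 0 <= f i) -> (forall F, \sum_(i <- F) f i <= M) ->
  exists r, sums f r.
Proof.
move=> f0 fM; pose A : set R := [set s | exists F, s = \sum_(i <- F) f i].
have supA : has_sup A.
  by split; [exists 0, fset0; rewrite big_seq_fset0|exists M => _ [F ->]].
exists (sup A) => e e0; have [_ [F0 ->] h] := sup_adherent e0 supA.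
exists F0 => F F0F; have F0le := sum_fsubset f0 F0F.
have : \sum_(i <- F) f i <= sup A by apply: sup_upper_bound => //; exists F.
rewrite ler_norml => FA; apply/andP; split; lra.
Qed.

Definition l2 : {pred I -> C} := fun x =>
  `[< exists M, forall F, \sum_(i <- F) cdot (x i) (x i) <= M >].

Lemma l2_submod : submod_closed l2.
Proof.
split=> [|k x y /asboolP[M xM] /asboolP[N yN]]; apply/asboolP.
  exists 0 => F; rewrite big1 // => i _.
  by rewrite -[0 i]/(0 : C) /cdot /= !mul0r addr0.
exists (2 * (rnorm (k : C^o) ^+ 2 * M) + 2 * N) => F.
apply: (@le_trans _ _ (\sum_(i <- F) (2 * (rnorm (k : C^o) ^+ 2 * cdot (x i) (x i))
    + 2 * cdot (y i) (y i)))).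
  apply: ler_sum => i _; rewrite -[(k *: x + y) i]/(k * x i + y i).
  apply: le_trans (cdotBle _ _) _; rewrite lerD2r ler_pM2l //.
  rewrite cdotJ mulrA [k^* * k]mulrC -normCK (rnormE (k : C^o)).
  by rewrite -rCX cdotC cdotZl.
rewrite big_split -!mulr_sumr /=.
by apply: lerD; rewrite ler_pM2l // ler_wpM2l // exprn_ge0 // rnorm_ge0.
Qed.

HB.instance Definition _ := GRing.isSubmodClosed.Build C (I -> C) l2 l2_submod.

Record ell2 := Ell2 { l2_val :> I -> C; l2_valP : l2_val \in l2 }.
HB.instance Definition _ := [isSub for l2_val].
HB.instance Definition _ := [Choice of ell2 by <:].
HB.instance Definition _ := [SubChoice_isSubLmodule of ell2 by <:].
Implicit Types u v : ell2.

Lemma l2_eq u v : (forall i, u i = v i) -> u = v.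
Proof. by move=> uv; apply: val_inj; apply/funext. Qed.
Lemma l2D u v i : (u + v) i = u i + v i. Proof. by []. Qed.
Lemma l2Z k u i : (k *: u) i = k * u i. Proof. by []. Qed.
Lemma l2B u v i : (u - v) i = u i - v i. Proof. by []. Qed.

Lemma l2_normsq u : exists r, sums (fun i => cdot (u i) (u i)) r.
Proof.
have /asboolP[M uM] := l2_valP u.
by apply: (@sums_nonneg _ M) => // i; exact: cdot_ge0.
Qed.

(* The inner product exists by polarisation. *)
Lemma l2_sums u v : exists r, sums (fun i => cdot (u i) (v i)) r.
Proof.
have [r hr] := l2_normsq (u + v); have [s hs] := l2_normsq u.
have [t ht] := l2_normsq v.
exists (2^-1 * (r + (-1) * (s + t))).
have := sumsZ (2^-1) (sumsD hr (sumsZ (-1) (sumsD hs ht))).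
congr sums; apply/funext => i; rewrite l2D cdotDl ![cdot _ (u i + v i)]cdotC.
by rewrite !cdotDl (cdotC (v i) (u i)); field.
Qed.

Definition l2ip u v : R := projT1 (cid (l2_sums u v)).

Lemma l2ipP u v : sums (fun i => cdot (u i) (v i)) (l2ip u v).
Proof. exact: (projT2 (cid _)). Qed.

Lemma l2ipE u v r : sums (fun i => cdot (u i) (v i)) r -> l2ip u v = r.
Proof. exact/sums_uniq/l2ipP. Qed.

Lemma l2ipC u v : l2ip u v = l2ip v u.
Proof.
apply: l2ipE; have := l2ipP v u; congr sums.
by apply/funext => i; exact: cdotC.
Qed.

Lemma l2ipDl u v (w : ell2) : l2ip (u + v) w = l2ip u w + l2ip v w.
Proof.
apply: l2ipE; have := sumsD (l2ipP u w) (l2ipP v w); congr sums.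
by apply/funext => i; rewrite l2D cdotDl.
Qed.

Lemma l2ipZl (r : R) u v : l2ip (rC r *: u) v = r * l2ip u v.
Proof.
apply: l2ipE; have := sumsZ r (l2ipP u v); congr sums.
by apply/funext => i; rewrite l2Z cdotZl.
Qed.

Lemma l2ipJ k u v : l2ip (k *: u) v = l2ip u (k^* *: v).
Proof.
apply: l2ipE; have := l2ipP u (k^* *: v); congr sums.
by apply/funext => i; rewrite !l2Z cdotJ.
Qed.

Lemma l2ip_sum_le u F : \sum_(i <- F) cdot (u i) (u i) <= l2ip u u.
Proof. by apply: sums_ge (l2ipP u u) => i; exact: cdot_ge0. Qed.

Lemma l2ip_ge0 u : 0 <= l2ip u u.
Proof. by have := l2ip_sum_le u fset0; rewrite big_seq_fset0. Qed.

Lemma l2ip_coord_le u i : cdot (u i) (u i) <= l2ip u u.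
Proof. by have := l2ip_sum_le u [fset i]%fset; rewrite big_seq_fset1. Qed.

Lemma l2ip_eq0 u : l2ip u u = 0 -> u = 0.
Proof.
move=> u0; apply: l2_eq => i; apply: cdot_eq0; apply/eqP.
by rewrite eq_le cdot_ge0 andbT -u0 l2ip_coord_le.
Qed.

(* [u n - c n] is nondecreasing and [u n + c n] nonincreasing for              *)
(* [c n = M * q ^+ n].                                                         *)
Lemma real_geometric_limit (u : nat -> R) (M q : R) : 0 <= q ->
  (forall n m, (n <= m)%N -> `|u n - u m| <= M * q ^+ n) ->
  exists l, forall n, `|u n - l| <= M * q ^+ n.
Proof.
move=> q0 uM; pose A : set R := [set u n - M * q ^+ n | n in setT].
have ub n : ubound A (u n + M * q ^+ n).
  move=> _ [m _ <-]; case: (leqP n m) => [nm|/ltnW mn].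
    have := uM n m nm; rewrite ler_norml => /andP[h _].
    have : 0 <= M * q ^+ m by exact: le_trans (normr_ge0 _) (uM m m (leqnn m)).
    lra.
  have := uM m n mn; rewrite ler_norml => /andP[_ h].
  have : 0 <= M * q ^+ n by exact: le_trans (normr_ge0 _) (uM n n (leqnn n)).
  lra.
have supA : has_sup A.
  by split; [exists (u 0%N - M * q ^+ 0), 0%N|exists (u 0%N + M * q ^+ 0)].
exists (sup A) => n; rewrite ler_norml; apply/andP; split.
  have : sup A <= u n + M * q ^+ n by apply: ge_sup => //; case: supA.
  lra.
have : u n - M * q ^+ n <= sup A by apply: sup_upper_bound => //; exists n.
lra.
Qed.

(** Real and imaginary parts converge in each coordinate. The distance to the limit is then bounded
    on finite sets [F], uniformly in [F], which gives both square summability and convergence. *)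
Lemma l2_complete (u : nat -> ell2) (M q : R) : 0 <= q < 1 ->
  (forall n m, (n <= m)%N ->
    Num.sqrt (l2ip (u n - u m) (u n - u m)) <= M * q ^+ n) ->
  exists l, forall e : R, 0 < e -> exists N, forall n, (N <= n)%N ->
    Num.sqrt (l2ip (u n - l) (u n - l)) <= e.
Proof.
move=> q01 uM; have /andP[q0 q1] := q01.
have M0 n : 0 <= M * q ^+ n by exact: le_trans (sqrtr_ge0 _) (uM n n (leqnn n)).
have uM2 n m : (n <= m)%N -> l2ip (u n - u m) (u n - u m) <= (M * q ^+ n) ^+ 2.
  move=> nm; rewrite -[leLHS]sqr_sqrtr ?l2ip_ge0 //.
  by rewrite ler_pXn2r ?nnegrE ?sqrtr_ge0 ?uM.
have coord n m i : (n <= m)%N -> cdot (u n i - u m i) (u n i - u m i) <= (M * q ^+ n) ^+ 2.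
  by move=> nm; apply: le_trans (l2ip_coord_le (u n - u m) i) (uM2 _ _ nm).
have abs_le (a b c : R) : 0 <= c -> a ^+ 2 + b ^+ 2 <= c ^+ 2 -> `|a| <= c.
  move=> c0 abc; rewrite -(ler_pXn2r (n := 2)) ?nnegrE // real_normK ?num_real //.
  by apply: le_trans abc; rewrite lerDl sqr_ge0.
have /choice[lr lrP] : forall i, exists l, forall n,
    `|complex.Re (u n i) - l| <= M * q ^+ n.
  move=> i; apply: real_geometric_limit => // n m nm.
  have := coord n m i nm; rewrite /cdot -!expr2 => /(abs_le _ _ _ (M0 n)).
  by case: (u n i) (u m i) => a b [c d].
have /choice[li liP] : forall i, exists l, forall n,
    `|complex.Im (u n i) - l| <= M * q ^+ n.
  move=> i; apply: real_geometric_limit => // n m nm.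
  have := coord n m i nm; rewrite /cdot -!expr2 addrC => /(abs_le _ _ _ (M0 n)).
  by case: (u n i) (u m i) => a b [c d].
pose l i : C := Complex (lr i) (li i).
have lP n i : cdot (u n i - l i) (u n i - l i) <= 2 * (M * q ^+ n) ^+ 2.
  have sq_le (a : R) : `|a| <= M * q ^+ n -> a ^+ 2 <= (M * q ^+ n) ^+ 2.
    by move=> h; rewrite -(real_normK (num_real a)) ler_pXn2r ?nnegrE.
  have := sq_le _ (lrP i n); have := sq_le _ (liP i n).
  by rewrite /l /cdot; case: (u n i) => a b /=; rewrite !expr2; lra.
have sumP n F : \sum_(i <- F) cdot (u n i - l i) (u n i - l i) <=
    2 * (M * q ^+ n) ^+ 2.
  apply/ler_addgt0Pr => e e0.
  (* On [F] the sum for [u n - l] is compared with that for [u n - u m]. The remainder is at most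
     [4 #|F| (M q^m)^2], and [m] is chosen to make this at most [e]; the minimum with 1 lets a
     square be bounded by its root. *)
  pose K : R := 4 * #|`F|%:R + 1.
  have K0 : 0 < K by rewrite ltr_wpDl // mulr_ge0.
  have e1 : 0 < Num.min 1 (e / K) by rewrite lt_min ltr01 divr_gt0.
  have [N hN] := geometric_small M q01 e1.
  pose m := maxn n N.
  have hm : M * q ^+ m <= Num.min 1 (e / K) by apply: hN; rewrite leq_maxr.
  have hm2 : (M * q ^+ m) ^+ 2 <= e / K.
    rewrite expr2 -[leRHS]mul1r; apply: ler_pM => //.
      by apply: le_trans hm _; rewrite ge_min lexx.
    by apply: le_trans hm _; rewrite ge_min lexx orbT.
  apply: (@le_trans _ _ (\sum_(i <- F) (2 * cdot ((u n - u m) i) ((u n - u m) i)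
      + 2 * (2 * (M * q ^+ m) ^+ 2)))).
    apply: ler_sum => i _.
    have -> : u n i - l i = (u n - u m) i + (u m i - l i) by rewrite l2B addrA subrK.
    by apply: le_trans (cdotBle _ _) _; rewrite lerD2l ler_pM2l.
  rewrite big_split /= -mulr_sumr; apply: lerD.
    rewrite ler_pM2l //; apply: le_trans (l2ip_sum_le (u n - u m) F) _.
    by apply: uM2; rewrite leq_maxl.
  rewrite big_const_seq count_predT iter_addr_0 -mulr_natr.
  have : (M * q ^+ m) ^+ 2 * K <= e by rewrite -ler_pdivlMr.
  by have := sqr_ge0 (M * q ^+ m); rewrite /K; nra.
have dP : (fun i => u 0%N i - l i) \in l2.
  by apply/asboolP; exists (2 * (M * q ^+ 0) ^+ 2) => F; exact: sumP.
(* Only the difference of [u 0] and [l] is known to be square summable, so the limit is recovered by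
   subtracting it from [u 0]. *)
pose lim := u 0%N - Ell2 dP.
have limE i : lim i = l i by rewrite l2B /= subKr.
exists lim => e e0; have e2 : 0 < e / 2 by rewrite divr_gt0.
have [N hN] := geometric_small M q01 e2; exists N => n /hN hn.
have e1 : 0 <= e by exact: ltW.
rewrite -(ler_pXn2r (n := 2)) ?nnegrE ?sqrtr_ge0 // sqr_sqrtr ?l2ip_ge0 //.
apply: (@le_trans _ _ (2 * (M * q ^+ n) ^+ 2)).
  apply: sums_le (l2ipP _ _) => F; apply: le_trans (sumP n F).
  by rewrite le_eqVlt; apply/orP; left; apply/eqP; apply: eq_bigr => i _; rewrite l2B limE.
have : (M * q ^+ n) ^+ 2 <= (e / 2) ^+ 2 by rewrite ler_pXn2r ?nnegrE // ltW.
by rewrite !expr2; nra.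
Qed.

Definition l2_hilbert : hilbert R :=
  Hilbert l2ipC l2ipDl l2ipZl l2ipJ l2ip_ge0 l2ip_eq0 l2_complete.

End L2.

(** * Normal forms in right-angled Artin groups *)

Section Words.
Variables (S : countType) (e : rel S).
Hypotheses (e_sym : symmetric e) (e_irr : irreflexive e).
Local Notation letter := (S * bool)%type.
Local Notation word := (seq letter).
Implicit Types (l m : letter) (u v w : word) (x y : S).

Definition proj x y w := [seq l <- w | (l.1 == x) || (l.1 == y)].

(* Two words are equivalent up to commutations of adjacent letters iff they    *)
(* have the same projections to all pairs of equal or non-adjacent vertices.   *)
Definition trace_eq u v := forall x y, ~~ e x y -> proj x y u = proj x y v.

Lemma trace_eq_refl u : trace_eq u u. Proof. by []. Qed.
Lemma trace_eq_sym u v : trace_eq u v -> trace_eq v u.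
Proof. by move=> uv x y xy; rewrite uv. Qed.
Lemma trace_eq_trans u v w : trace_eq u v -> trace_eq v w -> trace_eq u w.
Proof. by move=> uv vw x y xy; rewrite uv // vw. Qed.
Lemma trace_eq_cons l u v : trace_eq u v -> trace_eq (l :: u) (l :: v).
Proof. by move=> uv x y xy; rewrite /proj /= -!/(proj _ _ _) uv. Qed.

Lemma trace_eq_filter (f : pred letter) u v :
  trace_eq u v -> trace_eq [seq l <- u | f l] [seq l <- v | f l].
Proof.
move=> uv x y xy; have := uv x y xy; rewrite /proj => h.
have filterC (w : word) : [seq l <- [seq l <- w | f l] | (l.1 == x) || (l.1 == y)] =
    [seq l <- [seq l <- w | (l.1 == x) || (l.1 == y)] | f l].
  by rewrite -!filter_predI; apply: eq_filter => l /=; rewrite andbC.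
by rewrite !filterC h.
Qed.

Lemma neq_adj l m : e l.1 m.1 -> l != m.
Proof. by apply: contraTneq => ->; rewrite e_irr. Qed.

(** Commutations can bring an occurrence of [l] to the front of [w]. *)
Fixpoint beg l w :=
  if w is m :: w' then (m == l) || e m.1 l.1 && beg l w' else false.

Lemma beg_mem l w : beg l w -> l \in w.
Proof.
elim: w => //= m w IH /orP[/eqP ->|/andP[_ /IH lw]]; first exact: mem_head.
by rewrite in_cons lw orbT.
Qed.

(** A letter standing before [l] blocks it exactly when its vertex [y] is not adjacent to that of
    [l], and then it shows up in the projection to this pair. Hence the condition is visible on
    projections and invariant under commutations. *)
Lemma begP l w :
  beg l w <-> forall y, ~~ e l.1 y -> ohead (proj l.1 y w) = Some l.
Proof.
elim: w => [|m w IH] /=; first by split=> // /(_ l.1); rewrite e_irr => /(_ isT).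
split=> [/orP[/eqP -> y _|/andP[ml /IH h] y ly]|h].
- by rewrite /proj /= eqxx.
- rewrite /proj /=; have -> : m.1 == l.1 = false.
    by apply/eqP => m1; rewrite m1 e_irr in ml.
  have -> : m.1 == y = false.
    by apply/eqP => m1; rewrite -m1 e_sym ml in ly.
  exact: h.
- have [//|ml /=] := eqVneq m l; have [em|em] := boolP (e m.1 l.1); last first.
    have := h m.1; rewrite e_sym => /(_ em); rewrite /proj /= eqxx orbT /=.
    by case=> m1; rewrite m1 eqxx in ml.
  apply/IH => y ly; rewrite -(h y ly) /proj /=.
  have -> : m.1 == l.1 = false.
    by apply/eqP => m1; rewrite m1 e_irr in em.
  by have -> : m.1 == y = false by apply/eqP => m1; rewrite -m1 e_sym em in ly.
Qed.

Lemma beg_trace_eq l u v : trace_eq u v -> beg l u = beg l v.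
Proof.
by move=> uv; apply/idP/idP => /begP h; apply/begP => y ly; rewrite -(h y ly) uv.
Qed.

Lemma filter_rem (T : eqType) (p : pred T) (z : T) (s : seq T) :
  [seq t <- rem z s | p t] =
  if p z then rem z [seq t <- s | p t] else [seq t <- s | p t].
Proof.
elim: s => [|t s IH] /=; first by case: ifP.
have [->|tz] := eqVneq t z.
  by case: (boolP (p z)) => pz //=; rewrite ?eqxx.
rewrite /= IH; case: (boolP (p t)) => pt; case: (boolP (p z)) => pz //=.
by rewrite (negbTE tz).
Qed.

Lemma trace_eq_rem l u v : trace_eq u v -> trace_eq (rem l u) (rem l v).
Proof.
by move=> uv x y xy; rewrite /proj !filter_rem -!/(proj _ _ _) uv.
Qed.

Lemma beg_rem l w : beg l w -> trace_eq w (l :: rem l w).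
Proof.
move=> /begP h x y xy; rewrite /proj /= filter_rem -!/(proj _ _ _).
case: (boolP ((l.1 == x) || (l.1 == y))) => // lxy; have : ohead (proj x y w) = Some l.
  case/orP: lxy => /eqP lE; first by rewrite -lE h // lE.
  have -> : proj x y w = proj y x w by apply: eq_filter => m; rewrite orbC.
  by rewrite -lE h // lE e_sym.
by case: (proj x y w) => //= m t [->]; rewrite eqxx.
Qed.

Lemma beg_rem_adj l m w : e l.1 m.1 -> beg m (rem l w) = beg m w.
Proof.
move=> lm; elim: w => //= n w IH; have [->|nl] := eqVneq n l.
  by rewrite (negbTE (neq_adj lm)) lm.
by rewrite /= IH.
Qed.

Lemma inv_letter1 l : (inv_letter l).1 = l.1. Proof. by []. Qed.

(** Reduced words: no letter can be brought by commutations next to an inverse letter. *)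
Fixpoint red w := if w is m :: w' then red w' && ~~ beg (inv_letter m) w' else true.

Lemma red_rem l w : red w -> beg l w ->
  red (rem l w) && ~~ beg (inv_letter l) (rem l w).
Proof.
elim: w => //= m w IH /andP[rw mw]; have [ml|ml] := eqVneq m l.
  by rewrite -ml rw mw.
move=> /= /andP[eml lw]; have /andP[rl ll] := IH rw lw.
have -> : m == inv_letter l = false.
  by apply/negbTE/neq_adj; rewrite inv_letter1.
by rewrite rl beg_rem_adj ?mw ?inv_letter1 ?(negbTE ll) ?andbF // e_sym.
Qed.

Definition act l w := if beg (inv_letter l) w then rem (inv_letter l) w else l :: w.
Definition acts u w := foldr act w u.

Lemma act_red l w : red w -> red (act l w).
Proof.
rewrite /act => rw; case: ifPn => [lw|lw] /=; last by rewrite rw lw.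
by have /andP[] := red_rem rw lw.
Qed.

Lemma acts_red u w : red w -> red (acts u w).
Proof. by elim: u => //= l u IH rw; apply/act_red/IH. Qed.

Lemma act_trace_eq l u v : trace_eq u v -> trace_eq (act l u) (act l v).
Proof.
move=> uv; rewrite /act (beg_trace_eq _ uv); case: ifP => _.
  exact: trace_eq_rem.
exact: trace_eq_cons.
Qed.

Lemma acts_trace_eq w u v : trace_eq u v -> trace_eq (acts w u) (acts w v).
Proof. by elim: w => //= l w IH uv; apply/act_trace_eq/IH. Qed.

Lemma act_cancel l w : red w -> trace_eq (act l (act (inv_letter l) w)) w.
Proof.
move=> rw; rewrite /act inv_letterK; case: (boolP (beg l w)) => lw.
  have /andP[_ /negbTE ->] := red_rem rw lw.
  exact/trace_eq_sym/beg_rem.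
by rewrite /= eqxx /= .
Qed.

Lemma trace_eq_swap l m w : e l.1 m.1 -> trace_eq (l :: m :: w) (m :: l :: w).
Proof.
move=> lm x y xy; rewrite /proj /=.
case: (boolP ((l.1 == x) || (l.1 == y))) => hl //.
case: (boolP ((m.1 == x) || (m.1 == y))) => hm //; exfalso.
have irr := e_irr; have xy' : e y x = false by rewrite e_sym (negbTE xy).
move: lm; case/orP: hl => /eqP ->; case/orP: hm => /eqP ->.
- by rewrite irr.
- by rewrite (negbTE xy).
- by rewrite xy'.
- by rewrite irr.
Qed.

Lemma act_comm l m w : e l.1 m.1 -> trace_eq (act l (act m w)) (act m (act l w)).
Proof.
move=> lm; have ml : e m.1 l.1 by rewrite e_sym.
have nlm : l != inv_letter m by rewrite neq_adj.
have nml : m != inv_letter l by rewrite neq_adj.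
have remC : rem (inv_letter l) (rem (inv_letter m) w) =
    rem (inv_letter m) (rem (inv_letter l) w).
  elim: w => //= n w IH; have [nl|nl] := eqVneq n (inv_letter l).
    rewrite nl; have -> : inv_letter l == inv_letter m = false.
      by apply/negbTE/neq_adj.
    by rewrite /= eqxx.
  have [nm|nm] := eqVneq n (inv_letter m); first by rewrite /= nm eqxx.
  by rewrite /= (negbTE nl) (negbTE nm) IH.
rewrite /act; case bm: (beg (inv_letter m) w);
  case bl: (beg (inv_letter l) w); rewrite ?beg_rem_adj ?bm ?bl //=;
  rewrite ?(negbTE nlm) ?(negbTE nml) /= ?lm ?ml ?bm ?bl /= ?remC //.
exact: trace_eq_swap.
Qed.

(** Van der Waerden's argument. Letters act on reduced words modulo commutations, by left
    multiplication with cancellation, and the action respects the defining relations. Applied to the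
    empty word it recovers a reduced word, up to commutations, from its class in the group. *)
Lemma raag_rel_acts u1 u2 : raag_rel e u1 u2 -> forall w1 w2, red w1 -> red w2 ->
  trace_eq w1 w2 -> trace_eq (acts u1 w1) (acts u2 w2).
Proof.
elim=> {u1 u2} [u|u1 u2 _ IH|u1 u2 u3 _ IH1 _ IH2|u1 u2 v1 v2 _ IHu _ IHv|l|a b ab]
  w1 w2 r1 r2 w12.
- exact: acts_trace_eq.
- exact/trace_eq_sym/IH/trace_eq_sym.
- exact: trace_eq_trans (IH1 _ _ r1 r2 w12) (IH2 _ _ r2 r2 (@trace_eq_refl _)).
- by rewrite /acts !foldr_cat; apply: IHu; rewrite ?acts_red //; exact: IHv.
- exact: trace_eq_trans (act_cancel _ r1) w12.
- apply: (@trace_eq_trans _ (act (b, true) (act (a, true) w1))).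
    exact: act_comm.
  exact/act_trace_eq/act_trace_eq.
Qed.

Lemma acts_nil w : red w -> acts w [::] = w.
Proof. by elim: w => //= m w IH /andP[rw /negbTE mw]; rewrite IH // /act mw. Qed.

Lemma red_trace_eq u v : red u -> red v -> raag_rel e u v -> trace_eq u v.
Proof.
move=> ru rv /raag_rel_acts/(_ [::] [::] isT isT (@trace_eq_refl _)).
by rewrite !acts_nil.
Qed.

End Words.

Section RaagGroup.
Variables (S : countType) (e : rel S).
Hypotheses (e_sym : symmetric e) (e_irr : irreflexive e).
Local Notation letter := (S * bool)%type.
Local Notation word := (seq letter).
Local Notation A := (raag e).
Local Notation P := (raag_pos (e := e)).
Implicit Types (l m : letter) (w : word) (s : S) (u v p q : seq S) (x y z t : A).
Local Open Scope group_scope.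
Local Open Scope quotient_scope.

Definition raag_word w : A := \pi_(raag e) w.

Lemma raag_word_cat w1 w2 : raag_word (w1 ++ w2) = raag_word w1 * raag_word w2.
Proof. exact: Logic.eq_sym (@raag_mul_pi S e w1 w2). Qed.
Lemma raag_word_nil : raag_word [::] = 1. Proof. by []. Qed.
Lemma raag_word_cons l w : raag_word (l :: w) = raag_word [:: l] * raag_word w.
Proof. exact: (raag_word_cat [:: l]). Qed.
Lemma raag_word_inv w : raag_word (inv_word w) = (raag_word w)^-1.
Proof. exact: Logic.eq_sym (@raag_invg_pi S e w). Qed.
Lemma raag_wordP w1 w2 : raag_word w1 = raag_word w2 <-> raag_rel e w1 w2.
Proof. exact: raag_piP. Qed.
Lemma raag_word_surj x : exists w, x = raag_word w.
Proof. by exists (repr x); rewrite /raag_word reprK. Qed.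

Lemma raag_letter_comm l m : e l.1 m.1 ->
  commute (raag_word [:: l]) (raag_word [:: m]).
Proof.
have pos a b : e a b ->
    commute (raag_word [:: (a, true)]) (raag_word [:: (b, true)]).
  move=> ab; rewrite /commute -!raag_word_cat; apply/raag_wordP.
  exact: raag_comm.
have negE a : raag_word [:: (a, false)] = (raag_word [:: (a, true)])^-1.
  by rewrite -raag_word_inv.
case: l m => [a [] [b []]] /= ab; rewrite ?negE.
- exact: pos.
- exact/commuteV/pos.
- exact/commute_sym/commuteV/commute_sym/pos.
- exact/commuteV/commute_sym/commuteV/commute_sym/pos.
Qed.

Lemma beg_raag_word l w : beg e l w -> raag_word w = raag_word [:: l] * raag_word (rem l w).
Proof.
elim: w => //= m w IH; have [->|ml /=] := eqVneq m l; first by rewrite raag_word_cons.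
move=> /andP[eml /IH lw]; rewrite raag_word_cons lw (raag_word_cons _ (rem l w)).
by rewrite !mulgA (raag_letter_comm eml).
Qed.

Lemma beg_rev_raag_word l w : beg e l w ->
  raag_word (rev w) = raag_word (rev (rem l w)) * raag_word [:: l].
Proof.
elim: w => //= m w IH; have [->|ml /=] := eqVneq m l.
  by rewrite rev_cons -cats1 raag_word_cat.
move=> /andP[eml /IH lw]; rewrite !rev_cons -!cats1 !raag_word_cat lw.
by rewrite -!mulgA (raag_letter_comm eml).
Qed.

Lemma trace_eq_raag_word w1 w2 : trace_eq e w1 w2 -> raag_word w1 = raag_word w2.
Proof.
elim: w1 w2 => [|l w1 IH] w2 w12.
  case: w2 w12 => [|m w2] // /(_ m.1 m.1); rewrite e_irr => /(_ isT).
  by rewrite /proj /= eqxx.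
have lw2 : beg e l w2 by rewrite -(beg_trace_eq e_sym e_irr l w12) /= eqxx.
rewrite raag_word_cons (beg_raag_word lw2); congr (_ * _); apply: IH.
by have := trace_eq_rem l w12; rewrite /= eqxx.
Qed.

Definition pos_word u : word := [seq (s, true) | s <- u].
Definition raag_mon u : A := raag_word (pos_word u).

Lemma raag_mon_cat u v : raag_mon (u ++ v) = raag_mon u * raag_mon v.
Proof. by rewrite /raag_mon /pos_word map_cat raag_word_cat. Qed.
Lemma raag_mon_cons s u : raag_mon (s :: u) = raag_gen e s * raag_mon u.
Proof. exact: (raag_mon_cat [:: s]). Qed.
Lemma raag_mon_nil : raag_mon [::] = 1. Proof. by []. Qed.

Lemma raag_posE x : P x <-> exists u, x = raag_mon u.
Proof.
split=> [|[u ->]].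
  elim=> [|a y _ [u ->]]; first by exists [::].
  by exists (a :: u); rewrite raag_mon_cons.
elim: u => [|s u IH]; first exact: raag_pos1.
by rewrite raag_mon_cons; exact: raag_posM.
Qed.

Lemma raag_pos_mon u : P (raag_mon u). Proof. by apply/raag_posE; exists u. Qed.
Hint Resolve raag_pos_mon : core.

Lemma raag_pos_mul x y : P x -> P y -> P (x * y).
Proof. by move=> /raag_posE[u ->] /raag_posE[v ->]; rewrite -raag_mon_cat. Qed.

(** A cancellation pairs a letter [s] of the positive part with an inverse letter in [w]. That
    letter must commute past the rest of [u], so it can end [u] while its inverse can begin [w]. *)
Lemma red_cat u w : red e w ->
  (forall s, beg e (s, true) (rev (pos_word u)) -> ~~ beg e (s, false) w) ->
  red e (pos_word u ++ w).
Proof.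
move=> rw; elim: u => //= s u IH h; rewrite IH /=; last first.
  move=> s' bs'; apply: h; rewrite rev_cons -cats1.
  by elim: (rev _) bs' => //= m w' IHw /orP[->//|/andP[-> /IHw ->]]; rewrite orbT.
apply/negP; rewrite /inv_letter /= => bs.
have /andP[adj bw] : all (fun a => e a s) u && beg e (s, false) w.
  elim: u bs {IH h} => //= a u IH; rewrite xpair_eqE andbF /=.
  by move=> /andP[-> /IH].
suff b' : beg e (s, true) (rev (pos_word (s :: u))).
  by have := h s b'; rewrite bw.
rewrite /= rev_cons -cats1 /pos_word -map_rev.
have : all (fun a => e a s) (rev u) by rewrite all_rev.
elim: (rev u) => /= [|a u' IHu /andP[-> /IHu ->]]; first by rewrite eqxx.
by rewrite orbT.
Qed.

Lemma red_inv_pos v : red e (inv_word (pos_word v)).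
Proof.
suff h v' : red e [seq (s, false) | s <- v'].
  by have := h (rev v); rewrite /inv_word /pos_word -map_comp map_rev.
elim: v' => //= s v' ->; apply/negP => /beg_mem /mapP[s' _].
by rewrite /inv_letter => -[].
Qed.

Lemma red_pos u : red e (pos_word u).
Proof. by rewrite -[pos_word u]cats0; apply: red_cat. Qed.

Lemma raag_mon_trace u v : raag_mon u = raag_mon v ->
  trace_eq e (pos_word u) (pos_word v).
Proof. by move=> /raag_wordP; apply: red_trace_eq => //; exact: red_pos. Qed.

(** The fraction [u v^-1] is in lowest terms: no generator divides both [u] and [v] on the right. A
    final [s] of [v] is an initial [s^-1] of the inverse word. *)
Definition no_common_end u v := forall s,
  beg e (s, true) (rev (pos_word u)) -> ~~ beg e (s, false) (inv_word (pos_word v)).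

Lemma common_end u v : ~ no_common_end u v -> exists s u' v',
  [/\ raag_mon u = raag_mon u' * raag_gen e s,
      raag_mon v = raag_mon v' * raag_gen e s & (size u' < size u)%N].
Proof.
move=> /existsNP[s] /not_implyP[bu /negP/negPn bv].
have remE b (v' : seq S) : rem (s, b) [seq (a, b) | a <- v'] = [seq (a, b) | a <- rem s v'].
  by elim: v' => //= a v' IH; rewrite xpair_eqE eqxx andbT; case: ifP => //= _; rewrite IH.
exists s, (rev (rem s (rev u))), (rev (rem s (rev v))); split.
- have := beg_rev_raag_word bu; rewrite revK -/(raag_mon u) => ->.
  by rewrite /pos_word -map_rev remE /raag_mon /pos_word map_rev.
- have invE v' : inv_word (pos_word v') = [seq (a, false) | a <- rev v'].
    by rewrite /inv_word /pos_word -map_comp map_rev.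
  have := beg_raag_word bv; rewrite raag_word_inv invE remE -[rem s _]revK -invE.
  rewrite raag_word_inv -/(raag_mon _) -/(raag_mon _) => E.
  have := congr1 (fun x : A => x^-1) E; rewrite /= invgK invgM invgK => ->.
  by rewrite revK -raag_word_inv.
- have sr : s \in rev u.
    have /beg_mem := bu; rewrite /pos_word -map_rev => /mapP[a au [->]]; exact: au.
  by rewrite size_rev size_rem // size_rev; case: (u) sr.
Qed.

Lemma raag_fraction_reduce u v : exists u' v',
  no_common_end u' v' /\
  raag_mon u * (raag_mon v)^-1 = raag_mon u' * (raag_mon v')^-1.
Proof.
have [n] := ubnP (size u); elim: n u v => // n IH u v un.
have [|/common_end[s [u' [v' [-> -> su]]]]] := pselect (no_common_end u v).
  by exists u, v.
have [|u1 [v1 [h E]]] := IH u' v'; first exact: leq_trans su _.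
by exists u1, v1; split=> //; rewrite invgM mulgA mulgK E.
Qed.

(** A fraction in lowest terms has the least numerator. Common ends of [p] and [q] are cancelled
    until their fraction is in lowest terms too. *)
Lemma raag_fraction_dvd u v p q : no_common_end u v ->
  raag_mon p * (raag_mon q)^-1 = raag_mon u * (raag_mon v)^-1 ->
  exists r, raag_mon p = raag_mon u * raag_mon r.
Proof.
move=> uv; have [n] := ubnP (size p); elim: n p q => // n IH p q pn pq.
have [pq'|/common_end[s [p' [q' [pE qE sp]]]]] := pselect (no_common_end p q).
  exists [::]; rewrite raag_mon_nil mulg1.
  have /raag_wordP/red_trace_eq pqe :
      raag_word (pos_word p ++ inv_word (pos_word q)) =
      raag_word (pos_word u ++ inv_word (pos_word v)).
    by rewrite !raag_word_cat !raag_word_inv.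
  (* Both words are reduced, hence equal up to commutations, and keeping the positive letters
     identifies [p] with [u]. *)
  have /(trace_eq_filter (fun l => l.2)) h := pqe e_sym e_irr
    (red_cat (red_inv_pos q) pq') (red_cat (red_inv_pos v) uv).
  have fE (u1 v1 : seq S) : [seq l <- pos_word u1 ++ inv_word (pos_word v1) | l.2] = pos_word u1.
    rewrite filter_cat (_ : [seq l <- inv_word _ | l.2] = [::]) ?cats0.
      by rewrite /pos_word filter_map (eq_filter (a2 := predT)) ?filter_predT.
    rewrite /inv_word /pos_word -map_comp -map_rev filter_map.
    by rewrite (eq_filter (a2 := pred0)) ?filter_pred0.
  by move: h; rewrite !fE => /trace_eq_raag_word.
have [||r rE] := IH p' q'.
- exact: leq_trans sp _.
- by rewrite -pq pE qE invgM mulgA mulgK.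
by exists (r ++ [:: s]); rewrite pE rE raag_mon_cat mulgA.
Qed.

End RaagGroup.

(** * The order of a right-angled Artin group *)

Section RaagOrder.
Variables (S : countType) (e : rel S).
Hypotheses (e_sym : symmetric e) (e_irr : irreflexive e).
Local Notation letter := (S * bool)%type.
Local Notation word := (seq letter).
Local Notation A := (raag e).
Local Notation P := (raag_pos (e := e)).
Local Notation mon := (raag_mon e).
Implicit Types (l m : letter) (w : word) (s : S) (u v p q : seq S) (x y z t : A).
Local Open Scope group_scope.

(** Every common upper bound [z] writes the same element [x^-1 y] as a fraction with numerator
    [x^-1 z]. The numerator in lowest terms divides all of these, so it leads from [x] to the
    join. *)
Lemma raag_join x y z : po_le P x z -> po_le P y z -> exists j, is_join P x y j.
Proof.
move=> /raag_posE[p pE] /raag_posE[q qE].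
have tE z' : x^-1 * y = (x^-1 * z') * (y^-1 * z')^-1.
  by rewrite invgM invgK mulgA mulgK.
have [u [v [uv uvE]]] := raag_fraction_reduce e p q.
exists (x * mon u); split.
- by rewrite /po_le mulKg; exact: raag_pos_mon.
- rewrite /po_le; have -> : y^-1 * (x * mon u) = mon v; last exact: raag_pos_mon.
  apply: (@mulgI _ (x^-1 * y)); rewrite mulgA mulgK mulKg.
  by rewrite (tE z) pE qE uvE mulgVK.
- move=> w /raag_posE[p' pE'] /raag_posE[q' qE'].
  have [|r rE] := @raag_fraction_dvd _ _ e_sym e_irr u v p' q' uv.
    by rewrite -pE' -qE' -tE (tE z) pE qE uvE.
  by rewrite /po_le invgM -mulgA pE' rE mulKg; exact: raag_pos_mon.
Qed.

Definition letter_expo s l : int :=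
  if l.1 == s then (if l.2 then 1 else -1)%R else 0%R.
Definition expo s w : int := (\sum_(l <- w) letter_expo s l)%R.

Lemma expo_cat s w1 w2 : expo s (w1 ++ w2) = (expo s w1 + expo s w2)%R.
Proof. exact: big_cat. Qed.

Lemma raag_rel_expo s w1 w2 : raag_rel e w1 w2 -> expo s w1 = expo s w2.
Proof.
elim=> {w1 w2} [//|//|w1 w2 w3 _ -> _ ->//|w1 w2 w1' w2' _ h1 _ h2|[a b]|a b _].
- by rewrite !expo_cat h1 h2.
- rewrite /expo !big_cons !big_nil /letter_expo /=.
  by case: (a == s); case: b; rewrite /= ?addr0 // ?subrr ?addNr.
- by rewrite /expo !big_cons !big_nil !addr0 addrC.
Qed.

Definition raag_expo s x : int := expo s (repr x).

Lemma raag_expo_word s w : raag_expo s (raag_word e w) = expo s w.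
Proof. exact/raag_rel_expo/raag_repr_pi. Qed.

Lemma raag_expoM s x y : raag_expo s (x * y) = (raag_expo s x + raag_expo s y)%R.
Proof.
have [w1 ->] := raag_word_surj x; have [w2 ->] := raag_word_surj y.
by rewrite -raag_word_cat !raag_expo_word expo_cat.
Qed.

Lemma raag_expo_mon s u : raag_expo s (mon u) = (count_mem s u)%:Z.
Proof.
rewrite raag_expo_word /expo; elim: u => [|a u IH]; first by rewrite big_nil.
by rewrite big_cons IH /letter_expo /=; case: (a == s); rewrite ?add0r.
Qed.

Lemma raag_expo_ge0 s x : P x -> (0 <= raag_expo s x)%R.
Proof. by move=> /raag_posE[u ->]; rewrite raag_expo_mon. Qed.

Lemma raag_expo_support x : exists L : seq S, forall s, s \notin L -> raag_expo s x = 0%R.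
Proof.
have [w ->] := raag_word_surj x; exists [seq l.1 | l <- w] => s sw.
rewrite raag_expo_word /expo big_seq big1 // => l lw.
rewrite /letter_expo; case: eqP => // ls; case/negP: sw.
by apply/mapP; exists l.
Qed.

Lemma beg_cat_pos l w1 w2 : beg e l (w1 ++ w2) ->
  beg e l w1 \/ all (fun m => e m.1 l.1) w1 /\ beg e l w2.
Proof.
elim: w1 => /= [|m w1 IH]; first by right.
case/orP=> [->|/andP[-> /IH[->|[-> ->]]]]; first by left.
  by left; rewrite orbT.
by right.
Qed.

Lemma beg_mon s u : beg e (s, true) (pos_word u) ->
  exists v, mon u = raag_gen e s * mon v /\ (size v < size u)%N.
Proof.
move=> bu; exists (rem s u); split.
  have := beg_raag_word bu; rewrite -/(mon u) => ->; congr (_ * raag_word e _).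
  by elim: u {bu} => //= a u IH; rewrite xpair_eqE andbT; case: ifP => //= _; rewrite IH.
have su : s \in u by have /mapP[a au [->]] := beg_mem bu.
by rewrite size_rem //; case: (u) su.
Qed.

Lemma comm_gen_mon s u : all (fun a => e a s) u ->
  commute (raag_gen e s) (mon u).
Proof.
elim: u => /= [_|a u IH /andP[eas /IH h]]; first exact: commute1.
rewrite raag_mon_cons; apply: commuteM => //.
by apply: (@raag_letter_comm _ _ (s, true) (a, true)); rewrite e_sym.
Qed.

(* Cancelling first letters one at a time produces a common upper bound whose  *)
(* exponents are the maxima.                                                   *)
Lemma raag_small_bound u v z : po_le P (mon u) z -> po_le P (mon v) z ->
  exists c, [/\ po_le P (mon u) c, po_le P (mon v) c & forall s,
    (raag_expo s c <= Num.max (raag_expo s (mon u)) (raag_expo s (mon v)))%R].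
Proof.
have PM := @raag_pos_mul _ e; have P1 : P 1 by exact: raag_pos1.
elim: u v z => [|a u IH] v z uz vz.
  exists (mon v); split=> [||s]; rewrite /po_le ?raag_mon_nil ?invg1 ?mul1g.
  - exact: raag_pos_mon.
  - by rewrite mulVg.
  - by rewrite le_max lexx orbT.
have /raag_posE[p pE] := uz; have /raag_posE[q qE] := vz.
have zE : mon (a :: u ++ p) = mon (v ++ q).
  by rewrite -cat_cons !raag_mon_cat -pE -qE !mulVKg.
have za : po_le P (mon u) ((raag_gen e a)^-1 * z).
  by move: uz; rewrite raag_mon_cons /po_le invgM mulgA.
have expo_gen s : (0 <= raag_expo s (raag_gen e a))%R.
  by apply: raag_expo_ge0; rewrite -[raag_gen e a]mulg1; apply: raag_posM.
(* The words [a :: u ++ p] and [v ++ q] agree up to commutations, so [a] can begin the second.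
   Either [a] begins [v] and is cancelled from both sides, or it commutes with [v] and begins [q],
   in which case [v] still lies below [a^-1 z]. *)
have : beg e (a, true) (pos_word v ++ pos_word q).
  rewrite -map_cat -(beg_trace_eq e_sym e_irr _ (raag_mon_trace e_sym e_irr zE)).
  by rewrite /= eqxx.
case/beg_cat_pos => [/beg_mon[v' [vE _]]|[adj bq]].
  have va : po_le P (mon v') ((raag_gen e a)^-1 * z).
    by move: vz; rewrite vE /po_le invgM mulgA.
  have [c [uc vc cE]] := IH v' _ za va; exists (raag_gen e a * c); split.
  - by rewrite raag_mon_cons; apply/po_le_mul.
  - by rewrite vE; apply/po_le_mul.
  - move=> s; rewrite raag_mon_cons vE !raag_expoM.
    by rewrite -addr_maxr lerD2l cE.
have com : commute (raag_gen e a) (mon v).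
  by apply: comm_gen_mon; move: adj; rewrite all_map; apply: sub_all.
have va : po_le P (mon v) ((raag_gen e a)^-1 * z).
  have [q' [q'E _]] := beg_mon bq.
  have -> : z = raag_gen e a * (mon v * mon q').
    by rewrite -[LHS](mulVKg (mon v)) qE q'E !mulgA com.
  by rewrite /po_le !mulKg; exact: raag_pos_mon.
have [c [uc vc cE]] := IH v _ za va; exists (raag_gen e a * c); split.
- by rewrite raag_mon_cons; apply/po_le_mul.
- have -> : po_le P (mon v) (raag_gen e a * c) =
    P (raag_gen e a * ((mon v)^-1 * c)).
    by rewrite /po_le !mulgA (commuteV com).
  exact: raag_posM.
- move=> s; rewrite raag_mon_cons !raag_expoM.
  have [sa|sa] := eqVneq s a; last first.
    have -> : raag_expo s (raag_gen e a) = 0%R.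
      by rewrite -[raag_gen e a]/(mon [:: a]) raag_expo_mon /= eq_sym (negbTE sa).
    by rewrite !add0r.
  (* No vertex is adjacent to itself, so [a] does not occur in [v]. The extra [a] is therefore
     absorbed by the exponent of the first word. *)
  have v0 : raag_expo s (mon v) = 0%R.
    rewrite raag_expo_mon sa (count_memPn _) //; apply/negP => av.
    by move: adj => /allP/(_ (a, true) (map_f (fun s => (s, true)) av)); rewrite /= e_irr.
  have := cE s; rewrite v0 (max_idPl _) ?raag_expo_mon // => h.
  by rewrite le_max lerD2l -raag_expo_mon in h *; rewrite h.
Qed.

(** The join lies below the bound of [raag_small_bound], and exponents are monotone. This control of
    joins by an abelian group is what stands in for amenability. *)
Lemma raag_control x y z : P x -> P y -> is_join P x y z -> forall s,
  (raag_expo s z <= Num.max (raag_expo s x) (raag_expo s y))%R.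
Proof.
move=> /raag_posE[u ->] /raag_posE[v ->] [xz yz zm] s.
have [c [uc vc cE]] := raag_small_bound xz yz.
apply: le_trans (cE s); rewrite -[c](mulVKg z) raag_expoM lerDl.
by apply: raag_expo_ge0; exact: zm.
Qed.

(** Exponents count letters, so a word with exponents bounded by those of [u] uses only letters of
    [u] and is no longer than [u]. *)
Lemma raag_expo_finite g : P g ->
  finite_set [set p | P p /\ forall s, (raag_expo s p <= raag_expo s g)%R].
Proof.
move=> /raag_posE[u ->].
pose F n : set A := [set x | exists v, [/\ x = mon v, {subset v <= u} & (size v <= n)%N]].
have finF n : finite_set (F n).
  elim: n => [|n IH].
    apply: sub_finite_set (finite_set1 (1 : A)) => x [v [-> _]].
    by rewrite leqn0 => /eqP/size0nil ->.
  apply: sub_finite_set (_ : finite_set ([set (1 : A)] `|`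
    [set raag_gen e a * x | a in [set` u] & x in F n])).
    move=> x [[|a v] [-> vu vn]]; first by left.
    right; exists a => /=; first by apply: vu; rewrite mem_head.
    exists (mon v); last by rewrite raag_mon_cons.
    exists v; split=> // b bv; apply: vu; by rewrite in_cons bv orbT.
  rewrite finite_setU; split=> //.
  by apply: finite_image2 => //; exact: finite_seq.
apply: sub_finite_set (finF (size u)) => x [/raag_posE[v ->] h].
have cvu s : (count_mem s v <= count_mem s u)%N.
  by have := h s; rewrite !raag_expo_mon lez_nat.
exists v; split=> //.
  by move=> s; rewrite -!has_pred1 !has_count => /leq_trans; apply.
have /count_subseqP[v' v'u vv'] : forall s, (count_mem s v <= count_mem s u)%N by [].
by rewrite (perm_size vv') size_subseq.
Qed.

End RaagOrder.

Section RaagCone.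
Variables (S : countType) (e : rel S).
Local Open Scope group_scope.

Lemma raag_expo1 s : raag_expo s (1 : raag e) = 0%R.
Proof. by rewrite -[1]raag_mon_nil raag_expo_mon. Qed.

Lemma raag_expoV s (x : raag e) : raag_expo s x^-1 = (- raag_expo s x)%R.
Proof.
by apply/eqP; rewrite -subr_eq0 opprK -raag_expoM mulVg raag_expo1.
Qed.

Lemma raag_positive_cone : positive_cone (raag_pos (e := e)).
Proof.
split; [exact: raag_pos1|exact: raag_pos_mul|] => x Px PVx.
have x0 s : raag_expo s x = 0%R.
  apply/eqP; rewrite eq_le raag_expo_ge0 // andbT -oppr_ge0 -raag_expoV.
  exact: raag_expo_ge0.
have /raag_posE[[|a u] xE] := Px; first by rewrite xE raag_mon_nil.
by have := x0 a; rewrite xE raag_expo_mon /= eqxx.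
Qed.

End RaagCone.

(** * Splitting off a vertex adjacent to all others *)

Section DirectFactor.
Variables (S : countType) (e : rel S).
Local Open Scope group_scope.
Variable c : S.
Hypothesis c_central : forall s, s != c -> e c s.

Let S' := {s : S | s != c}.
Let e' : rel S' := fun a b => e (val a) (val b).
Local Notation P := (raag_pos (e := e)).

Definition drop_letter (l : S * bool) : option (S' * bool) :=
  omap (fun s => (s, l.2)) (insub l.1).
Definition drop_word w := pmap drop_letter w.
Definition lift_word (w : seq (S' * bool)) := [seq (val l.1, l.2) | l <- w].

Lemma drop_lift w : drop_word (lift_word w) = w.
Proof.
elim: w => //= -[a b] w; rewrite /drop_word /= => ->.
by rewrite /drop_letter /= valK.
Qed.

Lemma drop_rel w1 w2 : raag_rel e w1 w2 -> raag_rel e' (drop_word w1) (drop_word w2).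
Proof.
elim=> {w1 w2} [w|w1 w2 _ IH|w1 w2 w3 _ h1 _ h2|w1 w2 v1 v2 _ h1 _ h2|[a b]|a b ab].
- exact: raag_refl.
- exact: raag_sym.
- exact: raag_trans h1 h2.
- by rewrite /drop_word !pmap_cat; exact: raag_cat.
- rewrite /drop_word /= /drop_letter /=; case: insubP => [s _ _|_] /=.
    exact: (@raag_cancel _ e' (s, b)).
  exact: raag_refl.
- rewrite /drop_word /= /drop_letter /=.
  case: insubP => [s _ sa|_] /=; case: insubP => [s' _ s'b|_] /=;
    try exact: raag_refl.
  by apply: raag_comm; rewrite /e' sa s'b.
Qed.

Lemma lift_rel w1 w2 : raag_rel e' w1 w2 -> raag_rel e (lift_word w1) (lift_word w2).
Proof.
elim=> {w1 w2} [w|w1 w2 _ IH|w1 w2 w3 _ h1 _ h2|w1 w2 v1 v2 _ h1 _ h2|[a b]|a b ab].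
- exact: raag_refl.
- exact: raag_sym.
- exact: raag_trans h1 h2.
- by rewrite /lift_word !map_cat; exact: raag_cat.
- exact: (@raag_cancel _ e (val a, b)).
- exact: raag_comm.
Qed.

Definition drop_elt (x : raag e) : raag e' := raag_word e' (drop_word (repr x)).

Lemma drop_eltE w : drop_elt (raag_word e w) = raag_word e' (drop_word w).
Proof. exact/raag_wordP/drop_rel/raag_repr_pi. Qed.

Definition zword (n : int) : seq (S * bool) :=
  match n with Posz k => nseq k (c, true) | Negz k => nseq k.+1 (c, false) end.

Lemma zword_succ n : raag_word e (zword (n + 1)%R) =
  raag_word e [:: (c, true)] * raag_word e (zword n).
Proof.
case: n => [k|k]; first by rewrite -PoszD addn1 -raag_word_cat.
have cE : raag_word e [:: (c, false)] = (raag_word e [:: (c, true)])^-1.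
  by rewrite -raag_word_inv.
have -> : (Negz k + 1)%R = (- k%:Z)%R.
  by rewrite NegzE -[k.+1]addn1 PoszD opprD addrNK.
rewrite [zword (Negz k)]/= (raag_word_cons e (c, false)) cE mulVKg.
by case: k => [//|k]; rewrite -NegzE.
Qed.

Lemma zword_pred n : raag_word e (zword (n - 1)%R) =
  raag_word e [:: (c, false)] * raag_word e (zword n).
Proof.
have cE : raag_word e [:: (c, false)] = (raag_word e [:: (c, true)])^-1.
  by rewrite -raag_word_inv.
by rewrite -[in RHS](subrK 1%R n) zword_succ cE mulKg.
Qed.

Lemma zword_comm n l : l.1 != c ->
  commute (raag_word e (zword n)) (raag_word e [:: l]).
Proof.
move=> lc; have h b k : commute (raag_word e (nseq k (c, b))) (raag_word e [:: l]).
  elim: k => [|k IH]; first exact/commute_sym/commute1.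
  rewrite raag_word_cons; apply/commute_sym/commuteM; apply/commute_sym => //.
  by apply: raag_letter_comm => //=; exact: c_central.
by case: n => k; exact: h.
Qed.

(** Letters [c] commute with all others and are gathered in front. This makes the pair formed by the
    exponent of [c] and the word without [c] an isomorphism onto the direct sum. *)
Lemma central_split w :
  raag_word e w = raag_word e (zword (expo c w)) * raag_word e (lift_word (drop_word w)).
Proof.
elim: w => [|[a b] w IH]; first by rewrite /expo big_nil raag_word_nil mulg1.
have -> : drop_word ((a, b) :: w) =
  oapp (cons^~ (drop_word w)) (drop_word w) (drop_letter (a, b)) by [].
rewrite raag_word_cons IH /expo big_cons -/(expo c w) {1}/letter_expo.
rewrite /drop_letter [(a, b).1]/= [(a, b).2]/=.
case: insubP => [s sc sE|]; last first.
  move/negPn/eqP=> -> /=; rewrite eqxx; case: b.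
    by rewrite addrC zword_succ -!mulgA.
  by rewrite addrC zword_pred -!mulgA.
rewrite /= (negbTE sc) add0r sE (raag_word_cons e _ (lift_word _)) !mulgA.
by rewrite (@zword_comm _ (a, b)).
Qed.

Lemma central_direct_factor : has_ZN_direct_factor P.
Proof.
exists (raag e'), (raag_pos (e := e')), (fun x => (raag_expo c x, drop_elt x)).
have lift_inj w1 w2 : raag_word e' w1 = raag_word e' w2 ->
    raag_word e (lift_word w1) = raag_word e (lift_word w2).
  by move=> /raag_wordP/lift_rel/raag_wordP.
split.
- exact: raag_positive_cone.
- exists (fun nh => raag_word e (zword nh.1) * raag_word e (lift_word (repr nh.2))).
    move=> x /=; have [w ->] := raag_word_surj x.
    rewrite raag_expo_word drop_eltE [RHS]central_split; congr (_ * _).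
    by apply: lift_inj; apply/raag_wordP/raag_repr_pi.
  move=> [n h] /=; rewrite -raag_word_cat raag_expo_word drop_eltE expo_cat.
  have lift0 w : expo c (lift_word w) = 0%R.
    rewrite /expo /lift_word big_map big1 // => -[[s sc] b] _.
    by rewrite /letter_expo /= (negbTE sc).
  have zE m : expo c (zword m) = m.
    case: m => k; rewrite /expo.
      rewrite [zword k]/(nseq k (c, true)) big_nseq iter_addr_0.
      by rewrite /letter_expo /= eqxx natz.
    have -> : zword (Negz k) = nseq k.+1 (c, false) by [].
    rewrite big_nseq iter_addr_0.
    by rewrite /letter_expo /= eqxx mulNrn natz NegzE.
  have z0 m : drop_word (zword m) = [::].
    have h0 b k : drop_word (nseq k (c, b)) = [::].
      by elim: k => //= k; rewrite /drop_word /= /drop_letter /= insubF ?eqxx.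
    by case: m => k; exact: h0.
  by rewrite zE lift0 addr0 /drop_word pmap_cat -!/(drop_word _) z0 drop_lift
    /raag_word reprK.
- move=> x y /=; rewrite raag_expoM; congr (_, _).
  have [w1 ->] := raag_word_surj x; have [w2 ->] := raag_word_surj y.
  by rewrite -raag_word_cat !drop_eltE -raag_word_cat /drop_word pmap_cat.
- move=> x /=; split.
    move=> Px; split; first exact: raag_expo_ge0.
    have /raag_posE[u ->] := Px; rewrite drop_eltE.
    elim: u => [|a u IH]; first exact: raag_pos1.
    rewrite /drop_word /= /drop_letter /=; case: insubP => [s _ _ |_] /=; last exact: IH.
    by rewrite raag_word_cons; apply: raag_posM.
  have [w ->] := raag_word_surj x; rewrite raag_expo_word drop_eltE central_split.
  case: (expo c w) => k [k0 /raag_posE[u uE]]; last by [].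
  apply: raag_pos_mul.
    elim: k {k0} => [|k IH]; first exact: raag_pos1.
    by rewrite /= raag_word_cons; apply: raag_posM.
  rewrite (lift_inj _ (pos_word u) uE); elim: u {uE} => [|a u IH].
    exact: raag_pos1.
  by rewrite /= raag_word_cons; apply: raag_posM.
Qed.

End DirectFactor.

(** * Incompatible translates in the absence of a factor (Z, N) *)

Section RaagFree.
Variables (S : countType) (e : rel S).
Hypotheses (e_sym : symmetric e) (e_irr : irreflexive e).
Hypothesis no_ZN : ~ has_ZN_direct_factor (raag_pos (e := e)).
Local Notation P := (raag_pos (e := e)).
Local Notation mon := (raag_mon e).
Local Open Scope group_scope.

Lemma nonadjacent_exists s : exists2 s', s' != s & ~~ e s s'.
Proof.
apply: contrapT => h; apply: no_ZN; apply: (@central_direct_factor _ _ s).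
move=> s' s's; apply/negPn/negP => ss'; apply: h; by exists s'.
Qed.

(* A letter distinct from the one at which the shorter word ends separates two *)
(* comparable words.                                                           *)
Lemma separating_letter (T : eqType) (a b : T) (u v : seq T) : a != b -> u != v ->
  exists w, {subset w <= [:: a; b]} /\ forall p q, u ++ w ++ p <> v ++ w ++ q.
Proof.
move=> ab; wlog uv : u v / (size u <= size v)%N.
  move=> H; case: (leqP (size u) (size v)) => [|/ltnW] uv neq; first exact: H.
  have [|w [wab h]] := H v u uv; first by rewrite eq_sym.
  by exists w; split=> // p q E; apply: (h q p).
move=> neq; have [vE|vE] := eqVneq (take (size u) v) u; last first.
  exists [::]; split=> // p q /= E; move/eqP: vE; apply.
  by have := congr1 (take (size u)) E; rewrite take_size_cat // takel_cat // => ->.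
have := cat_take_drop (size u) v; rewrite vE; case: (drop _ v) => [|c k] uE.
  by rewrite cats0 in uE; rewrite uE eqxx in neq.
pose d := if c == a then b else a.
have dc : d != c.
  rewrite /d; have [->|ca] := eqVneq c a; first by rewrite eq_sym.
  by rewrite eq_sym.
exists [:: d]; split.
  by move=> x; rewrite !inE /d => /eqP ->; case: ifP; rewrite eqxx ?orbT.
move=> p q; rewrite -uE -catA => /(congr1 (drop (size u))).
by rewrite !drop_size_cat // => -[dc']; rewrite dc' eqxx in dc.
Qed.

(** If [t] and 1 have a common upper bound, then [t = u v^-1] with [u], [v] positive. For [s = v w]
    one has [t s = u w], and a common upper bound gives an equation [v w p = u w q]. Projected to a
    non-adjacent pair of vertices this is an equation in a free monoid, which a suitable [w]
    excludes. *)
Lemma raag_free (t : raag e) : t != 1 ->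
  exists2 s, P s & forall z, ~ (po_le P s z /\ po_le P (t * s) z).
Proof.
move=> t1; have [[z [oz tz]]|h] := pselect (exists z, po_le P 1 z /\ po_le P t z);
  last first.
  by exists 1 => [|z]; [exact: raag_pos1|rewrite mulg1 => hz; apply: h; exists z].
move: oz tz; rewrite /po_le invg1 mul1g => /raag_posE[u zE] /raag_posE[v tE].
have {}tE : t = mon u * (mon v)^-1 by rewrite -tE zE invgM invgK mulVKg.
have [x [y [xy exy]]] : exists x y, [/\ x != y, ~~ e x y &
    proj x y (pos_word u) != proj x y (pos_word v)].
  apply: contrapT => h; move/eqP: t1; apply.
  suff uv : mon u = mon v by rewrite tE uv mulgV.
  apply: trace_eq_raag_word => // x y exy; apply: contrapT => /eqP neq; apply: h.
  (* The differing projection may be to a single vertex [x]. The absence of a factor (Z, N) then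
     supplies a second vertex not adjacent to [x], so that the free monoid has two letters. *)
  have [xy|xy] := eqVneq x y; last by exists x, y.
  have [y' y'x exy'] := nonadjacent_exists x.
  exists x, y'; split=> //; first by rewrite eq_sym.
  apply: contra neq => /eqP E; apply/eqP.
  have sub w : proj x y w = [seq l <- proj x y' w | l.1 == x].
    rewrite /proj -filter_predI; apply: eq_filter => l /=.
    by rewrite -xy orbb; case: (l.1 == x).
  by rewrite !sub E.
move=> uv; have xyT : (x, true) != (y, true) by rewrite xpair_eqE negb_and xy.
have vu : proj x y (pos_word v) != proj x y (pos_word u) by rewrite eq_sym.
have [w [wxy hw]] := separating_letter xyT vu.
pose w' := [seq l.1 | l <- w].
have w'E : proj x y (pos_word w') = w.
  rewrite /pos_word /w' -map_comp.
  have wl l : l \in w -> l = (x, true) \/ l = (y, true).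
    by move=> /wxy; rewrite !inE => /orP[] /eqP; [left|right].
  have -> : [seq ((fun s => (s, true)) \o (fun l : S * bool => l.1)) l | l <- w] = w.
    rewrite -[RHS]map_id; apply/eq_in_map => l lw.
    by case: (wl l lw) => ->.
  rewrite /proj; apply/all_filterP/allP => l lw.
  by case: (wl l lw) => ->; rewrite /= eqxx ?orbT.
exists (mon (v ++ w')); first exact: raag_pos_mon.
move=> z' []; rewrite /po_le => /raag_posE[p pE] /raag_posE[q qE].
have : mon (v ++ w' ++ p) = mon (u ++ w' ++ q).
  rewrite !catA (raag_mon_cat _ (v ++ w')) -pE mulVKg (raag_mon_cat _ (u ++ w')) -qE.
  by rewrite tE !raag_mon_cat -[_ * _ * (_ * _)]mulgA mulKg mulVKg.
move=> /(raag_mon_trace e_sym e_irr)/(_ x y exy).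
rewrite /proj /pos_word !map_cat !filter_cat -!/(pos_word _) -!/(proj _ _ _) w'E.
exact: hw.
Qed.

End RaagFree.

(** * The boundary spectrum *)

Section Dynamics.
Variables (G : groupType) (P : set G).
Local Open Scope group_scope.
Hypothesis P1 : P 1.
Hypothesis PM : forall x y, P x -> P y -> P (x * y).
Hypothesis joinP : forall x y z, po_le P x z -> po_le P y z ->
  exists j, is_join P x y j.
Hypothesis freeP : forall t : G, t != 1 -> exists2 s, P s &
  forall z, ~ (po_le P s z /\ po_le P (t * s) z).
Implicit Types (x y z p q r s t : G) (w : subsets G).
Local Notation X := (boundary P).

Lemma po_le_refl x : po_le P x x. Proof. by rewrite /po_le mulVg. Qed.

Lemma po_le_trans y x z : po_le P x y -> po_le P y z -> po_le P x z.
Proof.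
by rewrite /po_le => xy yz; have := PM xy yz; rewrite mulgA mulgK.
Qed.

Lemma po_le1 p : po_le P 1 p = P p. Proof. by rewrite /po_le invg1 mul1g. Qed.

Lemma po_le_mulr x p : P p -> po_le P x (x * p).
Proof. by rewrite /po_le mulKg. Qed.

Lemma hereditary_le w x y : hereditary P w -> w y -> po_le P x y -> w x.
Proof.
by move=> hw wy xy; have := hw _ _ wy xy; rewrite invgM invgK mulgA mulgV mul1g.
Qed.

Lemma directed_bound w x y : directed P w -> w x -> w y ->
  exists z, [/\ w z, po_le P x z & po_le P y z].
Proof. by move=> dw wx wy; have [z [xz yz _] wz] := dw x y wx wy; exists z. Qed.

(** Bounded pairs have joins, so the hereditary hull of a directed set is directed, and maximality
    identifies it with the set. *)
Lemma maximal_hereditary w : maximal_directed P w -> hereditary P w.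
Proof.
move=> [w1 dw mw]; pose w' : subsets G := fun z => `[< exists2 x, w x & po_le P z x >].
have w'w : w' = w.
  apply: mw => [x y /asboolP[x' wx' xx'] /asboolP[y' wy' yy']|x wx]; last first.
    by apply/asboolP; exists x => //; exact: po_le_refl.
  have [z [wz xz yz]] := directed_bound dw wx' wy'.
  have xz' := po_le_trans xx' xz; have yz' := po_le_trans yy' yz.
  have [j jxy] := joinP xz' yz'; exists j => //; apply/asboolP; exists z => //.
  by case: jxy => _ _; apply.
move=> x p wx Pp; rewrite -w'w; apply/asboolP; exists x => //.
by rewrite /po_le invgM invgK -mulgA mulVg mulg1.
Qed.

Lemma maximal_nica w : maximal_directed P w -> nica_spectrum P w.
Proof. by move=> mw; have [w1 dw _] := mw; split=> //; exact: maximal_hereditary. Qed.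

(** Otherwise [q] has a join with every element of [w], and the elements below these joins form a
    directed set containing both [w] and [q]. *)
Lemma maximal_incompatible w q : maximal_directed P w -> ~~ w q ->
  exists2 x, w x & forall z, ~ (po_le P q z /\ po_le P x z).
Proof.
move=> [w1 dw mw] wq; apply: contrapT => h; case/negP: wq.
have {}h x : w x -> exists j, is_join P q x j.
  move=> wx; apply: contrapT => nj; apply: h; exists x => // z [qz xz].
  by apply: nj; apply: joinP qz xz.
pose w' : subsets G := fun z =>
  `[< exists x, w x /\ exists2 j, is_join P q x j & po_le P z j >].
have <- : w' = w.
  apply: mw => [z1 z2 /asboolP[x1 [wx1 [j1 j1x z1j]]] /asboolP[x2 [wx2 [j2 j2x z2j]]]|x wx].
    have [x [wx x1x x2x]] := directed_bound dw wx1 wx2.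
    have [j jx] := h x wx; have [qj xj _] := jx.
    have z1' : po_le P z1 j.
      by apply: po_le_trans z1j _; case: j1x => _ _; apply=> //; exact: po_le_trans xj.
    have z2' : po_le P z2 j.
      by apply: po_le_trans z2j _; case: j2x => _ _; apply=> //; exact: po_le_trans xj.
    have [z zz] := joinP z1' z2'; exists z => //.
    apply/asboolP; exists x; split=> //; exists j => //.
    by case: zz => _ _; apply.
  by apply/asboolP; exists x; split=> //; have [j jx] := h x wx; exists j => //; case: jx.
apply/asboolP; exists 1; split=> //; have [j jx] := h 1 w1.
by exists j => //; case: jx.
Qed.

Lemma maximal_exists : exists w, maximal_directed P w.
Proof.
pose T := {w : subsets G | directed P w /\ w 1}.
have d1 : directed P (fun x => x == 1 :> G).
  move=> x y /eqP -> /eqP ->; exists 1 => //.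
  by split=> //; exact: po_le_refl.
pose t0 : T := exist _ _ (conj d1 (eqxx 1)).
pose Rle (a b : T) := `[< forall x, sval a x -> sval b x >].
have [||||t tm] := @Zorn T Rle.
- by move=> a; apply/asboolP.
- by move=> b a c /asboolP ab /asboolP bc; apply/asboolP => x /ab /bc.
- move=> [a pa] [b pb] /asboolP ab /asboolP ba; apply: eq_exist; apply/funext => x.
  by apply/idP/idP => [/ab|/ba].
- move=> A totA; have [A0|/set0P[a0 Aa0]] := eqVneq A set0.
    by exists t0 => s; rewrite A0.
  pose u : subsets G := fun x => `[< exists2 a, A a & sval a x >].
  have du : directed P u.
    move=> x y /asboolP[a Aa ax] /asboolP[b Ab bx].
    have [c [Ac cx cy]] : exists c, [/\ A c, sval c x & sval c y].
      case: (totA a b Aa Ab) => /asboolP => [ab|ba]; first by exists b; split=> //; exact: ab.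
      by exists a; split=> //; exact: ba.
    have [dc _] := svalP c; have [z xyz cz] := dc x y cx cy.
    by exists z => //; apply/asboolP; exists c.
  have u1 : u 1 by apply/asboolP; exists a0 => //; case: (svalP a0).
  by exists (exist _ u (conj du u1)) => s As; apply/asboolP => x sx; apply/asboolP; exists s.
exists (sval t); have [dt t1] := svalP t; split=> // w' dw' tw'.
have w'1 : w' 1 by exact: tw'.
by have /(congr1 sval) := tm (exist _ w' (conj dw' w'1)) (asboolT tw').
Qed.

Lemma bval1 (x : X) : bval x 1.
Proof. by case: (bdryP x) => -[]. Qed.
Lemma bval_hereditary (x : X) : hereditary P (bval x).
Proof. by case: (bdryP x) => -[]. Qed.
Lemma bval_directed (x : X) : directed P (bval x).
Proof. by case: (bdryP x) => -[]. Qed.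
Lemma bval_le (x : X) y z : bval x z -> po_le P y z -> bval x y.
Proof. exact/hereditary_le/bval_hereditary. Qed.
Lemma bval_inv (x : X) p : P p -> bval x p^-1.
Proof. by move=> Pp; rewrite -[p^-1]mul1g; apply: bval_hereditary => //; exact: bval1. Qed.

Lemma maximal_boundary w : maximal_directed P w -> boundary_spectrum P w.
Proof. by move=> mw; split; [exact: maximal_nica|exact: subset_closure]. Qed.

Lemma boundary_inhabited : inhabited X.
Proof.
have [w mw] := maximal_exists; have [x _] := inbdryP (maximal_boundary mw).
exact: (inhabits x).
Qed.

(* At a maximal directed set [w] the sets [U_r], [r \in w], form a base of      *)
(* neighbourhoods: an element outside [w] is excluded by one incompatible with *)
(* it.                                                                         *)
Lemma maximal_base w (W : set (subsets G)) : maximal_directed P w -> nbhs w W ->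
  exists r, [/\ P r, w r & forall w', nica_spectrum P w' -> w' r -> W w'].
Proof.
move=> mw; have [w1 dw _] := mw.
pose F : set_system (subsets G) := [set A | exists r,
  [/\ P r, w r & forall w', nica_spectrum P w' -> w' r -> A w']].
have FF : Filter F.
  split; first by exists 1.
  - move=> A B [r [Pr wr rA]] [s [Ps ws sB]].
    have [z [wz rz sz]] := directed_bound dw wr ws.
    have Pz : P z by rewrite -po_le1; apply: po_le_trans rz; rewrite po_le1.
    exists z; split=> // w' nw' w'z; have [_ hw' _] := nw'.
    split; first by apply: rA => //; exact: hereditary_le rz.
    by apply: sB => //; exact: hereditary_le sz.
  - move=> A B AB [r [Pr wr rA]]; exists r; split=> // w' nw' w'r.
    exact/AB/rA.
suff : F --> w by move=> Fw /Fw.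
apply: subsets_cvg => g; have [wg|wg] := boolP (w g).
  have [z [wz gz oz]] := directed_bound dw wg w1.
  exists z; rewrite -po_le1; split=> // w' [_ hw' _] w'z.
  by rewrite (hereditary_le hw' w'z gz).
have [x wx xg] := maximal_incompatible mw wg.
have [z [wz xz oz]] := directed_bound dw wx w1.
exists z; rewrite -po_le1; split=> // w' [_ hw' dw'] w'z.
apply/negbTE/negP => w'g.
have [y [_ gy zy]] := directed_bound dw' w'g w'z.
by apply: (xg y); split=> //; exact: po_le_trans zy.
Qed.

(** Maximal sets are dense, and one of them close to [x] supplies [r]. The point [x] itself may lie
    outside [U_r]; what compressions use is that [U_r] is contained in [V]. *)
Lemma boundary_base (x : X) (V : set X) : nbhs x V ->
  exists r, P r /\ forall y : X, bval y r -> V y.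
Proof.
move=> [_ [[W oW <-] Wx] WV]; have [_ cx] := bdryP x.
have nW : nbhs (bval x) W by exact: open_nbhs_nbhs.
have [w [mw Ww]] := cx _ nW.
have [|r [Pr _ rW]] := @maximal_base w W mw; first exact: open_nbhs_nbhs.
exists r; split=> // y yr; apply: WV; apply: rW => //.
by case: (bdryP y).
Qed.

Definition incompatible x y := forall z, ~ (po_le P x z /\ po_le P y z).

Lemma separate_translates (T : seq G) r : P r -> exists r', [/\ P r', po_le P r r' &
  forall t, t \in T -> t != 1 -> incompatible r' (t * r')].
Proof.
elim: T r => [|t T IH] r Pr; first by exists r; split=> //; exact: po_le_refl.
have [r1 [Pr1 rr1 h]] := IH r Pr.
have [t1|t1] := eqVneq t 1.
  exists r1; split=> // s; rewrite in_cons => /orP[/eqP ->|]; last exact: h.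
  by rewrite t1 eqxx.
(* Incompatibility of [s] and [t' s] becomes, after translation by [r1], that of [r1 s] and
   [t r1 s]. Pairs separated earlier stay separated, since incompatibility passes to larger
   elements. *)
pose t' := r1^-1 * t * r1.
have t'1 : t' != 1.
  apply: contra t1 => /eqP E; apply/eqP.
  have : r1 * t' = t * r1 by rewrite /t' !mulgA mulgV mul1g.
  by rewrite E mulg1 => /(canLR (mulgK r1)); rewrite mulgV.
have [s Ps sh] := freeP t'1; have P' := PM Pr1 Ps.
have r1' : po_le P r1 (r1 * s) by exact: po_le_mulr.
exists (r1 * s); split=> //; first exact: po_le_trans r1'.
move=> u; rewrite in_cons => /orP[/eqP -> _ z [az bz]|uT u1 z [az bz]].
  apply: (sh (r1^-1 * z)); split; first by apply/(po_le_mul _ r1); rewrite mulVKg.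
  apply/(po_le_mul _ r1); rewrite mulVKg /t' !mulgA mulgV mul1g.
  by rewrite -mulgA.
apply: (h u uT u1 z); split; first exact: po_le_trans az.
by apply: po_le_trans bz; apply/po_le_mul.
Qed.

Lemma boundary_base_free (x : X) (V : set X) (T : seq G) : nbhs x V ->
  exists r, [/\ P r, forall y : X, bval y r -> V y &
    forall t, t \in T -> t != 1 -> incompatible r (t * r)].
Proof.
move=> /boundary_base[r [Pr rV]].
have [r' [Pr' rr' h]] := separate_translates T Pr.
exists r'; split=> // y yr'; apply: rV; exact: bval_le rr'.
Qed.

(** A point is directed, so it cannot contain both of two incompatible elements [s] and [t s]. This
    will provide an isometry that is not unitary. *)
Lemma boundary_proper t : P t -> t != 1 -> exists r, P r /\ exists x : X, ~~ bval x r.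
Proof.
move=> Pt t1; have [s Ps h] := freeP t1; have [x] := boundary_inhabited.
have [xs|xs] := boolP (bval x s); last by exists s; split=> //; exists x.
exists (t * s); split; first exact: PM.
exists x; apply/negP => xts.
have [z [_ sz tz]] := directed_bound (@bval_directed x) xs xts.
exact: (h z).
Qed.

End Dynamics.

(** * Finite sums and their norms *)

Section CrossedSums.
Variables (R : realType) (G : groupType) (P : set G).
Local Notation C := (Cplx R).
Local Notation X := (boundary P).
Local Notation K := (crossed_sums R P).
Implicit Types (a b c : K) (s t r p q : G) (x y : X) (f g : X -> C).

Lemma sums_eq a b : (forall r x, a r x = b r x) -> a = b.
Proof. exact: crossed_eq. Qed.
Lemma sumsDE a b r x : (a + b) r x = a r x + b r x. Proof. by []. Qed.
Lemma sumsNE a r x : (- a) r x = - a r x. Proof. by []. Qed.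
Lemma sumsZE (k : C) a r x : (k *: a) r x = k * a r x. Proof. by []. Qed.
Lemma sums_sumE I (l : seq I) (F : I -> K) r x :
  (\sum_(i <- l) F i) r x = \sum_(i <- l) F i r x.
Proof.
elim: l => [|i l IH]; first by rewrite !big_nil.
by rewrite !big_cons sumsDE IH.
Qed.

Lemma crossed_supp a r x : ~~ bval x r -> a r x = 0.
Proof. by have [_] := crossed_dom a r; apply. Qed.

Lemma crossed_cts a r : continuous (a r).
Proof. by have [] := crossed_dom a r. Qed.

Lemma smulE a b r x : (a ** b) r x =
  \sum_(s \in [set: G]) a s x * extend (b (s^-1 * r)%g) (translate s^-1%g (bval x)).
Proof. exact: sums_mulE. Qed.

Lemma starE a r x : star a r x = (extend (a r^-1%g) (translate r^-1%g (bval x)))^*.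
Proof. exact: crossed_starE. Qed.

Lemma delta_finite_sum t f : dom_ideal t f -> delta t f \in @finite_sum R G P.
Proof.
move=> df; apply/asboolP; split=> [|r].
  apply: sub_finite_set (finite_set1 t) => r /=; rewrite /delta.
  by case: eqP.
by rewrite /delta; case: eqP => [->//|_]; exact: dom_ideal0.
Qed.

(* [f delta_t], with junk value [0] when [f] is not in [C_0 (U_t)]. *)
Definition monomial t f : K :=
  if pselect (dom_ideal t f) is left df then CrossedSums (delta_finite_sum df) else 0.

Lemma monomialE t f r x : dom_ideal t f ->
  monomial t f r x = if r == t then f x else 0.
Proof.
move=> df; rewrite /monomial; case: pselect => // h.
by rewrite /= /delta; case: eqP.
Qed.

Lemma monomial_mul t f a r x : dom_ideal t f -> (monomial t f ** a) r x =
  f x * extend (a (t^-1 * r)%g) (translate t^-1%g (bval x)).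
Proof.
move=> df; rewrite smulE (fsbigTE [fset t]%fset) ?big_seq_fset1 ?monomialE ?eqxx //.
move=> s; rewrite !inE => st.
by rewrite monomialE // (negbTE st) mul0r.
Qed.

Lemma mul_monomial t f a r x : dom_ideal t f -> (a ** monomial t f) r x =
  a (r * t^-1)%g x * extend f (translate (t * r^-1)%g (bval x)).
Proof.
move=> df; rewrite smulE (fsbigTE [fset (r * t^-1)%g]%fset) ?big_seq_fset1.
  rewrite invgM invgK -[(_ * r)%g]mulgA mulVg mulg1; congr (_ * extend _ _).
  by apply/funext => y; rewrite monomialE // eqxx.
move=> s; rewrite !inE => sr.
have -> : monomial t f (s^-1 * r)%g = 0; last by rewrite extend0 mulr0.
apply/funext => y; rewrite monomialE //; case: eqP => // E.
by case/eqP: sr; rewrite -E invgM invgK mulgA mulgV mul1g.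
Qed.

Lemma dom_ideal1 f : continuous f -> @dom_ideal R G P 1%g f.
Proof.
move=> cf; split=> // x /negP[]; by case: (bdryP x) => -[].
Qed.

Definition ind t : X -> C := fun x => if bval x t then 1 else 0.

Lemma ind_dom t : dom_ideal t (ind t).
Proof.
split=> [x|x /negbTE xt]; last by rewrite /ind xt.
apply: (@cvg_near_cst _ _ _ _ _ (nbhs_filter x)).
by apply: filterS (near_bdry x t) => y; rewrite /ind => ->.
Qed.

Definition iso p : K := monomial p (ind p).

Lemma ind1 : ind 1%g = fun=> 1.
Proof. by apply/funext => x; rewrite /ind; case: (bdryP x) => -[] ->. Qed.

Definition kone : K := iso 1%g.

Lemma kone_l a : kone ** a = a.
Proof.
apply: sums_eq => r x; rewrite monomial_mul; last exact: ind_dom.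
rewrite ind1 mul1r invg1 mul1g.
have -> : translate 1%g (bval x) = bval x.
  by apply/funext => y; rewrite /translate invg1 mul1g.
by rewrite extend_val.
Qed.

Lemma kone_star : star kone = kone.
Proof.
apply: sums_eq => r x; rewrite starE monomialE; last exact: ind_dom.
have [->|r1] := eqVneq r 1%g; last first.
  rewrite (_ : kone r^-1%g = 0) ?extend0 ?conjC0 //; apply/funext => y.
  rewrite monomialE; last exact: ind_dom.
  by rewrite (can2_eq invgK invgK) invg1 (negbTE r1).
have -> : translate 1^-1%g (bval x) = bval x.
  by apply/funext => y; rewrite /translate !invg1 mul1g.
rewrite extend_val monomialE; last exact: ind_dom.
by rewrite invg1 eqxx ind1 conjC1.
Qed.

Lemma kone_unit : is_unit kone.
Proof.
split=> a; first exact: kone_l.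
by rewrite -[LHS]starK stM kone_star kone_l starK.
Qed.

Section Isometries.

Lemma shift_proof p x : P p -> boundary_spectrum P (translate p (bval x)).
Proof.
move=> Pp; apply: translate_boundary; first exact: bdryP.
exact: bval_inv.
Qed.

Lemma shift_exists p x : exists y : X, P p -> bval y = translate p (bval x).
Proof.
have [Pp|] := pselect (P p); last by exists x.
by have [y yE] := inbdryP (shift_proof x Pp); exists y.
Qed.

(* The point [p x], with junk value [x] when [p] is not in [P]. *)
Definition shift p x : X := projT1 (cid (shift_exists p x)).

Lemma shiftE p x : P p -> bval (shift p x) = translate p (bval x).
Proof. exact: (projT2 (cid (shift_exists p x))). Qed.

Lemma shift_mem p x t : P p -> bval (shift p x) t = bval x (p^-1 * t)%g.
Proof. by move=> Pp; rewrite shiftE. Qed.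

Lemma shift_self p x : P p -> bval (shift p x) p.
Proof. by move=> Pp; rewrite shift_mem // mulVg; exact: bval1. Qed.

Lemma star_iso_mul p a r x : P p ->
  (star (iso p) ** a) r x = a (p * r)%g (shift p x).
Proof.
(* Every point is hereditary and contains 1, hence contains [p^-1]; so [U_(p^-1)] is the whole
   boundary and the constant 1 is allowed in degree [p^-1]. *)
move=> Pp; have indp : @dom_ideal R G P p^-1%g (fun=> 1 : C).
  by split=> [|y]; [exact: (@cst_continuous X C 1)|rewrite bval_inv].
have -> : star (iso p) = monomial p^-1%g (fun=> 1).
  apply: sums_eq => s y; rewrite starE monomialE //.
  case: eqP => [->|sp]; last first.
    rewrite (_ : iso p s^-1%g = 0) ?extend0 ?conjC0 //; apply/funext => z.
    rewrite monomialE; last exact: ind_dom.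
    by case: eqP => // E; case: sp; rewrite -E invgK.
  rewrite invgK -shiftE // extend_val monomialE; last exact: ind_dom.
  by rewrite eqxx /ind shift_self // conjC1.
by rewrite monomial_mul // mul1r invgK -shiftE // extend_val.
Qed.

Lemma mul_iso q a r x : (a ** iso q) r x =
  if bval x r then a (r * q^-1)%g x else 0.
Proof.
rewrite mul_monomial; last exact: ind_dom.
have [xrq|xrq] := boolP (bval x (r * q^-1)%g); last first.
  by rewrite (crossed_supp _ xrq) mul0r; case: ifP.
have [y yE] := inbdry_translate xrq.
have qrE : translate (q * r^-1)%g (bval x) = bval y.
  by rewrite -yE invgM invgK.
rewrite qrE extend_val /ind -qrE /translate invgM invgK mulgVK.
by case: ifP; rewrite ?mulr1 ?mulr0.
Qed.

Lemma compressE p q a r x : P p -> (star (iso p) ** a ** iso q) r x =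
  if bval x r then a (p * r * q^-1)%g (shift p x) else 0.
Proof.
by move=> Pp; rewrite mul_iso; case: ifP => // xr; rewrite star_iso_mul // mulgA.
Qed.

Lemma iso_isometry p : P p -> star (iso p) ** iso p = kone.
Proof.
move=> Pp; apply: sums_eq => r x; rewrite star_iso_mul // !monomialE; try exact: ind_dom.
rewrite -[X in _ == X]mulg1 (inj_eq (@mulgI _ p)).
by case: eqP => // _; rewrite ind1 /ind shift_self.
Qed.

End Isometries.

(** The right-hand side is the sum over [s] of [|a_s (s y)|^2], and the term [s = t] is the
    left-hand side because [t y = x]. *)
Lemma star_mul1_ge a t x y : bval y = translate t^-1%g (bval x) ->
  `|a t x| ^+ 2 <= (star a ** a) 1%g y.
Proof.
move=> yE; pose z s := extend (a s^-1%g) (translate s^-1%g (bval y)).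
have zt : z t^-1%g = a t x by rewrite /z !invgK yE translateVK extend_val.
have zE s : star a s y * extend (a (s^-1 * 1)%g) (translate s^-1%g (bval y)) = `|z s| ^+ 2.
  by rewrite mulg1 starE mulrC -normCK.
rewrite [leRHS](@crossed_mul_fset _ _ _ _ _ (supp (star a))); last first.
  by move=> s /suppP.
rewrite (eq_bigr (fun s => `|z s| ^+ 2)) => [|s _]; last exact: zE.
have [ts|/suppP ts] := boolP (t^-1%g \in supp (star a)).
  by rewrite (big_fsetD1 _ ts) /= zt lerDl sumr_ge0.
have -> : a t x = 0.
  rewrite -zt; apply: (can_inj (@conjCK C)).
  by have := starE a t^-1%g y; rewrite ts conjC0 /z => <-.
by rewrite normr0 expr0n sumr_ge0.
Qed.

End CrossedSums.

Section ComplexContinuity.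
Variable R : realType.
Local Notation C := (Cplx R).
Variable X : topologicalType.
Implicit Types (f : X -> C).

Lemma rnorm_Re (z : C) : `|complex.Re z| <= rnorm (z : C^o).
Proof. by rewrite -rC_le -rnormE; exact: normc_ge_Re. Qed.

Lemma continuous_Re f : continuous f -> continuous (fun x => complex.Re (f x) : R).
Proof.
move=> cf x; apply/cvgrPdist_le => e e0.
have /cvgrPdist_le/(_ (rC e)) := cf x; rewrite rC_lt => /(_ e0).
apply: filterS => y; rewrite (rnormE (_ : C^o)) rC_le; apply: le_trans.
by rewrite -raddfB; exact: rnorm_Re.
Qed.

Lemma continuous_rC (h : X -> R) : continuous h -> continuous (fun x => rC (h x) : C).
Proof.
move=> ch x; apply/cvgrPdist_le => e ep.
have er : e = rC (complex.Re e) by rewrite /rC RRe_real // realE ltW.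
have e0 : 0 < complex.Re e by rewrite -rC_lt -er.
have /cvgrPdist_le/(_ _ e0) := ch x; apply: filterS => y.
by rewrite -rCN -rCD norm_rC er rC_le.
Qed.

End ComplexContinuity.

Section FunctionNorm.
Variables (R : realType) (G : groupType) (P : set G).
Local Notation C := (Cplx R).
Local Notation X := (boundary P).
Local Notation K := (crossed_sums R P).
Variable (B : cstarAlgType C).
Variable (iota : K -> B).
Hypothesis iota_hom : star_hom iota.
Implicit Types (a b c : K) (s t r p q : G) (x y : X) (f g : X -> C).

Definition fmul f : K := monomial 1%g f.

Lemma fmulE f r x : continuous f -> fmul f r x = if r == 1%g then f x else 0.
Proof. by move=> cf; rewrite monomialE //; exact: dom_ideal1. Qed.

Lemma translate1 (w : subsets G) : translate 1%g w = w.
Proof. by apply/funext => y; rewrite /translate invg1 mul1g. Qed.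

Lemma fmulM f g : continuous f -> continuous g ->
  fmul f ** fmul g = fmul (fun x => f x * g x).
Proof.
move=> cf cg; have cfg : continuous (fun x => f x * g x).
  by move=> x; apply: (@continuousM C X); [exact: cf|exact: cg].
apply: sums_eq => r x; rewrite monomial_mul; last exact: dom_ideal1.
rewrite invg1 mul1g translate1 extend_val !fmulE //.
by case: ifP; rewrite ?mulr0.
Qed.

Lemma fmulJ f : continuous f -> star (fmul f) = fmul (fun x => (f x)^*).
Proof.
move=> cf; have cj : continuous (fun x => (f x)^*).
  by move=> x; apply: (@continuous_comp X C C); [exact: cf|exact: conj_continuous].
apply: sums_eq => r x; rewrite starE fmulE //.
have [->|r1] := eqVneq r 1%g.
  by rewrite invg1 translate1 extend_val fmulE // eqxx.
rewrite (_ : fmul f r^-1%g = 0) ?extend0 ?conjC0 //; apply/funext => y.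
by rewrite fmulE // (can2_eq invgK invgK) invg1 (negbTE r1).
Qed.

Lemma fmulD f g : continuous f -> continuous g ->
  fmul f + fmul g = fmul (fun x => f x + g x).
Proof.
move=> cf cg; have cfg : continuous (fun x => f x + g x).
  by move=> x; apply: (@continuousD C C X); [exact: cf|exact: cg].
apply: sums_eq => r x; rewrite sumsDE !fmulE //.
by case: ifP; rewrite ?addr0.
Qed.

Lemma fmulZ (k : C) f : continuous f -> k *: fmul f = fmul (fun x => k * f x).
Proof.
move=> cf; have ckf : continuous (fun x => k * f x).
  by move=> x; apply: (@continuousM C X); [exact: cst_continuous|exact: cf].
apply: sums_eq => r x; rewrite sumsZE !fmulE //.
by case: ifP; rewrite ?mulr0.
Qed.

Lemma kone_fmul : kone R P = fmul (fun=> 1).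
Proof. by rewrite /kone /iso /fmul ind1. Qed.

(* [f] real with [|f| <= 1]: [f^2 + g^2 = 1] for [g = sqrt (1 - f^2)].         *)
Lemma rnorm_fmul_real (h : X -> R) : continuous h -> (forall x, `|h x| <= 1) ->
  rnorm (iota (fmul (fun x => rC (h x)))) <= 1.
Proof.
move=> ch h1; pose k x := Num.sqrt (1 - h x * h x).
have ck : continuous k.
  move=> x; apply: (@continuous_comp X R R).
    apply: (@continuousB R R X); first exact: cst_continuous.
    by apply: (@continuousM R X); exact: ch.
  exact: sqrt_continuous.
have crh := continuous_rC ch; have crk := continuous_rC ck.
have sq2 : fmul (fun x => rC (h x)) ** fmul (fun x => rC (h x)) +
    fmul (fun x => rC (k x)) ** fmul (fun x => rC (k x)) = kone R P.
  have cM (u : X -> C) : continuous u -> continuous (fun x => u x * u x).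
    by move=> cu x; apply: (@continuousM C X); exact: cu.
  rewrite (fmulM crh crh) (fmulM crk crk) (fmulD (cM _ crh) (cM _ crk)).
  rewrite kone_fmul; congr fmul; apply/funext => x.
  rewrite -!rCM -rCD /k -!expr2 sqr_sqrtr; first by rewrite addrC subrK.
  by rewrite subr_ge0 -(real_normK (num_real (h x))) expr_le1.
apply: (@rnorm_commuting_squares _ _ _ (iota (fmul (fun x => rC (k x))))).
- rewrite -(star_homS iota_hom) (fmulJ crh); congr (iota (fmul _)).
  by apply/funext => x; rewrite rC_conj.
- rewrite -(star_homS iota_hom) (fmulJ crk); congr (iota (fmul _)).
  by apply/funext => x; rewrite rC_conj.
- rewrite -!(star_homM iota_hom) (fmulM crh crk) (fmulM crk crh); congr (iota (fmul _)).
  by apply/funext => x; rewrite mulrC.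
rewrite -!(star_homM iota_hom) -(star_homD iota_hom) sq2.
apply: rnorm_projection; rewrite -(star_homS iota_hom) -(star_homM iota_hom).
by rewrite kone_star kone_l.
Qed.

Lemma rnorm_rC (r : R) : rnorm (rC r : C^o) = `|r|.
Proof. by apply: rC_inj; rewrite -(rnormE (rC r : C^o)); exact: norm_rC. Qed.

Lemma rnormCM (z w : C) : rnorm (z * w : C^o) = rnorm (z : C^o) * rnorm (w : C^o).
Proof. exact: (@rnormZ _ C^o). Qed.

Lemma normC_sqr (z : C) : z * z^* = rC (rnorm (z : C^o) ^+ 2).
Proof. by rewrite -normCK (rnormE (z : C^o)) rCX. Qed.

(** The product [m ** star m] of the monomial [m] is multiplication by the real function [|f|^2], so
    the C*-identity reduces the claim to [rnorm_fmul_real]. *)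
Lemma rnorm_monomial1 t f : dom_ideal t f -> (forall x, rnorm (f x : C^o) <= 1) ->
  rnorm (iota (monomial t f)) <= 1.
Proof.
move=> df f1; have [cf f0] := df.
pose h x : R := rnorm (f x : C^o) ^+ 2.
have hE x : h x = complex.Re (f x * (f x)^*) by rewrite normC_sqr.
have ch : continuous h.
  have -> : h = fun x => complex.Re (f x * (f x)^*) by apply/funext.
  apply: continuous_Re => x; apply: (@continuousM C X); first exact: cf.
  by apply: (@continuous_comp X C C); [exact: cf|exact: conj_continuous].
have h1 x : `|h x| <= 1.
  by rewrite ger0_norm ?exprn_ge0 ?rnorm_ge0 // expr_le1 ?rnorm_ge0.
have crh := continuous_rC ch.
have mm : monomial t f ** star (monomial t f) = fmul (fun x => rC (h x)).
  apply: sums_eq => r x; rewrite monomial_mul // fmulE //.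
  have [xt|xt] := boolP (bval x t); last first.
    by rewrite f0 // mul0r /h f0 // rnorm0 expr0n; case: ifP.
  have [y yE] := inbdry_translate xt; rewrite yE extend_val starE -yE.
  rewrite invgM invgK -translateM.
  have [->|r1] := eqVneq r 1%g.
    rewrite invg1 mul1g mulgV translate1 extend_val monomialE // eqxx.
    by rewrite normC_sqr.
  rewrite (_ : monomial t f (r^-1 * t)%g = 0) ?extend0 ?conjC0 ?mulr0 //.
  apply/funext => z; rewrite monomialE //; case: eqP => // E.
  case/eqP: r1; apply: invg_inj; rewrite invg1.
  by apply: (@mulIg _ t); rewrite E mul1g.
rewrite -(expr_le1 (n := 2)) ?rnorm_ge0 // -rnorm_Mstar -(star_homS iota_hom).
by rewrite -(star_homM iota_hom) mm; exact: rnorm_fmul_real.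
Qed.

Lemma monomialZ (k : C) t f : dom_ideal t f -> k *: monomial t f = monomial t (fun x => k * f x).
Proof.
move=> df; have dkf : dom_ideal t (fun x => k * f x).
  have := dom_idealD k df (@dom_ideal0 R G P t); congr dom_ideal.
  by apply/funext => x; exact: addr0.
apply: sums_eq => r x; rewrite sumsZE !monomialE //.
by case: ifP; rewrite ?mulr0.
Qed.

Lemma rnorm_monomial t f (M : R) : 0 <= M -> dom_ideal t f ->
  (forall x, rnorm (f x : C^o) <= M) -> rnorm (iota (monomial t f)) <= M.
Proof.
move=> M0 df fM; have [M1|M1] := eqVneq M 0.
  have -> : monomial t f = 0.
    apply: sums_eq => r x; rewrite monomialE //; case: ifP => // _.
    apply: (@rnorm_eq0 _ C^o); apply/eqP; rewrite eq_le rnorm_ge0 andbT.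
    by rewrite -M1 fM.
  by rewrite (star_hom0 iota_hom) rnorm0.
have Mp : 0 < M by rewrite lt_def M1.
have Mi : `|M^-1| = M^-1 by rewrite ger0_norm // invr_ge0.
have : rnorm (iota (rC M^-1 *: monomial t f)) <= 1.
  rewrite monomialZ //; apply: rnorm_monomial1 => [|x].
    have := dom_idealD (rC M^-1) df (@dom_ideal0 R G P t); congr dom_ideal.
    by apply/funext => x; exact: addr0.
  by rewrite rnormCM rnorm_rC Mi mulrC ler_pdivrMr // mul1r.
by rewrite (star_homZ iota_hom) rnormZr Mi mulrC ler_pdivrMr // mul1r.
Qed.

Lemma monomial_expand a : a = \sum_(t <- supp a) monomial t (a t).
Proof.
apply: sums_eq => r x; rewrite sums_sumE.
have mE t : monomial t (a t) r x = if r == t then a t x else 0.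
  by rewrite monomialE //; exact: crossed_dom.
rewrite (eq_bigr _ (fun t _ => mE t)).
have [rs|rs] := boolP (r \in supp a).
  rewrite (big_fsetD1 _ rs) /= eqxx big_seq big1 ?addr0 // => t.
  by rewrite in_fsetD1 eq_sym => /andP[/negbTE ->].
rewrite (suppP rs) big_seq big1 // => t ts.
by case: eqP => // rt; rewrite rt ts in rs.
Qed.

(** The cardinality factor is crude but harmless: applied to powers supported in a fixed finite set,
    it disappears on taking roots. *)
Lemma rnorm_iota_le a (M : R) (T : {fset G}) : 0 <= M ->
  (forall t x, rnorm (a t x : C^o) <= M) -> (supp a `<=` T)%fset ->
  rnorm (iota a) <= #|` T|%:R * M.
Proof.
move=> M0 aM aT; rewrite {1}(monomial_expand a) (star_hom_sum iota_hom).
apply: le_trans (rnorm_sum _ _) _.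
apply: (@le_trans _ _ (\sum_(t <- supp a) M)).
  apply: ler_sum => t _; apply: rnorm_monomial => //; exact: crossed_dom.
rewrite big_const_seq count_predT iter_addr_0 -[leLHS]mulr_natl ler_wpM2r // ler_nat.
exact: fsubset_leq_card.
Qed.

End FunctionNorm.

(** * Compression by the semigroup of isometries *)

Section Compression.
Variables (R : realType) (G : groupType) (P : set G).
Local Notation C := (Cplx R).
Local Notation X := (boundary P).
Local Notation K := (crossed_sums R P).
Hypothesis P1 : P 1%g.
Hypothesis PM : forall x y, P x -> P y -> P (x * y)%g.
Hypothesis joinP : forall x y z, po_le P x z -> po_le P y z ->
  exists j, is_join P x y j.
Hypothesis freeP : forall t : G, t != 1%g -> exists2 s, P s &
  forall z, ~ (po_le P s z /\ po_le P (t * s)%g z).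
Variables (B : cstarAlgType C) (iota : K -> B).
Hypothesis iota_hom : star_hom iota.
Hypothesis iota_dense : closure (range iota) = [set: B].
Implicit Types (a b c : K) (s t r p q : G) (x y : X) (f g : X -> C) (h k : B).

Lemma iota_approx h (e : R) : 0 < e -> exists a, rnorm (h - iota a) <= e.
Proof.
move=> e0; have : closure (range iota) h by rewrite iota_dense.
by move=> /closureP/(_ e e0)[_ [a _ <-]]; exists a.
Qed.

Lemma iota_unit : is_unit (iota (kone R P)).
Proof.
have [kl kr] := kone_unit R P; set u := iota _.
have h1 h : u ** h = h.
  apply/eqP; rewrite -subr_eq0; apply/eqP/rnorm_small => e e0.
  have u1 : rnorm u <= 1.
    apply: rnorm_projection; rewrite -(star_homS iota_hom) -(star_homM iota_hom).
    by rewrite kone_star kl.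
  have e2 : 0 < e / 2 by rewrite divr_gt0.
  have [a ha] := iota_approx h e2.
  have -> : u ** h - h = u ** (h - iota a) + (iota a - h).
    by rewrite smulBr -(star_homM iota_hom) kl addrA subrK.
  rewrite (splitr e); apply: le_trans (rnormD _ _) _; apply: lerD; last by rewrite rnormC.
  by rewrite -[leRHS]mul1r; apply: rnormM_le.
split=> // h; rewrite -[LHS]starK stM -(star_homS iota_hom) kone_star h1.
exact: starK.
Qed.

Local Notation unit1 := (iota (kone R P)).
Definition isoB p : B := iota (iso R P p).

Lemma isoB_isometry p : P p -> star (isoB p) ** isoB p = unit1.
Proof.
by move=> Pp; rewrite -(star_homS iota_hom) -(star_homM iota_hom) iso_isometry.
Qed.

Lemma rnorm_unit1 : rnorm unit1 <= 1.
Proof.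
apply: rnorm_projection; rewrite -(star_homS iota_hom) -(star_homM iota_hom).
by rewrite kone_star kone_l.
Qed.

Lemma rnorm_isoB p : P p -> rnorm (isoB p) <= 1.
Proof.
by move=> Pp; apply: rnorm_le1_starM; rewrite isoB_isometry // rnorm_unit1.
Qed.

Lemma fmul_kone (k : C) : k *: kone R P = fmul (fun=> k).
Proof.
rewrite kone_fmul fmulZ; last exact: cst_continuous.
by congr fmul; apply/funext => x; rewrite mulr1.
Qed.

Lemma compression a x0 (e : R) : 0 < e -> exists2 r, P r &
  rnorm (star (isoB r) ** iota a ** isoB r - a 1%g x0 *: unit1) <= e.
Proof.
move=> e0; pose V : set X := [set x | rnorm (a 1%g x0 - a 1%g x : C^o) <= e].
have nV : nbhs x0 V.
  have /cvgrPdist_le/(_ (rC e)) := @crossed_cts _ _ _ a 1%g x0.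
  rewrite rC_lt => /(_ e0); apply: filterS => x.
  by rewrite /V /= -rC_le -rnormE.
have [r [Pr rV rT]] := boundary_base_free P1 PM joinP freeP (supp a) nV.
exists r => //; pose f x := a 1%g (shift r x).
(* The coefficients away from 1 vanish exactly, so only the one at 1 has to be estimated. *)
have cE : star (iso R P r) ** a ** iso R P r - a 1%g x0 *: kone R P =
    monomial 1%g ((star (iso R P r) ** a ** iso R P r - a 1%g x0 *: kone R P) 1%g).
  apply: sums_eq => t x; rewrite monomialE; last exact: crossed_dom.
  have [->//|t1] := eqVneq t 1%g.
  rewrite fmul_kone sumsDE sumsNE fmulE; last exact: cst_continuous.
  rewrite (negbTE t1) subr0 compressE //; case: ifP => // xt.
  set u := (r * t * r^-1)%g.
  have [uT|/suppP ->//] := boolP (u \in supp a).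
  have u1 : u != 1%g.
    apply: contra t1 => /eqP E; apply/eqP; apply: (@mulgI _ r).
    by rewrite mulg1 -[LHS](mulgVK r) -/u E mul1g.
  rewrite crossed_supp //; apply/negP => su.
  (* The point [r x] contains both [r] and [r t = u r], hence a common upper bound of them, against
     the choice of [r]. *)
  have sr : bval (shift r x) (r * t)%g by rewrite shift_mem // mulKg.
  have [z [_ rz tz]] := directed_bound (@bval_directed _ _ (shift r x))
    (shift_self x Pr) sr.
  apply: (rT u uT u1 z); split=> //.
  by rewrite /u mulgVK.
have -> : star (isoB r) ** iota a ** isoB r - a 1%g x0 *: unit1 =
    iota (star (iso R P r) ** a ** iso R P r - a 1%g x0 *: kone R P).
  by rewrite (star_homB iota_hom) !(star_homM iota_hom) (star_homS iota_hom) (star_homZ iota_hom).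
rewrite cE; apply: rnorm_monomial => //; first exact: ltW.
  exact: crossed_dom.
move=> x; rewrite fmul_kone sumsDE sumsNE fmulE; last exact: cst_continuous.
rewrite eqxx compressE // bval1 mulg1 mulgV rnormC.
by apply: rV; exact: shift_self.
Qed.

Hypothesis unit1_neq0 : unit1 != 0.

Lemma rnorm_unit : rnorm unit1 = 1.
Proof.
have u0 : rnorm unit1 != 0 by apply: contra unit1_neq0 => /eqP/rnorm_eq0 ->.
apply: (mulfI u0); rewrite mulr1 -expr2 -rnorm_starM -(star_homS iota_hom).
by rewrite -(star_homM iota_hom) kone_star kone_l.
Qed.

Lemma coef1_le a x : rnorm (a 1%g x : C^o) <= rnorm (iota a).
Proof.
apply/ler_addgt0Pr => e e0; have [r Pr h] := compression a x e0.
rewrite -[leLHS]mulr1 -rnorm_unit -(@rnormZ _ B).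
rewrite -[a 1%g x *: unit1](subKr (star (isoB r) ** iota a ** isoB r)).
apply: le_trans (rnormD _ _) _; apply: lerD; last by rewrite rnormN.
have rr := rnorm_isoB Pr; have rs : rnorm (star (isoB r)) <= 1 by rewrite rnorm_star.
have := rnormM_le (rnormM_le rs (lexx (rnorm (iota a)))) rr.
by rewrite mulr1 mul1r.
Qed.

(** Every coefficient is the coefficient at 1 of a two-sided compression. Choose [p] in [x] above
    [t] and 1; then [q = t^-1 p] is positive, [t = p q^-1], and [x = p y] for a point [y]. *)
Lemma coef_le a t x : rnorm (a t x : C^o) <= rnorm (iota a).
Proof.
have [xt|xt] := boolP (bval x t); last first.
  by rewrite crossed_supp // rnorm0 rnorm_ge0.
have [p [xp tp p1]] := directed_bound (@bval_directed _ _ x) xt (bval1 x).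
have Pp : P p by rewrite -(po_le1 P).
pose q := (t^-1 * p)%g; have Pq : P q by exact: tp.
have [y yE] := inbdry_translate xp.
have sy : shift p y = x.
  by apply: val_inj; have := shiftE y Pp; rewrite -yE translateVK.
have := coef1_le (star (iso R P p) ** a ** iso R P q) y.
rewrite compressE // bval1 sy mulg1.
have -> : (p * q^-1)%g = t by rewrite /q invgM invgK mulgA mulgV mul1g.
move=> h; apply: le_trans h _.
rewrite !(star_homM iota_hom) (star_homS iota_hom).
have rs : rnorm (star (isoB p)) <= 1 by rewrite rnorm_star rnorm_isoB.
have := rnormM_le (rnormM_le rs (lexx (rnorm (iota a)))) (rnorm_isoB Pq).
by rewrite mulr1 mul1r.
Qed.

(* The elements all of whose Fourier coefficients vanish.                      *)
Definition null_ideal : set B :=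
  [set h | forall a t x, rnorm (a t x : C^o) <= rnorm (h - iota a)].

(** By [coef_le] the coefficients extend continuously to [B], but the extension is never built. The
    definition tests its vanishing at [h] against all finite sums; one approximating family is
    enough. *)
Lemma null_idealP h : (forall e : R, 0 < e -> exists2 a, rnorm (h - iota a) <= e &
    forall t x, rnorm (a t x : C^o) <= e) -> null_ideal h.
Proof.
move=> H a t x; apply/ler_addgt0Pr => e e0.
have e2 : 0 < e / 2 by rewrite divr_gt0.
have [b hb b2] := H _ e2.
rewrite -[a t x](subrK (b t x)); apply: le_trans (rnormD _ _) _.
rewrite (splitr e) addrA; apply: lerD; last exact: b2.
apply: le_trans (coef_le (a - b) t x) _; rewrite (star_homB iota_hom).
rewrite addrC; apply: le_trans (rnorm_dist h _ _) _; rewrite rnormC addrC.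
by apply: lerD.
Qed.

Lemma null_ideal_approx h (e : R) : null_ideal h -> 0 < e ->
  exists2 a, rnorm (h - iota a) <= e & forall t x, rnorm (a t x : C^o) <= e.
Proof.
move=> Jh e0; have [a ha] := iota_approx h e0; exists a => // t x.
exact: le_trans (Jh a t x) ha.
Qed.

Lemma null_idealD h k : null_ideal h -> null_ideal k -> null_ideal (h + k).
Proof.
move=> Jh Jk; apply: null_idealP => e e0; have e2 : 0 < e / 2 by rewrite divr_gt0.
have [a ha ca] := null_ideal_approx Jh e2.
have [b kb cb] := null_ideal_approx Jk e2.
exists (a + b); last first.
  move=> t x; rewrite sumsDE (splitr e); apply: le_trans (rnormD _ _) _.
  exact: lerD.
rewrite (star_homD iota_hom) opprD addrACA (splitr e).
by apply: le_trans (rnormD _ _) _; exact: lerD.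
Qed.

Lemma null_idealZ (k : C) h : null_ideal h -> null_ideal (k *: h).
Proof.
move=> Jh; apply: null_idealP => e e0.
have k0 : 0 < rnorm (k : C^o) + 1 by rewrite ltr_wpDl ?rnorm_ge0.
have [|a ha ca] := @null_ideal_approx h (e / (rnorm (k : C^o) + 1)) Jh.
  by rewrite divr_gt0.
have le1 (r : R) : 0 <= r -> r <= e / (rnorm (k : C^o) + 1) ->
    rnorm (k : C^o) * r <= e.
  move=> r0; rewrite ler_pdivlMr // mulrDr mulr1 mulrC; apply: le_trans.
  by rewrite lerDl.
exists (k *: a) => [|t x].
  rewrite (star_homZ iota_hom) -scalerBr (@rnormZ _ B); apply: le1 => //.
  exact: rnorm_ge0.
by rewrite sumsZE rnormCM; apply: le1 => //; exact: rnorm_ge0.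
Qed.

Lemma null_idealN h : null_ideal h -> null_ideal (- h).
Proof. by move=> Jh; rewrite -scaleN1r; exact: null_idealZ. Qed.

Lemma null_ideal_star h : null_ideal h -> null_ideal (star h).
Proof.
move=> Jh; apply: null_idealP => e e0.
have [a ha ca] := null_ideal_approx Jh e0; exists (star a) => [|t x].
  by rewrite (star_homS iota_hom) -starB rnorm_star.
rewrite starE /rnorm norm_conjC -/(rnorm (_ : C^o)) /extend.
by case: insub => [y|]; [exact: ca|rewrite rnorm0 ltW].
Qed.

Lemma null_ideal_closed h :
  (forall e : R, 0 < e -> exists2 k, null_ideal k & rnorm (h - k) <= e) ->
  null_ideal h.
Proof.
move=> H; apply: null_idealP => e e0; have e2 : 0 < e / 2 by rewrite divr_gt0.
have [k Jk hk] := H _ e2; have [a ka ca] := null_ideal_approx Jk e2.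
exists a => [|t x]; last first.
  by apply: le_trans (ca t x) _; rewrite ler_pdivrMr // mulr_natr mulr2n lerDl ltW.
by rewrite (splitr e); apply: le_trans (rnorm_dist k _ _) _; exact: lerD.
Qed.

Lemma null_ideal_iota_mul c h : null_ideal h -> null_ideal (iota c ** h).
Proof.
move=> Jh; apply: null_idealP => e e0.
(* The first factor bounds the number of terms in a coefficient of [c ** a], the second both the
   norm of [iota c] and the coefficients of [c]. *)
pose M := (#|` supp c|%:R + 1) * (rnorm (iota c) + 1) : R.
have c1 : 0 < rnorm (iota c) + 1 by rewrite ltr_wpDl ?rnorm_ge0.
have s1 : 0 < #|` supp c|%:R + 1 :> R by rewrite ltr_wpDl.
have M0 : 0 < M by rewrite mulr_gt0.
have [|a ha ca] := @null_ideal_approx h (e / M) Jh; first by rewrite divr_gt0.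
have Me : M * (e / M) = e by rewrite mulrCA mulfV ?mulr1 // gt_eqF.
exists (c ** a) => [|t x].
  rewrite (star_homM iota_hom) -smulBr; apply: le_trans (rnormM_le (lexx _) ha) _.
  apply: (@le_trans _ _ (M * (e / M))); last by rewrite Me.
  rewrite ler_wpM2r ?divr_ge0 ?(ltW e0) ?(ltW M0) // /M.
  apply: (@le_trans _ _ (1 * (rnorm (iota c) + 1))); first by rewrite mul1r lerDl.
  by rewrite ler_wpM2r ?(ltW c1) // lerDr.
rewrite [(c ** a) t x](@crossed_mul_fset _ _ _ _ _ (supp c)); last first.
  by move=> s /suppP.
apply: le_trans (@rnorm_sum _ C^o _ _ _) _.
apply: (@le_trans _ _ (\sum_(s <- supp c) (rnorm (iota c) + 1) * (e / M))).
  apply: ler_sum => s _; rewrite rnormCM ler_pM ?rnorm_ge0 //.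
    by apply: le_trans (coef_le c s x) _; rewrite lerDl.
  rewrite /extend; case: insub => [y|]; first exact: ca.
  by rewrite rnorm0 divr_ge0 // ltW.
rewrite big_const_seq count_predT iter_addr_0 -[leLHS]mulr_natl mulrA.
apply: (@le_trans _ _ (M * (e / M))); last by rewrite Me.
rewrite ler_wpM2r ?divr_ge0 ?(ltW e0) ?(ltW M0) //.
by rewrite /M ler_wpM2r ?(ltW c1) // lerDl.
Qed.

Lemma null_ideal_mull k h : null_ideal h -> null_ideal (k ** h).
Proof.
move=> Jh; apply: null_ideal_closed => e e0.
have h1 : 0 < rnorm h + 1 by rewrite ltr_wpDl ?rnorm_ge0.
have [|c kc] := @iota_approx k (e / (rnorm h + 1)); first by rewrite divr_gt0.
exists (iota c ** h); first exact: null_ideal_iota_mul.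
rewrite -smulBl; apply: le_trans (rnormM_le kc (lexx _)) _.
by rewrite mulrAC ler_pdivrMr // ler_pM2l // lerDl.
Qed.

Lemma null_ideal_mulr k h : null_ideal h -> null_ideal (h ** k).
Proof.
move=> Jh; rewrite -[h ** k]starK stM; apply: null_ideal_star.
exact/null_ideal_mull/null_ideal_star.
Qed.

End Compression.

(** * Gauge actions and faithfulness of the Fourier coefficients *)

Section Growth.
Variable R : realType.

Lemma bernoulli_ineq (d : R) m : 0 <= d -> 1 + m%:R * d <= (1 + d) ^+ m.
Proof.
move=> d0; elim: m => [|m IH]; first by rewrite mul0r addr0 expr0.
rewrite exprS; apply: (@le_trans _ _ ((1 + d) * (1 + m%:R * d))).
  by rewrite -natr1; have := mulr_ge0 d0 d0; have : 0 <= m%:R :> R by []; nra.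
by rewrite ler_wpM2l // addr_ge0.
Qed.

(** A factor linear in the exponent disappears on taking [2 ^ n]-th roots. This turns counts of
    terms into sharp norm bounds. *)
Lemma growth_le (y l A : R) : 0 <= A -> 0 <= y -> 0 <= l ->
  (forall n, y ^+ (2 ^ n)%N <= (A * (2 ^ n)%:R + 1) * l ^+ (2 ^ n)%N) -> y <= l.
Proof.
move=> A0 y0 l0 H; rewrite leNgt; apply/negP => ly.
have [l1|l1] := eqVneq l 0.
  have := H 0%N; rewrite l1 expn0 !expr1 mulr0 => y1.
  by rewrite l1 in ly; lra.
have lp : 0 < l by rewrite lt_def l1.
pose d := y / l - 1.
have d0 : 0 < d by rewrite subr_gt0 ltr_pdivlMr // mul1r.
have H' n : (1 + d) ^+ (2 ^ n)%N <= A * (2 ^ n)%:R + 1.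
  rewrite /d addrC subrK expr_div_n ler_pdivrMr ?exprn_gt0 //; exact: H.
(* For [q = 2 ^ n], squaring Bernoulli's inequality gives at least [(q d)^2] at exponent [2 q],
   against at most [2 A q + 1]. So [q d^2] would stay bounded. *)
have key n : (2 ^ n)%:R * d ^+ 2 <= 4 * (A + 1).
  have := H' n.+1; rewrite expnS mulnC exprM.
  have q0 : 0 < (2 ^ n)%:R :> R by rewrite ltr0n expn_gt0.
  have q1 : 1 <= (2 ^ n)%:R :> R by rewrite ler1n expn_gt0.
  have b := bernoulli_ineq (2 ^ n) (ltW d0).
  rewrite natrM => h; move: b h; set q := (2 ^ n)%:R; set u := (1 + d) ^+ _.
  rewrite -/q in q0 q1 * => b h.
  have qd : 0 <= q * d by rewrite mulr_ge0 // ltW.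
  have h1 : (q * d) ^+ 2 <= u ^+ 2.
    by rewrite ler_pXn2r ?nnegrE //; lra.
  rewrite -(ler_pM2l q0); rewrite !expr2 in h h1 *; nra.
have [n hn] : exists n, 4 * (A + 1) / d ^+ 2 < (2 ^ n)%:R.
  exists (Num.trunc (4 * (A + 1) / d ^+ 2)).+1.
  apply: lt_trans (truncnS_gt _) _.
  by rewrite ltr_nat ltn_expl.
have := key n; rewrite leNgt => /negP[].
by rewrite -ltr_pdivrMr // exprn_gt0.
Qed.

End Growth.

Section RootsOfUnity.
Variable R : realType.
Local Notation C := (Cplx R).

(** Iterated square roots of -1; the equation by itself forces the exact order [2 ^ j.+1]. *)
Lemma root_minus1 j : exists z : C, z ^+ (2 ^ j)%N = -1.
Proof.
elim: j => [|j [z zE]]; first by exists (-1); rewrite expr1.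
by exists (sqrtC z); rewrite expnS exprM sqrtCK.
Qed.

Lemma norm_root_minus1 (z : C) j : z ^+ (2 ^ j)%N = -1 -> z * z^* = 1.
Proof.
move=> zE; rewrite -normCK; have : `|z| ^+ (2 ^ j)%N = 1 by rewrite -normrX zE normrN1.
move=> /eqP; rewrite pexpr_eq1 ?expn_gt0 // => /eqP ->.
by rewrite expr1n.
Qed.

Lemma prim_root_minus1 (z : C) j : z ^+ (2 ^ j)%N = -1 ->
  (2 ^ j.+1).-primitive_root z.
Proof.
move=> zE; have z1 : z ^+ (2 ^ j.+1)%N = 1 by rewrite expnS mulnC exprM zE sqrrN expr1n.
have [|m mz] := prim_order_exists _ z1; first by rewrite expn_gt0.
move=> /(dvdn_pfactor _ _ (isT : prime 2))[k kj mE].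
move: kj; rewrite leq_eqVlt => /orP[/eqP kj|kj]; first by rewrite -kj -mE.
have : z ^+ (2 ^ j)%N = 1.
  by apply/eqP; rewrite -(prim_order_dvd mz) mE dvdn_exp2l.
rewrite zE => /eqP; rewrite eq_sym -subr_eq0 opprK.
by rewrite -[1 + 1]/(2%:R) pnatr_eq0.
Qed.

Lemma sum_root_powers (z : C) j (n : int) : z ^+ (2 ^ j)%N = -1 ->
  (`|n| < 2 ^ j.+1)%N ->
  \sum_(k < 2 ^ j.+1) (z ^ n) ^+ k = if n == 0 then (2 ^ j.+1)%:R else 0.
Proof.
move=> zE nN; have pz := prim_root_minus1 zE.
case: eqP => [->|/eqP n0].
  rewrite expr0z (eq_bigr (fun=> 1)) => [|k _]; last by rewrite expr1n.
  by rewrite sumr_const card_ord.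
have wN : (z ^ n) ^+ (2 ^ j.+1)%N = 1.
  by rewrite exprnP exprzAC -exprnP (prim_expr_order pz) exp1rz.
have w1 : z ^ n != 1.
  have : z ^+ `|n|%N != 1.
    have n1 : (0 < `|n|)%N by rewrite absz_gt0.
    rewrite -(prim_order_dvd pz); apply/negP => /dvdn_leq -/(_ n1).
    by rewrite leqNgt nN.
  case: (n) => m; first by [].
  by move=> /= h; rewrite -[z ^ _]/(z ^- m.+1) invr_eq1.
apply/eqP; have := subrX1 (z ^ n) (2 ^ j.+1); rewrite wN subrr => /eqP.
by rewrite eq_sym mulf_eq0 subr_eq0 (negbTE w1).
Qed.

End RootsOfUnity.

Section Gauge.
Variables (R : realType) (G : groupType) (P : set G).
Local Notation C := (Cplx R).
Local Notation X := (boundary P).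
Local Notation K := (crossed_sums R P).
Implicit Types (a b c : K) (s t r p q g : G) (x y : X).

Lemma crossed_cst_scale (u : G -> C) a :
  (fun t => (fun x => u t * a t x) : X -> C) \in @finite_sum R G P.
Proof.
apply/asboolP; split=> [|t].
  have /asboolP[fa _] := crossed_valP a; apply: sub_finite_set fa => t /= h a0.
  by apply: h; apply/funext => x; rewrite a0 mulr0.
have := dom_idealD (u t) (crossed_dom a t) (@dom_ideal0 R G P t); congr dom_ideal.
by apply/funext => x; exact: addr0.
Qed.

Definition rescale u a : K := CrossedSums (crossed_cst_scale u a).

Lemma rescaleE u a t x : rescale u a t x = u t * a t x. Proof. by []. Qed.

Lemma extend_rescale u a t w : extend (rescale u a t) w = u t * extend (a t) w.
Proof. by rewrite /extend; case: insub => [//|]; rewrite mulr0. Qed.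

Lemma rescale_hom u : (forall s t, u (s * t)%g = u s * u t) ->
  (forall s, u s^-1%g = (u s)^*) -> star_hom (rescale u).
Proof.
move=> uM uV; split=> [k a b|a b|a]; apply: sums_eq => r x.
- by rewrite !(sumsDE, sumsZE, rescaleE) mulrDr mulrCA.
- rewrite rescaleE [(a ** b) r x](@crossed_mul_fset _ _ _ _ _ (supp a)); last first.
    by move=> s /suppP.
  rewrite [RHS](@crossed_mul_fset _ _ _ _ _ (supp a)); last first.
    by move=> s /suppP sa; apply/funext => y; rewrite rescaleE sa mulr0.
  rewrite mulr_sumr; apply: eq_bigr => s _; rewrite extend_rescale rescaleE.
  by rewrite -{1}(mulVKg s r) uM mulrACA.
- by rewrite rescaleE !starE extend_rescale [RHS]rmorphM /= -uV invgK.
Qed.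

Variable phi : G -> int.
Hypothesis phiM : forall s t, phi (s * t)%g = phi s + phi t.

Lemma phi1 : phi 1%g = 0.
Proof. by apply: (@addrI _ (phi 1%g)); rewrite -phiM mulg1 addr0. Qed.
Lemma phiV s : phi s^-1%g = - phi s.
Proof. by apply/eqP; rewrite -subr_eq0 opprK -phiM mulVg phi1. Qed.

Definition gauge (z : C) a : K := rescale (fun t => z ^ phi t) a.

Lemma gauge_hom (z : C) : z * z^* = 1 -> star_hom (gauge z).
Proof.
move=> zz; have z0 : z != 0 by apply/eqP => z0; move/eqP: zz; rewrite z0 mul0r eq_sym oner_eq0.
apply: rescale_hom => [s t|s]; first by rewrite phiM expfzDr.
have zV : z^* = z^-1 by rewrite -[LHS](mulKf z0) zz mulr1.
rewrite phiV; case: (phi s) => n.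
  by rewrite -exprnN -exprnP rmorphXn /= zV exprVn.
by rewrite NegzE opprK -exprnN -exprnP fmorphV rmorphXn /= zV exprVn invrK.
Qed.

Definition component (d : int) a : K := rescale (fun t => if phi t == d then 1 else 0) a.

Lemma componentE d a t x : component d a t x = if phi t == d then a t x else 0.
Proof. by rewrite rescaleE; case: eqP; rewrite ?mul1r ?mul0r. Qed.

Definition degree_le (M : nat) a := forall t, a t <> 0 -> (`|phi t| <= M)%N.

(** The condition on [j] keeps [|phi t - d|] below the order of [z] on the support, so the average
    over the powers of [z] kills every degree other than [d], without aliasing. *)
Lemma component_average d a M j (z : C) : degree_le M a -> z ^+ (2 ^ j)%N = -1 ->
  (M + `|d| < 2 ^ j.+1)%N ->
  component d a = (2 ^ j.+1)%:R^-1 *: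
    \sum_(k < 2 ^ j.+1) (z ^+ k) ^ (- d) *: gauge (z ^+ k) a.
Proof.
move=> aM zE Mj; apply: sums_eq => t x; rewrite componentE sumsZE sums_sumE.
have [a0|a0] := eqVneq (a t x) 0.
  rewrite a0 big1 ?mulr0; first by case: ifP.
  by move=> k _; rewrite sumsZE rescaleE a0 !mulr0.
have z0 : z != 0.
  apply/eqP => z0; move/eqP: zE; rewrite z0 expr0n expn_eq0 /= eq_sym oppr_eq0.
  by rewrite oner_eq0.
rewrite (eq_bigr (fun k : 'I_(2 ^ j.+1) => (z ^ (phi t - d)) ^+ k * a t x)); last first.
  move=> k _; rewrite sumsZE rescaleE mulrA; congr (_ * _).
  rewrite -expfzDr ?expf_neq0 // addrC.
  by rewrite [z ^+ k]exprnP exprzAC.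
rewrite -mulr_suml (sum_root_powers zE); last first.
  have at0 : a t <> 0 by move=> E; rewrite E eqxx in a0.
  by have := aM t at0; lia.
rewrite subr_eq0; case: eqP => _; last by rewrite mul0r mulr0.
by rewrite mulrA mulVf ?mul1r // pnatr_eq0 expn_eq0.
Qed.

Lemma mul_neq0 a b t : (a ** b) t <> 0 -> exists s, a s <> 0 /\ b (s^-1 * t)%g <> 0.
Proof.
move=> h; apply: contrapT => H; apply: h; apply/funext => x.
rewrite [LHS](@crossed_mul_fset _ _ _ _ _ (supp a)); last by move=> s /suppP.
rewrite big1 // => s _; have [->|as0] := pselect (a s = 0); first by rewrite mul0r.
have [->|bs0] := pselect (b (s^-1 * t)%g = 0); first by rewrite extend0 mulr0.
by case: H; exists s.
Qed.

Lemma star_neq0 a t : star a t <> 0 -> a t^-1%g <> 0.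
Proof.
move=> h a0; apply: h; apply/funext => x.
by rewrite starE a0 extend0 conjC0.
Qed.

Lemma degree_mul M N a b : degree_le M a -> degree_le N b -> degree_le (M + N) (a ** b).
Proof.
move=> aM bN t /mul_neq0[s [/aM sa /bN sb]].
have -> : phi t = phi s + phi (s^-1 * t)%g by rewrite -phiM mulVKg.
move: sa sb; move: (phi s) (phi _) => m n; lia.
Qed.

Lemma degree_iter_square M n a : degree_le M a ->
  degree_le (M * 2 ^ n) (iter n (@square _ _) a).
Proof.
move=> aM; elim: n => [|n IH]; first by rewrite expn0 muln1.
by rewrite expnS mulnCA mul2n -addnn; exact: degree_mul.
Qed.

Lemma degree_exists a : exists M, degree_le M a.
Proof.
exists (\sum_(t <- supp a) `|phi t|)%N => t at0.
have ta : t \in supp a by apply/negPn/negP => /suppP.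
by rewrite (big_fsetD1 _ ta) leq_addr.
Qed.

Lemma component_sum M a : degree_le M a ->
  a = \sum_(k < M.*2.+1) component (k%:Z - M%:Z) a.
Proof.
move=> aM; apply: sums_eq => t x; rewrite sums_sumE.
have [a0|a0] := eqVneq (a t x) 0.
  rewrite a0 big1 // => k _; rewrite componentE a0; by case: ifP.
have at0 : a t <> 0 by move=> E; rewrite E eqxx in a0.
have aMt := aM t at0; have k0 : 0 <= phi t + M%:Z by lia.
have kM : (`|(phi t + M%:Z)%R| < M.*2.+1)%N by lia.
rewrite (bigD1 (Ordinal kM)) // componentE [nat_of_ord _]/= gez0_abs // addrK eqxx.
rewrite big1 => [|k kne]; first by rewrite [RHS]addr0.
rewrite componentE; case: eqP => // E.
case/eqP: kne; apply: val_inj => /=; apply/eqP; rewrite -eqz_nat gez0_abs //.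
by rewrite E subrK.
Qed.

End Gauge.

(** * Norm estimates on gauge-invariant elements, and the reduction to them *)

Section Core.
Variables (R : realType) (G : groupType) (P : set G) (S : eqType) (phi : S -> G -> int).
Local Notation C := (Cplx R).
Local Notation X := (boundary P).
Local Notation K := (crossed_sums R P).
Hypothesis P1 : P 1%g.
Hypothesis PM : forall x y, P x -> P y -> P (x * y)%g.
Hypothesis joinP : forall x y z, po_le P x z -> po_le P y z ->
  exists j, is_join P x y j.
Hypothesis freeP : forall t : G, t != 1%g -> exists2 s, P s &
  forall z, ~ (po_le P s z /\ po_le P (t * s)%g z).
Hypothesis phiM : forall s x y, phi s (x * y)%g = phi s x + phi s y.
Hypothesis phi_ge0 : forall s x, P x -> 0 <= phi s x.
Hypothesis phi_supp : forall x, exists L : seq S, forall s, s \notin L -> phi s x = 0.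
Hypothesis phi_control : forall x y z, P x -> P y -> is_join P x y z ->
  forall s, phi s z <= Num.max (phi s x) (phi s y).
Hypothesis phi_finite : forall g, P g ->
  finite_set [set p | P p /\ forall s, phi s p <= phi s g].
Implicit Types (a b c : K) (t r p q g : G) (x y : X) (s : S).

Let phiV' s t : phi s t^-1%g = - phi s t := phiV (phiM s) t.

(* The coefficients of the elements of [core g] are indexed by a finite set of *)
(* group elements depending only on [g], and [core g] is a *-subalgebra; these *)
(* are the finite-dimensional-type pieces exhausting the gauge-invariant part. *)
Definition core g a := forall t x, a t x != 0 -> (forall s, phi s t = 0) /\
  exists p, [/\ P p, bval x p, po_le P t p & forall s, phi s p <= phi s g].

(** Let [p] witness [t] at [x], and [p'] witness [t^-1 r] at [t^-1 x]. The product is witnessed by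
    [t z], with [z] the join of [p'] and [t^-1 p]. As the exponents of [t] vanish, control of joins
    keeps those of [t z] below those of [g]: products do not enlarge the bound. *)
Lemma core_mul g a b : P g -> core g a -> core g b -> core g (a ** b).
Proof.
move=> Pg ga gb r x abx.
have [t [at0 bt0]] : exists t, a t x != 0 /\
    extend (b (t^-1 * r)%g) (translate t^-1%g (bval x)) != 0.
  apply: contrapT => h; case/eqP: abx.
  rewrite [LHS](@crossed_mul_fset _ _ _ _ _ (supp a)); last by move=> s /suppP.
  rewrite big1 // => t _; have [->|a0] := eqVneq (a t x) 0; first by rewrite mul0r.
  have [->|b0] := eqVneq (extend (b (t^-1 * r)%g) (translate t^-1%g (bval x))) 0.
    by rewrite mulr0.
  by case: h; exists t.
have [t0 [p [Pp xp tp pg]]] := ga t x at0.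
have xt : bval x t by apply/negPn/negP => /(crossed_supp a) E; rewrite E eqxx in at0.
have [y yE] := inbdry_translate xt; move: bt0; rewrite yE extend_val => bt0.
have [r0 [p' [Pp' yp' rp' p'g]]] := gb _ y bt0.
split=> [s|]; first by rewrite -(mulVKg t r) phiM t0 r0 addr0.
have yp : bval y (t^-1 * p)%g by rewrite -yE /translate invgK mulVKg.
have Ptp : P (t^-1 * p)%g by exact: tp.
have [z zj yz] := @bval_directed _ _ y _ _ yp' yp.
have [p'z tpz _] := zj.
have Pz : P z by rewrite -po_le1; apply: (po_le_trans PM _ p'z); rewrite po_le1.
have ptz : po_le P p (t * z)%g.
  by rewrite -(mulVKg t p); apply/po_le_mul.
exists (t * z)%g; split.
- by rewrite -po_le1; apply: (po_le_trans PM _ ptz); rewrite po_le1.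
- by move: yz; rewrite -yE /translate invgK.
- apply: (po_le_trans PM (y := (t * p')%g)); last exact/po_le_mul.
  by rewrite -{1}(mulVKg t r); apply/po_le_mul.
- move=> s; rewrite phiM t0 add0r.
  apply: le_trans (phi_control Pp' Ptp zj s) _.
  by rewrite ge_max p'g phiM phiV' t0 oppr0 add0r pg.
Qed.

Lemma core_star g a : core g a -> core g (star a).
Proof.
move=> ga r x; rewrite starE conjC_eq0 => h.
have xr : bval x r.
  apply/negPn/negP => xr; case/eqP: h; apply: extend_out.
  by move=> /(boundary_translateP _ (bdryP x)); rewrite (negbTE xr).
have [y yE] := inbdry_translate xr; move: h; rewrite yE extend_val => h.
have [r0 [p [Pp yp rp pg]]] := ga _ y h.
have rE s : phi s r = 0 by apply/eqP; rewrite -oppr_eq0 -phiV' r0.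
split=> //; exists (r * p)%g; split.
- by move: rp; rewrite /po_le invgK.
- by move: yp; rewrite -yE /translate invgK.
- exact: po_le_mulr.
- by move=> s; rewrite phiM rE add0r.
Qed.

Lemma core_iter_square g a n : P g -> core g a -> core g (iter n (@square _ _) a).
Proof. by move=> Pg ga; elim: n => //= n IH; exact: core_mul. Qed.

(** If [p] witnesses [t], then [q = t^-1 p] is positive with the same exponents as [p], and
    [t = p q^-1] has finitely many possible values. *)
Lemma core_supp g : P g -> exists T : {fset G}, forall a, core g a -> (supp a `<=` T)%fset.
Proof.
move=> Pg; pose F := [set p | P p /\ forall s, phi s p <= phi s g].
have fF : finite_set [set (p * q^-1)%g | p in F & q in F].
  by apply: finite_image2; exact: phi_finite.
exists (fset_set [set (p * q^-1)%g | p in F & q in F]) => a ga.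
apply/fsubsetP => t ta; have [x atx] : exists x, a t x != 0.
  apply: contrapT => h; move: ta; rewrite /supp in_fset_set.
    move=> /set_mem /= []; apply/funext => x; apply: contrapT => /eqP ax.
    by apply: h; exists x.
  by have /asboolP[] := crossed_valP a.
have [t0 [p [Pp xp tp pg]]] := ga t x atx.
rewrite in_fset_set //; apply/mem_set; exists p; first by [].
exists (t^-1 * p)%g; last by rewrite invgM invgK mulgA mulgV mul1g.
by split=> // s; rewrite phiM phiV' t0 oppr0 add0r.
Qed.

Lemma core_exists a : (forall s t, a t <> 0 -> phi s t = 0) -> exists2 g, P g & core g a.
Proof.
move=> a0.
suff [g Pg h] : exists2 g, P g & forall t x, t \in enum_fset (supp a) -> bval x t -> exists p,
    [/\ P p, bval x p, po_le P t p & forall s, phi s p <= phi s g].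
  exists g => // t x atx; have at0 : a t <> 0 by move=> E; rewrite E eqxx in atx.
  split=> [s|]; first exact: a0.
  apply: h; first by have := @suppP _ _ _ a t; case: (t \in _) => // /(_ isT).
  by apply/negPn/negP => /(crossed_supp a) E; rewrite E eqxx in atx.
elim: (enum_fset (supp a)) => [|t T [g Pg IH]].
  by exists 1%g => // t x; rewrite in_nil.
have [h Ph hP] : exists2 h, P h & forall x, bval x t -> exists p,
    [/\ P p, bval x p, po_le P t p & forall s, phi s p <= phi s h].
  have [[x0 xt0]|nx] := pselect (exists x : X, bval x t); last first.
    by exists 1%g => // x xt; case: nx; exists x.
  (* Joins of 1 and [t] found in different points lie below each other, so the exponents found at
     one point serve at all of them. *)
  have [z [oz tz zm] _] := @bval_directed _ _ x0 _ _ (bval1 x0) xt0.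
  exists z => [|x xt]; first by rewrite -(po_le1 P).
  have [z' [oz' tz' zm'] xz'] := @bval_directed _ _ x _ _ (bval1 x) xt.
  exists z'; split=> // [|s]; first by rewrite -(po_le1 P).
  have zz : po_le P z' z by exact: zm'.
  by rewrite -(mulVKg z' z) phiM lerDl phi_ge0.
(* Exponents are nonnegative on the cone, so the product dominates both factors. *)
exists (g * h)%g => [|u x]; first exact: PM.
rewrite in_cons => /orP[/eqP ->|uT] xu.
  have [p [Pp xp tp ph]] := hP x xu; exists p; split=> // s.
  by rewrite phiM; apply: le_trans (ph s) _; rewrite lerDr phi_ge0.
have [p [Pp xp tp pg]] := IH u x uT xu; exists p; split=> // s.
by rewrite phiM; apply: le_trans (pg s) _; rewrite lerDl phi_ge0.
Qed.

Variables (B : cstarAlgType C) (iota : K -> B).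
Hypothesis iota_hom : star_hom iota.
Hypothesis iota_dense : closure (range iota) = [set: B].
Hypothesis iota_univ : forall f : K -> B, star_hom f ->
  exists2 g : B -> B, star_hom g & forall a, g (iota a) = f a.
Hypothesis unit1_neq0 : iota (kone R P) != 0.
Implicit Types (h k : B).
Local Notation J := (null_ideal iota).

Let JD := null_idealD P1 PM joinP freeP iota_hom iota_dense unit1_neq0.
Let JZ := null_idealZ P1 PM joinP freeP iota_hom iota_dense unit1_neq0.
Let JN := null_idealN P1 PM joinP freeP iota_hom iota_dense unit1_neq0.
Let Jstar := null_ideal_star P1 PM joinP freeP iota_hom iota_dense unit1_neq0.
Let Jml := null_ideal_mull P1 PM joinP freeP iota_hom iota_dense unit1_neq0.
Let Jmr := null_ideal_mulr P1 PM joinP freeP iota_hom iota_dense unit1_neq0.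
Let JP := null_idealP P1 PM joinP freeP iota_hom unit1_neq0.

(** A bound [l] for the quotient norm modulo [J], with an explicit nearby element of [J]. The aim is
    that on finite sums the norm of [B] is bounded by [l] as well, which forces [J] to be 0. *)
Definition near_null (l : R) h := exists2 j, J j & rnorm (h - j) <= l.

Lemma near_null_mul (l m : R) h k : near_null l h -> near_null m k ->
  near_null (l * m) (h ** k).
Proof.
move=> [i Ji hi] [j Jj kj]; exists (i ** k + h ** j - i ** j).
  apply: JD; last exact/JN/Jml.
  by apply: JD; [exact: Jmr|exact: Jml].
have -> : h ** k - (i ** k + h ** j - i ** j) = (h - i) ** (k - j).
  have E (w x y z : B) : w - (x + y - z) = w - y - (x - z).
    by rewrite !opprB opprD (addrC (- x)) !addrA (addrAC w).
  by rewrite smulBl !smulBr E.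
exact: rnormM_le.
Qed.

Lemma near_null_star (l : R) h : near_null l h -> near_null l (star h).
Proof. by move=> [i Ji hi]; exists (star i); [exact: Jstar|rewrite -starB rnorm_star]. Qed.

Lemma near_null_iter_square (l : R) h n :
  near_null l h -> near_null (l ^+ (2 ^ n)%N) (iter n (@square _ _) h).
Proof.
move=> hl; elim: n => [|n IH]; first by rewrite expr1.
by rewrite expnS mulnC exprM expr2; exact: near_null_mul.
Qed.

Lemma near_null_coef (l : R) a t x : near_null l (iota a) -> rnorm (a t x : C^o) <= l.
Proof. by move=> [j Jj al]; apply: le_trans (Jj a t x) _; rewrite rnormC. Qed.

Lemma rnorm_expz (z : C) (n : int) : z * z^* = 1 -> rnorm (z ^ n : C^o) = 1.
Proof.
move=> zz; apply: rC_inj; rewrite -(rnormE (z ^ n : C^o)).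
have z1 : `|z| = 1 by apply/eqP; rewrite -(@pexpr_eq1 _ _ 2) // normCK zz.
rewrite [LHS](_ : _ = `|z| ^ n); first by rewrite z1 exp1rz.
by case: n => n; [exact: normrX|rewrite /= normfV normrX].
Qed.

(** Universality gives the endomorphism. It is contractive and multiplies coefficients by numbers of
    modulus 1, hence preserves [J]. *)
Lemma gauge_extend s (z : C) : z * z^* = 1 -> exists2 g : B -> B, star_hom g &
  (forall a, g (iota a) = iota (gauge (phi s) z a)) /\ forall h, J h -> J (g h).
Proof.
move=> zz; have fh : star_hom (iota \o gauge (phi s) z).
  have gh := gauge_hom P (phiM s) zz; split=> [k a b|a b|a] /=.
  - by rewrite (star_homD gh) (star_homD iota_hom) !(star_homZ gh, star_homZ iota_hom).
  - by rewrite (star_homM gh) (star_homM iota_hom).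
  - by rewrite (star_homS gh) (star_homS iota_hom).
have [g gh gE] := iota_univ fh; exists g => //; split=> // h Jh.
apply: JP => e e0; have [a ha ca] := null_ideal_approx iota_dense Jh e0.
exists (gauge (phi s) z a) => [|t x].
  rewrite -[iota (gauge _ _ _)](gE a) -(star_homB gh).
  by apply: le_trans (star_hom_contractive (iota_unit iota_hom iota_dense) gh _) _.
by rewrite rescaleE rnormCM rnorm_expz // mul1r.
Qed.

Lemma near_null_sum (l : R) n (u : nat -> C) (F : nat -> B) : 0 <= l -> (0 < n)%N ->
  (forall i, rnorm (u i : C^o) <= 1) -> (forall i, near_null l (F i)) ->
  near_null l (n%:R^-1 *: \sum_(i < n) u i *: F i).
Proof.
move=> l0 n0 u1 FJ.
have /choice[j jP] : forall i, exists k, J k /\ rnorm (F i - k) <= l.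
  by move=> i; have [k Jk Fk] := FJ i; exists k.
have nE : (n%:R^-1 : C) = rC n%:R^-1.
  by rewrite /rC fmorphV rmorph_nat.
have n1 : 0 < n%:R :> R by rewrite ltr0n.
exists (n%:R^-1 *: \sum_(i < n) u i *: j i).
  apply: JZ; elim/big_ind: _ => [||i _]; last by apply: JZ; case: (jP i).
    by rewrite -(scale0r (j 0%N)); apply: JZ; case: (jP 0%N).
  exact: JD.
rewrite -scalerBr -sumrB nE rnormZr ger0_norm ?invr_ge0 ?ler0n //.
rewrite mulrC ler_pdivrMr //; apply: le_trans (rnorm_sum _ _) _.
apply: (@le_trans _ _ (\sum_(i < n) l)); last by rewrite sumr_const card_ord mulr_natr.
apply: ler_sum => i _; rewrite -scalerBr (@rnormZ _ B) -[l]mul1r.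
by apply: ler_pM; rewrite ?rnorm_ge0 //; case: (jP i).
Qed.

Lemma near_null_component (l : R) s d a : 0 <= l -> near_null l (iota a) ->
  near_null l (iota (component (phi s) d a)).
Proof.
move=> l0 [j0 Jj al]; have [M aM] := degree_exists (phi s) a.
pose j := (M + `|d|)%N; have [z zE] := @root_minus1 R j.
have zz := norm_root_minus1 zE.
have zk (i : nat) : z ^+ i * (z ^+ i)^* = 1 by rewrite rmorphXn -exprMn zz expr1n.
have Mj : (M + `|d| < 2 ^ j.+1)%N.
  by apply: ltn_trans (ltn_expl j.+1 (isT : 1 < 2)%N); rewrite /j.
rewrite (component_average aM zE Mj) (star_homZ iota_hom) (star_hom_sum iota_hom).
have /choice[g gP] : forall k : nat, exists g : B -> B, [/\ star_hom g,
    forall a, g (iota a) = iota (gauge (phi s) (z ^+ k) a) & forall h, J h -> J (g h)].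
  by move=> k; have [g gh [gE gJ]] := gauge_extend s (zk k); exists g.
rewrite (eq_bigr (fun k : 'I_(2 ^ j.+1) => (z ^+ k) ^ (- d) *: g k (iota a))); last first.
  by move=> k _; have [_ gE _] := gP k; rewrite (star_homZ iota_hom) gE.
apply: (@near_null_sum l _ (fun i : nat => (z ^+ i) ^ (- d)) (fun i : nat => g i (iota a))) => //.
- by rewrite expn_gt0.
- by move=> k; rewrite rnorm_expz.
- move=> k; have [gh _ gJ] := gP k; exists (g k j0); first exact: gJ.
  rewrite -(star_homB gh); apply: le_trans al.
  exact: (star_hom_contractive (iota_unit iota_hom iota_dense) gh).
Qed.

Lemma rnorm_iter_square_star a n :
  rnorm (iter n (@square _ _) (iota (star a ** a))) = (rnorm (iota a) ^+ 2) ^+ (2 ^ n)%N.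
Proof.
rewrite rnorm_iter_square; last by rewrite -(star_homS iota_hom) stM starK.
by rewrite (star_homM iota_hom) (star_homS iota_hom) rnorm_starM.
Qed.

Lemma near_null_square_star (l : R) a n : near_null l (iota a) ->
  near_null ((l ^+ 2) ^+ (2 ^ n)%N) (iota (iter n (@square _ _) (star a ** a))).
Proof.
move=> al; rewrite (star_hom_iter_square iota_hom); apply: near_null_iter_square.
rewrite (star_homM iota_hom) (star_homS iota_hom) expr2; apply: near_null_mul => //.
exact: near_null_star.
Qed.

(* The norm of [B] on the gauge-invariant elements is determined by the        *)
(* Fourier coefficients: the powers of [a^* a] stay in a set of the form       *)
(* [core g], where the two differ by at most a constant factor.                *)
Lemma near_null_core (l : R) a : 0 <= l -> (forall s t, a t <> 0 -> phi s t = 0) ->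
  near_null l (iota a) -> rnorm (iota a) <= l.
Proof.
move=> l0 a0 al; have [g Pg ga] := core_exists a0.
have [T Tg] := core_supp Pg.
rewrite -(ler_pXn2r (n := 2)) ?nnegrE ?rnorm_ge0 //.
apply: (@growth_le _ _ _ #|` T|%:R); rewrite ?exprn_ge0 ?rnorm_ge0 // => n.
rewrite -rnorm_iter_square_star -(star_hom_iter_square iota_hom).
have yl := near_null_square_star n al.
set y := iter n _ _ in yl *.
have gy : core g y by apply: core_iter_square => //; apply: core_mul => //; exact: core_star.
have y0 : 0 <= (l ^+ 2) ^+ (2 ^ n)%N by rewrite !exprn_ge0.
apply: le_trans (rnorm_iota_le iota_hom y0 (fun t x => near_null_coef t x yl) (Tg _ gy)) _.
apply: ler_wpM2r => //; have T0 : 0 <= #|` T|%:R :> R by [].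
have q1 : 1 <= (2 ^ n)%:R :> R by rewrite ler1n expn_gt0.
nra.
Qed.

(** Induction on a list of generators that carries all nonzero exponents of [a]. The [2 ^ n]-th
    power of [star a ** a] has at most [2 D 2 ^ n + 1] components with respect to [s], a number
    linear in the exponent, which [growth_le] removes. *)
Lemma near_null_le (L : seq S) (l : R) a : 0 <= l ->
  (forall s t, a t <> 0 -> s \notin L -> phi s t = 0) ->
  near_null l (iota a) -> rnorm (iota a) <= l.
Proof.
elim: L l a => [|s L IH] l a l0 aL al.
  by apply: near_null_core => // s t at0; exact: aL.
have [D aD] := degree_exists (phi s) (star a ** a).
rewrite -(ler_pXn2r (n := 2)) ?nnegrE ?rnorm_ge0 //.
apply: (@growth_le _ _ _ (2 * D%:R)); rewrite ?exprn_ge0 ?mulr_ge0 ?rnorm_ge0 // => n.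
rewrite -rnorm_iter_square_star -(star_hom_iter_square iota_hom).
have yl := near_null_square_star n al.
have yD := degree_iter_square (n := n) (phiM s) aD.
have yL s' t : iter n (@square _ _) (star a ** a) t <> 0 -> s' \notin s :: L -> phi s' t = 0.
  have mulL b c : (forall t, b t <> 0 -> s' \notin s :: L -> phi s' t = 0) ->
      (forall t, c t <> 0 -> s' \notin s :: L -> phi s' t = 0) ->
      forall t, (b ** c) t <> 0 -> s' \notin s :: L -> phi s' t = 0.
    move=> bL cL u /mul_neq0[r [br cr]] sL.
    by rewrite -(mulVKg r u) phiM (bL r br sL) (cL _ cr sL) addr0.
  elim: n t {yl yD} => [|n IHn] t; last exact: mulL.
  apply: mulL => u; last exact: aL.
  by move=> /star_neq0 au sL; apply/eqP; rewrite -oppr_eq0 -phiV' (aL s' _ au sL).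
move: yl yD yL; set y := iter n _ _; set mu := (l ^+ 2) ^+ _ => yl yD yL.
have mu0 : 0 <= mu by rewrite !exprn_ge0.
rewrite (component_sum yD) (star_hom_sum iota_hom).
apply: le_trans (rnorm_sum _ _) _.
apply: (@le_trans _ _ (\sum_(k < (D * 2 ^ n).*2.+1) mu)); last first.
  rewrite sumr_const card_ord -[leLHS]mulr_natl ler_wpM2r //.
  by rewrite -addn1 natrD -mul2n !natrM mulrA.
apply: ler_sum => k _; set c := component _ _ _.
have cl : near_null mu (iota c) by exact: near_null_component.
rewrite -(ler_pXn2r (n := 2)) ?nnegrE ?rnorm_ge0 //.
rewrite -rnorm_starM -(star_homS iota_hom) -(star_homM iota_hom).
(* The component [c] is homogeneous in [s], so [star c ** c] has degree 0 there and only the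
   generators of [L] remain. *)
apply: IH; first by rewrite exprn_ge0.
  have cL s' t : s' \notin L -> c t <> 0 -> phi s' t = if s' == s then k%:Z - (D * 2 ^ n)%N%:Z else 0.
    move=> s'L ct; have yt : y t <> 0 /\ phi s t = k%:Z - (D * 2 ^ n)%N%:Z.
      split=> [y0|]; first by apply: ct; apply/funext => x; rewrite componentE y0; case: eqP.
      by apply/eqP/negPn/negP => /negbTE E; apply: ct; apply/funext => x; rewrite componentE E.
    have [->|s's] := eqVneq s' s; first by case: yt.
    by apply: (yL s' t); [case: yt|rewrite in_cons negb_or s's].
  move=> s' t /mul_neq0[u [/star_neq0 cu ct]] s'L.
  have := cL s' _ s'L cu; rewrite phiV' => cu'.
  rewrite -(mulVKg u t) phiM (cL s' _ s'L ct).
  by apply/eqP; rewrite -oppr_eq0 opprD cu' subrr.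
rewrite (star_homM iota_hom) (star_homS iota_hom) expr2; apply: near_null_mul => //.
exact: near_null_star.
Qed.

(** A finite sum close to [h] is equally close to [J], hence small in norm by [near_null_le]. *)
Lemma null_ideal_eq0 h : J h -> h = 0.
Proof.
move=> Jh; apply: rnorm_small => e e0; have e2 : 0 < e / 2 by rewrite divr_gt0.
have [a ha] := iota_approx iota_dense h e2.
have [L aL] : exists L : seq S, forall s t, a t <> 0 -> s \notin L -> phi s t = 0.
  suff [L hL] : exists L : seq S, forall s t, t \in enum_fset (supp a) -> s \notin L ->
      phi s t = 0.
    exists L => s t at0; apply: hL.
    by have := @suppP _ _ _ a t; case: (t \in _) => // /(_ isT).
  elim: (enum_fset (supp a)) => [|t T [L IH]]; first by exists [::].
  have [L' hL'] := phi_supp t; exists (L ++ L') => s u.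
  rewrite in_cons mem_cat negb_or => /orP[/eqP ->|uT] /andP[sL sL']; first exact: hL'.
  exact: IH.
rewrite -[h](subrK (iota a)) (splitr e); apply: le_trans (rnormD _ _) _.
apply: lerD => //; apply: near_null_le aL _; first exact: ltW.
by exists h => //; rewrite rnormC.
Qed.

End Core.

(** * The regular representation *)

Section Compactness.
Variables (R : realType) (G : groupType) (P : set G).
Local Notation C := (Cplx R).
Local Notation X := (boundary P).
Hypothesis Pcone : positive_cone P.
Implicit Types (x y z t : G) (w : subsets G).

Lemma is_join_uniq x y z z' : is_join P x y z -> is_join P x y z' -> z = z'.
Proof.
have [_ _ anti] := Pcone; move=> [xz yz zm] [xz' yz' zm'].
have : (z^-1 * z')%g = 1%g.
  apply: anti; first exact: zm.
  by rewrite invgM invgK; exact: zm'.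
by move=> E; rewrite -[z']mul1g -(mulgV z) -mulgA E mulg1.
Qed.

(** Directedness survives limits because joins are unique: a second nearby set, chosen to agree with
    [w] also at the join found in the first, must contain that same join. *)
Lemma nica_closed : closed (nica_spectrum P).
Proof.
move=> w cw; have H x : exists w', [/\ nica_spectrum P w', w' x = w x & True].
  by have [w' [nw' w'x]] := cw _ (near_subsets w x); exists w'.
split.
- have [w' [[[w'1 _ _]] w'E]] := cw _ (near_subsets w 1%g).
  by rewrite -w'E.
- move=> x p wx Pp.
  have [w' [[[_ hw' _]] [w'x w'xp]]] :=
    cw _ (filterI (near_subsets w x) (near_subsets w (x * p^-1)%g)).
  by rewrite -w'xp; apply: hw' => //; rewrite w'x.
- move=> x y wx wy.
  have [w1 [[[_ _ dw1]] [w1x w1y]]] :=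
    cw _ (filterI (near_subsets w x) (near_subsets w y)).
  have [||z zj _] := dw1 x y; rewrite ?w1x ?w1y //; exists z => //.
  have [w2 [[[_ _ dw2]] [[w2x w2y] w2z]]] := cw _ (filterI
    (filterI (near_subsets w x) (near_subsets w y)) (near_subsets w z)).
  have [||z' zj' w2z'] := dw2 x y; rewrite ?w2x ?w2y //.
  by rewrite -w2z (is_join_uniq zj zj').
Qed.

Lemma boundary_compact : compact [set: X].
Proof.
have cS : compact (boundary_spectrum P).
  apply: (@subclosed_compact _ _ [set: subsets G]) => //.
    by apply: closedI; [exact: nica_closed|exact: closed_closure].
  have := @tychonoff G (fun=> bool) (fun=> [set: bool]) (fun=> bool_compact).
  by congr (compact _); apply/seteqP; split.
move=> F FF _; have FB : F (@bval G P @^-1` boundary_spectrum P).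
  by apply: (@filterS _ F _ setT) => [x _|]; [exact: bdryP|exact: filterT].
have [w [bw Fw]] := cS (@bval G P @ F) _ FB.
have [x xE] := inbdryP bw; exists x; split=> // A U FA [_ [[W oW <-] Wx] WU].
have nW : nbhs w W by rewrite xE; exact: open_nbhs_nbhs.
have FbA : F (@bval G P @^-1` (@bval G P @` A)).
  by apply: filterS FA => y Ay; exists y.
have [_ [[y Ay <-] Wy]] := Fw _ _ FbA nW.
by exists y; split=> //; exact: WU.
Qed.

Lemma continuous_bounded (f : X -> C) : continuous f ->
  exists2 M : R, 0 <= M & forall x : X, rnorm (f x : C^o) <= M.
Proof.
move=> cf; pose h (x : X) : R := complex.Re (f x * (f x)^*).
have hE (x : X) : h x = rnorm (f x : C^o) ^+ 2 by rewrite /h normC_sqr.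
have ch : continuous h.
  apply: continuous_Re => x; apply: (@continuousM C X); first exact: cf.
  by apply: (@continuous_comp X C C); [exact: cf|exact: conj_continuous].
have : compact (h @` [set: X]).
  apply: continuous_compact; last exact: boundary_compact.
  exact: continuous_subspaceT.
move=> /compact_bounded/pinfty_ex_gt0[M M0 hM].
(* From [r^2 <= M] follows [r <= M + 1], which avoids a square root. *)
exists (M + 1) => [|x]; first by rewrite addr_ge0 // ltW.
have : h x <= M by apply: le_trans (ler_norm _) (hM _ _); exists x.
rewrite hE; have := rnorm_ge0 (f x : C^o); rewrite expr2; nra.
Qed.

End Compactness.

Section WeightedTranslation.
Variables (R : realType) (G : groupType).
Local Notation C := (Cplx R).
Local Notation H := (l2_hilbert R G).
Implicit Types (s t : G) (u : G -> C) (xi eta : ell2 R G).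

Lemma sum_reindex (f : G -> R) s (F : {fset G}) :
  \sum_(t <- F) f (s * t)%g = \sum_(t <- [fset (s * t)%g | t in F]%fset) f t.
Proof. by rewrite big_imfset //= => x y _ _; exact: mulgI. Qed.

Lemma sums_reindex (f : G -> R) s r : sums f r -> sums (fun t => f (s * t)%g) r.
Proof.
move=> fr e e0; have [F0 h] := fr e e0.
exists [fset (s^-1 * t)%g | t in F0]%fset => F F0F; rewrite sum_reindex; apply: h.
apply/fsubsetP => t tF0; rewrite -[t](mulVKg s).
apply/imfsetP; exists (s^-1 * t)%g => //; apply: (fsubsetP F0F).
by apply/imfsetP; exists t.
Qed.

Lemma cdotM (z w : C) : cdot (z * w) (z * w) = rnorm (z : C^o) ^+ 2 * cdot w w.
Proof. by rewrite cdotJ mulrA [z^* * z]mulrC normC_sqr cdotC cdotZl. Qed.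

Definition weighted u s (xi : G -> C) : G -> C := fun t => u t * xi (s^-1 * t)%g.

Variables (u : G -> C) (M : R).
Hypothesis uM : forall t, rnorm (u t : C^o) <= M.

Let M0 : 0 <= M. Proof. exact: le_trans (rnorm_ge0 _) (uM 1%g). Qed.

Lemma weighted_sum_le s xi (F : {fset G}) :
  \sum_(t <- F) cdot (weighted u s xi t) (weighted u s xi t) <= M ^+ 2 * l2ip xi xi.
Proof.
apply: (@le_trans _ _ (\sum_(t <- F) M ^+ 2 * cdot (xi (s^-1 * t)%g) (xi (s^-1 * t)%g))).
  apply: ler_sum => t _; rewrite cdotM ler_wpM2r ?cdot_ge0 //.
  by rewrite ler_pXn2r ?nnegrE ?rnorm_ge0.
rewrite -mulr_sumr ler_wpM2l ?exprn_ge0 //.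
by rewrite (sum_reindex (fun t => cdot (xi t) (xi t))); exact: l2ip_sum_le.
Qed.

Lemma weighted_l2 s xi : weighted u s xi \in @l2 R G.
Proof. by apply/asboolP; exists (M ^+ 2 * l2ip xi xi); exact: weighted_sum_le. Qed.

Definition wtrans s (xi : H) : H := Ell2 (weighted_l2 s xi).

Lemma wtransE s (xi : H) t :
  (wtrans s xi : ell2 R G) t = u t * (xi : ell2 R G) (s^-1 * t)%g.
Proof. by []. Qed.

Lemma wtrans_bounded s : bounded_by (wtrans s) M.
Proof.
move=> xi; rewrite -(ler_pXn2r (n := 2)) ?nnegrE ?mulr_ge0 ?hnorm_ge0 //.
rewrite exprMn !hnorm_sqr.
by apply: sums_le (l2ipP (wtrans s xi) (wtrans s xi)) => F; exact: weighted_sum_le.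
Qed.

End WeightedTranslation.

Section HilbertCoordinates.
Variables (R : realType) (G : groupType).
Local Notation H := (l2_hilbert R G).
Implicit Types x y : H.

Lemma l2_hilbertZ (k : Cplx R) x t : (k *: x : ell2 R G) t = k * (x : ell2 R G) t.
Proof. by []. Qed.
Lemma l2_hilbertD x y t : (x + y : ell2 R G) t = (x : ell2 R G) t + (y : ell2 R G) t.
Proof. by []. Qed.

End HilbertCoordinates.

Section WeightedOperator.
Variables (R : realType) (G : groupType).
Local Notation C := (Cplx R).
Local Notation H := (l2_hilbert R G).
Variables (u : G -> C) (M : R) (uM : forall t, rnorm (u t : C^o) <= M) (s : G).

Definition dual_weight (t : G) : C := (u (s * t)%g)^*.

Lemma dual_weight_bound t : rnorm (dual_weight t : C^o) <= M.
Proof. by rewrite /rnorm norm_conjC; exact: uM. Qed.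

Lemma wtrans_adjoint : adjoint (wtrans uM s) (wtrans dual_weight_bound s^-1%g).
Proof.
move=> xi eta; apply: l2ipE; have := sums_reindex s^-1%g (l2ipP xi (wtrans dual_weight_bound s^-1%g eta)).
congr sums; apply/funext => t.
by rewrite /= /weighted /dual_weight !mulVKg invgK mulVKg -cdotJ.
Qed.

Lemma wtrans_operator : wtrans uM s \in @operator R H.
Proof.
apply/asboolP; split.
- move=> k xi; apply: l2_eq => t; rewrite l2_hilbertZ.
  by rewrite !wtransE l2_hilbertZ mulrCA.
- by exists (wtrans dual_weight_bound s^-1%g); exact: wtrans_adjoint.
- by exists M; exact: wtrans_bounded.
Qed.

Definition wop : opH H := OpH wtrans_operator.

End WeightedOperator.

Section RegularRep.
Variables (R : realType) (G : groupType) (P : set G).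
Local Notation C := (Cplx R).
Local Notation X := (boundary P).
Local Notation K := (crossed_sums R P).
Local Notation H := (l2_hilbert R G).
Hypothesis Pcone : positive_cone P.
Variable x0 : X.
Implicit Types (a b : K) (s t r : G).

(** Evaluation of [a s] along the orbit of [x0], at [t x0]. The action is partial and [t x0] may
    leave the boundary; the weight is then 0, so all of l^2 (G) carries the representation. *)
Definition coef_weight a s t : C := extend (a s) (translate t (bval x0)).

Lemma coef_weight_bounded a s : exists M, forall t, rnorm (coef_weight a s t : C^o) <= M.
Proof.
have [M M0 aM] := continuous_bounded Pcone (@crossed_cts _ _ _ a s).
exists M => t; rewrite /coef_weight /extend; case: insub => [y|]; first exact: aM.
by rewrite rnorm0.
Qed.

Definition coef_op a s : opH H := wop (projT2 (cid (coef_weight_bounded a s))) s.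

Definition rep a : opH H := \sum_(s <- supp a) coef_op a s.

Lemma op_sumE (I : Type) (l : seq I) (F : I -> opH H) (xi : H) :
  (\sum_(i <- l) F i) xi = \sum_(i <- l) F i xi.
Proof.
elim: l => [|i l IH]; first by rewrite !big_nil.
by rewrite !big_cons op_D IH.
Qed.

Lemma l2_sumE (I : Type) (l : seq I) (F : I -> ell2 R G) t :
  (\sum_(i <- l) F i) t = \sum_(i <- l) F i t.
Proof.
elim: l => [|i l IH]; first by rewrite !big_nil.
by rewrite !big_cons l2D IH.
Qed.

Lemma repE a (xi : ell2 R G) t : (rep a xi : ell2 R G) t =
  \sum_(s \in [set: G]) coef_weight a s t * xi (s^-1 * t)%g.
Proof.
rewrite /rep op_sumE l2_sumE (fsbigTE (supp a)) // => s /suppP as0.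
by rewrite /coef_weight as0 extend0 mul0r.
Qed.

Lemma repE_fset a (T : {fset G}) (xi : ell2 R G) t :
  {in [predC T], forall s, a s = 0} -> (rep a xi : ell2 R G) t =
  \sum_(s <- T) coef_weight a s t * xi (s^-1 * t)%g.
Proof.
move=> aT; rewrite repE (fsbigTE T) // => s sT.
by rewrite /coef_weight aT // extend0 mul0r.
Qed.

Lemma rep_linear (k : C) a b : rep (k *: a + b) = k *: rep a + rep b.
Proof.
apply: op_eq => xi; apply: l2_eq => t.
pose T := (supp a `|` supp b)%fset.
have aT : {in [predC T], forall s, a s = 0}.
  by move=> s; rewrite inE /= in_fsetU negb_or => /andP[/suppP].
have bT : {in [predC T], forall s, b s = 0}.
  by move=> s; rewrite inE /= in_fsetU negb_or => /andP[_ /suppP].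
have abT : {in [predC T], forall s, (k *: a + b) s = 0}.
  by move=> s sT; rewrite -[LHS]/(k *: a s + b s) aT // bT // scaler0 addr0.
rewrite (repE_fset _ _ abT) op_D op_Z l2_hilbertD l2_hilbertZ.
rewrite (repE_fset _ _ aT) (repE_fset _ _ bT) mulr_sumr -big_split /=.
apply: eq_bigr => s _; rewrite /coef_weight -[(k *: a + b) s]/(k *: a s + b s).
by rewrite extendD extendZ mulrDl mulrA.
Qed.

Lemma rep_mul a b : rep (a ** b) = smul (rep a) (rep b).
Proof.
apply: op_eq => xi; apply: l2_eq => t; rewrite -[RHS]/((rep a (rep b xi) : ell2 R G) t).
pose U := [fset (s * r)%g | s in supp a, r in supp b]%fset.
have abU s v : s \in supp a -> v \notin U -> b (s^-1 * v)%g = 0.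
  move=> sa vU; apply: suppP; apply: contra vU => sv.
  by apply/imfset2P; exists s => //; exists (s^-1 * v)%g => //; rewrite mulVKg.
rewrite (@repE_fset _ U); last first.
  move=> v vU; apply/funext => z.
  rewrite [LHS](@crossed_mul_fset _ _ _ _ _ (supp a)); last by move=> s /suppP.
  by rewrite big_seq big1 // => s sa; rewrite (abU s) // extend0 mulr0.
rewrite (@repE_fset a (supp a)); last by move=> s /suppP.
have [wb|wb] := pselect (boundary_spectrum P (translate t (bval x0))); last first.
  rewrite !big1 // => s _; by rewrite /coef_weight extend_out // mul0r.
have abE v : coef_weight (a ** b) v t = \sum_(s <- supp a)
    coef_weight a s t * coef_weight b (s^-1 * v)%g (s^-1 * t)%g.
  rewrite /coef_weight [LHS]extend_mul // (fsbigTE (supp a)); last first.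
    by move=> s /suppP ->; rewrite extend0 mul0r.
  by apply: eq_bigr => s _; rewrite translateM.
under eq_bigr => v _ do rewrite abE mulr_suml.
rewrite exchange_big [LHS]big_seq [RHS]big_seq; apply: eq_bigr => s sa /=.
rewrite repE mulr_fsumr (reindex_fsbigT (fun v => s^-1 * v)%g); last first.
  by exists (fun v => s * v)%g => v; rewrite ?mulKg ?mulVKg.
rewrite (fsbigTE U); last first.
  by move=> v vU; rewrite /coef_weight abU // extend0 mul0r mulr0.
by apply: eq_bigr => v _; rewrite mulrA invgM invgK -mulgA mulVKg.
Qed.

Lemma coef_weight_star a s t :
  coef_weight (star a) s^-1%g t = (coef_weight a s (s * t)%g)^*.
Proof.
rewrite /coef_weight translateM.
have [wb|wb] := pselect (boundary_spectrum P (translate t (bval x0))).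
  by have [y ->] := inbdryP wb; rewrite extend_val starE !invgK.
rewrite extend_out // -[LHS](conjC0 C); congr (_^*).
have [wb'|wb'] := pselect (boundary_spectrum P (translate s (translate t (bval x0)))); last first.
  by rewrite extend_out.
have [y yE] := inbdryP wb'; rewrite yE extend_val crossed_supp //.
apply/negP => ys; apply: wb.
by rewrite -[translate t _](translateK s) yE; have [z ->] := inbdry_translate ys; exact: bdryP.
Qed.

Lemma rep_star a : rep (star a) = star (rep a).
Proof.
apply: op_eq => xi; apply: l2_eq => t.
rewrite (@repE_fset _ [fset s^-1%g | s in supp a]%fset); last first.
  move=> r rT; apply/funext => x; rewrite starE (_ : a r^-1%g = 0) ?extend0 ?conjC0 //.
  apply: suppP; apply: contra rT => ra; apply/imfsetP; exists r^-1%g => //.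
  by rewrite invgK.
rewrite big_imfset /=; last by move=> x y _ _; exact: invg_inj.
have E : star (rep a) = \sum_(s <- supp a) star (coef_op a s) by exact: star_sum.
transitivity (((\sum_(s <- supp a) star (coef_op a s) : opH H) xi : ell2 R G) t); last first.
  by rewrite -E.
rewrite op_sumE l2_sumE; apply: eq_bigr => s _.
have -> : star (coef_op a s) =
    wop (dual_weight_bound (projT2 (cid (coef_weight_bounded a s))) s) s^-1%g.
  by apply: op_starP => y z; exact: wtrans_adjoint.
by rewrite [RHS]wtransE coef_weight_star.
Qed.

Lemma rep_hom : star_hom rep.
Proof. by split; [exact: rep_linear|exact: rep_mul|exact: rep_star]. Qed.

Lemma point_mass_l2 : (fun t => if t == 1%g then 1 else 0) \in @l2 R G.
Proof.
apply/asboolP; exists 1 => F.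
have E t : cdot (if t == 1%g then 1 : C else 0) (if t == 1%g then 1 else 0) =
    if t == 1%g then 1 else 0 :> R.
  by case: eqP; rewrite /cdot /= ?mulr1 ?mulr0 addr0.
rewrite (eq_bigr _ (fun t _ => E t)).
have [F1|F1] := boolP (1%g \in F); last first.
  rewrite big_seq big1 // => t tF; case: eqP tF => // ->.
  by rewrite (negbTE F1).
rewrite (big_fsetD1 _ F1) /= eqxx.
rewrite big_seq big1 ?addr0 // => t.
by rewrite in_fsetD1 => /andP[/negbTE -> _].
Qed.

Lemma rep_kone : rep (kone R P) != 0.
Proof.
(* The point mass at 1 sits over [x0] itself, where the unit has coefficient 1. *)
apply/eqP => E; have := repE (kone R P) (Ell2 point_mass_l2) 1%g.
rewrite E (fsbigTE [fset 1%g]%fset) ?big_seq_fset1 /=; last first.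
  move=> s; rewrite !inE => /negbTE s1; rewrite /coef_weight (_ : kone R P s = 0).
    by rewrite extend0 mul0r.
  by apply/funext => x; rewrite monomialE ?s1 //; exact: ind_dom.
rewrite invg1 mul1g eqxx mulr1 /coef_weight translate1 extend_val monomialE; last exact: ind_dom.
by rewrite eqxx ind1 => /eqP; rewrite eq_sym oner_eq0.
Qed.

End RegularRep.

(** * Pure infiniteness and simplicity *)

Section InfiniteProjection.
Variables (C : numClosedFieldType) (B : cstarAlgType C) (e v s : B).

(** The isometry [v] carries the unit to [v ** star v] and transports the non-unitary isometry [s]
    to the partial isometry [v ** s ** star v] inside that corner. *)
Lemma infinite_range_projection : is_unit e -> star v ** v = e ->
  star s ** s = e -> s ** star s <> e -> infinite_projection (v ** star v).
Proof.
move=> eu vE sE se; have [el er] := eu.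
have qE : v ** s ** star v ** star (v ** s ** star v) = v ** (s ** star s) ** star v.
  by rewrite !stM starK !sMA -[v ** s ** _ ** v]sMA vE er.
have ssE : (s ** star s) ** (s ** star s) = s ** star s.
  by rewrite sMA -[s ** _ ** s]sMA sE er.
split; first by rewrite /projection stM starK sMA -[v ** _ ** v]sMA vE er.
exists (v ** s ** star v) => q; have {}qE : q = v ** (s ** star s) ** star v by [].
clearbody q; split.
- rewrite !stM starK !sMA -[v ** star s ** _ ** v]sMA vE er.
  by rewrite -[v ** star s ** s]sMA sE er.
- split; first by rewrite qE !stM !starK !sMA.
  rewrite qE; move: (s ** star s) ssE => T TT.
  by rewrite !sMA -[v ** T ** _ ** v]sMA vE er -[v ** T ** T]sMA TT.
- exists ((e - s ** star s) ** star v).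
  rewrite stM starK starB (star_unit eu) stM starK -sMA.
  rewrite [(e - _) ** (_ ** star v)]sMA smulBl smulBr smulBr ssE !el er subrr subr0.
  by rewrite smulBl smulBr el qE !sMA.
move=> qp; apply: se; have : star v ** q ** v = star v ** (v ** star v) ** v by rewrite qp.
by rewrite qE !sMA vE !el -!sMA vE !er.
Qed.

End InfiniteProjection.

Section PureInfiniteness.
Variables (R : realType) (G : groupType) (P : set G).
Local Notation C := (Cplx R).
Local Notation X := (boundary P).
Local Notation K := (crossed_sums R P).
Hypothesis P1 : P 1%g.
Hypothesis PM : forall x y, P x -> P y -> P (x * y)%g.
Hypothesis joinP : forall x y z, po_le P x z -> po_le P y z ->
  exists j, is_join P x y j.
Hypothesis freeP : forall t : G, t != 1%g -> exists2 s, P s &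
  forall z, ~ (po_le P s z /\ po_le P (t * s)%g z).
Variables (B : cstarAlgType C) (iota : K -> B).
Hypothesis iota_hom : star_hom iota.
Hypothesis iota_dense : closure (range iota) = [set: B].
Local Notation unit1 := (iota (kone R P)).
Hypothesis unit1_neq0 : unit1 != 0.
Hypothesis null_eq0 : forall h, null_ideal iota h -> h = 0.
Implicit Types (a : K) (h : B) (x y : X).

Let unitB : is_unit unit1 := iota_unit iota_hom iota_dense.

Lemma large_coef h : h != 0 -> exists2 k : R, 0 < k & forall d : R, 0 < d ->
  exists a, rnorm (h - iota a) <= d /\
  exists y, rC k <= (star a ** a) 1%g y.
Proof.
move=> h0; have [a0 [t [x hx]]] : exists a0 t x,
    rnorm (h - iota a0) < rnorm (a0 t x : C^o).
  apply: contrapT => H; case/eqP: h0; apply: null_eq0 => a t x.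
  by rewrite leNgt; apply/negP => ax; apply: H; exists a, t, x.
pose k0 := rnorm (a0 t x : C^o) - rnorm (h - iota a0).
have k0_gt0 : 0 < k0 by rewrite subr_gt0.
have k2 : 0 < k0 / 2 by rewrite divr_gt0.
(* The constant must precede [d], which will later be chosen from it. A coefficient exceeding the
   distance to [h] by [k0] leaves at least [k0 / 2] for every finite sum within [k0 / 2] of [h]. *)
exists ((k0 / 2) ^+ 2) => [|d d0]; first exact: exprn_gt0.
have m0 : 0 < Num.min d (k0 / 2) by rewrite lt_min d0.
have [a ha] := iota_approx iota_dense h m0; exists a.
move: ha; rewrite le_min => /andP[ha ha']; split=> //.
have ax : k0 / 2 <= rnorm (a t x : C^o).
  have := coef_le P1 PM joinP freeP iota_hom unit1_neq0 (a0 - a) t x.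
  rewrite (star_homB iota_hom) => c1.
  have c2 := rnorm_dist h (iota a0) (iota a); rewrite [rnorm (iota a0 - h)]rnormC in c2.
  have c3 := rnormD ((a0 - a) t x : C^o) (a t x : C^o); rewrite sumsDE sumsNE subrK in c3.
  rewrite sumsDE sumsNE in c1; rewrite /k0 in ha' *; lra.
have xt : bval x t.
  apply: contraTT ax => xt; rewrite crossed_supp // rnorm0 -ltNge; exact: k2.
have [y yE] := inbdry_translate xt; exists y.
apply: le_trans (star_mul1_ge a (esym yE)); rewrite (@rnormE _ C^o) -rCX rC_le.
by rewrite ler_pXn2r ?nnegrE ?rnorm_ge0 // ltW.
Qed.

Lemma exists_isometry h : h != 0 -> exists x : B, star (h ** x) ** (h ** x) = unit1.
Proof.
move=> h0; have [k k0 hk] := large_coef h0.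
have M0 : 0 < 2 * rnorm h + 1 by rewrite ltr_wpDl ?mulr_ge0 ?rnorm_ge0.
(* A quarter of [k] is spent on replacing [h] by [a] and a quarter on the compression; together they
   are at most half of [g], as [near_unit_inverse_sqrt] requires. The factor [2 * rnorm h + 1]
   bounds the sum of the norms of [h] and [iota a], using [d <= 1]. *)
pose d := Num.min 1 (k / 4 / (2 * rnorm h + 1)).
have d0 : 0 < d by rewrite lt_min ltr01 !divr_gt0.
have [a [ha [y ky]]] := hk _ d0.
pose g := complex.Re ((star a ** a) 1%g y).
have gE : (star a ** a) 1%g y = rC g.
  rewrite /rC /g RRe_real // realE (le_trans _ ky) //.
  by rewrite -[0]/(rC 0) rC_le ltW.
have kg : k <= g by rewrite -rC_le -gE.
have g0 : 0 < g by exact: lt_le_trans kg.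
have k4 : 0 < k / 4 by rewrite divr_gt0.
have [r Pr hr] := compression P1 PM joinP freeP iota_hom (star a ** a) y k4.
have dh : rnorm (star h ** h - iota (star a ** a)) <= k / 4.
  rewrite (star_homM iota_hom) (star_homS iota_hom); set b := iota a in ha *.
  have -> : star h ** h - star b ** b = star h ** (h - b) + star (h - b) ** b.
    by rewrite starB smulBr smulBl addrA subrK.
  have rb : rnorm b <= rnorm h + 1.
    rewrite -[b](subKr h); apply: le_trans (rnormD _ _) _; rewrite rnormN.
    rewrite lerD2l; apply: le_trans ha _.
    by rewrite /d ge_min lexx.
  apply: le_trans (rnormD _ _) _.
  have e1 := rnormM_le (lexx (rnorm (star h))) ha.
  have e2 := rnormM_le (s := d) (a := star (h - b)) (b := b) _ rb.
  apply: le_trans (lerD e1 (e2 _)) _; first by rewrite rnorm_star.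
  rewrite rnorm_star -[leRHS](divfK (lt0r_neq0 M0)).
  have dM : d <= k / 4 / (2 * rnorm h + 1) by rewrite /d ge_min lexx orbT.
  apply: le_trans (ler_wpM2r (ltW M0) dM); rewrite le_eqVlt; apply/orP; left.
  by apply/eqP; ring.
pose v := isoB iota r; pose w := star v ** (star h ** h) ** v.
have sw : star w = w by rewrite /w !stM !starK !sMA.
have wg : rnorm (w - rC g *: unit1) <= k / 2.
  apply: le_trans (rnorm_dist (star v ** iota (star a ** a) ** v) _ _) _.
  have -> : k / 2 = k / 4 + k / 4 by lra.
  apply: lerD; last by rewrite -gE.
  rewrite -smulBl -smulBr; have rv := rnorm_isoB iota_hom Pr.
  have rs : rnorm (star v) <= 1 by rewrite rnorm_star.
  by have := rnormM_le (rnormM_le rs dh) rv; rewrite mulr1 mul1r.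
have [||z sz zE] := @near_unit_inverse_sqrt _ _ unit1 (rC g^-1 *: w) unitB.
- by rewrite stZ rC_conj sw.
- have -> : unit1 - rC g^-1 *: w = rC g^-1 *: (rC g *: unit1 - w).
    by rewrite scalerBr scalerA -rCM mulVf ?gt_eqF // scale1r.
  rewrite rnormZr rnormC ger0_norm ?invr_ge0 ?(ltW g0) // mulrC.
  rewrite ler_pdivrMr //; apply: le_trans wg _; lra.
exists (rC (Num.sqrt g^-1) *: (v ** z)).
rewrite sMZr stZ sMZl sMZr scalerA rC_conj -rCM -expr2 sqr_sqrtr ?invr_ge0 ?(ltW g0) //.
by rewrite -zE sMZr sMZl; congr (_ *: _); rewrite !stM sz /w !sMA.
Qed.

Lemma crossed_simple : simple_cstar B.
Proof.
split=> [|I [_ [I0 _] IM]]; first by exists unit1.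
have [[h [Ih h0]]|In] := pselect (exists h, I h /\ h != 0); last first.
  left; apply/seteqP; split=> [h Ih|h ->//]; apply: contrapT => h0.
  by apply: In; exists h; split=> //; exact/eqP.
right; apply/seteqP; split=> // b _; have [x xE] := exists_isometry h0.
have [_ ur] := unitB; rewrite -[b]ur -xE.
have [_ Ihx] := IM x h Ih.
have [IhX _] := IM (star (h ** x)) _ Ihx.
by have [] := IM b _ IhX.
Qed.

(** At a point outside [U_r] the coefficient at 1 of the complementary projection has value 1, so
    that projection is not 0. *)
Lemma isoB_range_proper r x : P r -> ~~ bval x r ->
  isoB iota r ** star (isoB iota r) <> unit1.
Proof.
move=> Pr xr E.
have := coef1_le P1 PM joinP freeP iota_hom unit1_neq0
  (kone R P - iso R P r ** star (iso R P r)) x.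
rewrite (star_homB iota_hom) (star_homM iota_hom) (star_homS iota_hom).
rewrite -/(isoB iota r) E subrr rnorm0 sumsDE sumsNE monomialE; last exact: ind_dom.
rewrite eqxx ind1 monomial_mul; last exact: ind_dom.
rewrite /ind (negbTE xr) mul0r subr0 => h.
have : (rC 1 : C) <= rC 0.
  by rewrite rC_le; apply: le_trans h; rewrite /rnorm normr1.
by rewrite rC_le ler10.
Qed.

Lemma crossed_purely_infinite (g : G) : P g -> g != 1%g -> purely_infinite B.
Proof.
move=> Pg g1 H [[_ [H0 HZ] HM Hs] Hher] [h Hh h0].
have [x xE] := exists_isometry h0.
have [k k0 [c cE]] := norm_minus_mul_star x unitB.
have [r [Pr [y yr]]] := boundary_proper P1 PM joinP freeP Pg g1.
exists (h ** x ** star (h ** x)); last first.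
  apply: (infinite_range_projection unitB xE (isoB_isometry iota_hom Pr)).
  exact: isoB_range_proper yr.
(* Conjugating [rC k *: unit1 - x ** star x = star c ** c] by [h] places the projection below a
   multiple of [h ** star h], which belongs to [H]. *)
apply: (Hher _ (rC k *: (h ** star h))).
- by rewrite -[_ *: _]addr0; apply: HZ => //; exact/HM/Hs.
- by exists (star (h ** x)); rewrite subr0 starK.
have [_ er] := unitB; exists (c ** star h).
have -> : star (c ** star h) ** (c ** star h) = h ** (star c ** c) ** star h.
  by rewrite stM starK !sMA.
by rewrite -cE smulBr smulBl sMZr sMZl er stM !sMA.
Qed.

End PureInfiniteness.

Theorem corollary5p7 (R : realType) (S : countType) (e : rel S)
    (S_nonempty : inhabited S) (e_sym : symmetric e) (e_irr : irreflexive e)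
    (no_ZN : ~ has_ZN_direct_factor (raag_pos (e := e)))
    (B : cstarAlgType (Cplx R))
    (iota : crossed_sums R (raag_pos (e := e)) -> B)
    (B_crossed_product : universal_cstar_completion iota) :
  purely_infinite B /\ simple_cstar B.
Proof.
have [iota_hom iota_dense iota_univ] := B_crossed_product.
pose P := raag_pos (e := e).
have P1 : P 1%g by exact: raag_pos1.
have PM : forall x y, P x -> P y -> P (x * y)%g by exact: raag_pos_mul.
have joinP := raag_join e_sym e_irr; have freeP := raag_free e_sym e_irr no_ZN.
have [x0] := boundary_inhabited P1 PM joinP.
(* The regular representation factors through [iota] and does not kill the unit, which rules out
   [B = 0]. *)
have unit1_neq0 : iota (kone R P) != 0.
  have repP := rep_hom R (raag_positive_cone e) x0.
  have [g g_hom gE] := iota_univ _ _ repP.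
  apply: contraNneq (rep_kone R (raag_positive_cone e) x0) => i0.
  by rewrite -gE i0 (star_hom0 g_hom).
have null_eq0 h : null_ideal iota h -> h = 0.
  apply: (null_ideal_eq0 P1 PM joinP freeP (phi := @raag_expo S e)) => //.
  - by move=> s x y; exact: raag_expoM.
  - by move=> s x; exact: raag_expo_ge0.
  - exact: raag_expo_support.
  - exact: raag_control.
  - exact: raag_expo_finite.
  - exact: iota_univ.
split; last first.
  exact: (crossed_simple P1 PM joinP freeP iota_hom iota_dense unit1_neq0 null_eq0).
(* A generator is positive and differs from 1 by its exponent; [boundary_proper] turns it into an
   isometry that is not unitary. *)
case: S_nonempty => s.
have gE : raag_gen e s = raag_mon e [:: s] by rewrite raag_mon_cons mulg1.
apply: (crossed_purely_infinite P1 PM joinP freeP iota_hom iota_dense unit1_neq0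
  null_eq0 (g := raag_gen e s)).
  by rewrite gE; exact: raag_pos_mon.
apply/eqP => /(congr1 (raag_expo s)).
by rewrite raag_expo1 gE raag_expo_mon /= eqxx.
Qed.
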